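(* Let $1\le k\le n$ and $f\in\mathcal S'(\mathbb R^n)$. If $f$ is $k$-directionally regular at $(P_{e^k,x^k},\xi)$ for every $x^k\in\mathbb R^k$ and every $\xi\in\mathbb R^n\setminus\{0\}$, then $f\in\mathcal E(\mathbb R^n)$, i.e. $f$ is a $C^\infty$ function on $\mathbb R^n$.
   Context: $e^k=(e_1,\dots,e_k)$ denotes the first $k$ coordinate directions; for $t\in\mathbb R^n$, $t^k=(t_1,\dots,t_k)$. For $x^k\in\mathbb R^k$, $P_{e^k,x^k}=\{t\in\mathbb R^n:\ t^k=x^k\}$. $g^k\in(\mathcal D(\mathbb R))^k$ means $g^k(t^k)=g_1(t_1)\cdots g_k(t_k)$ with $g_i\in\mathcal D(\mathbb R)=C_c^\infty(\mathbb R)$. For $x_0^k=(x_{0,1},\dots,x_{0,k})$, $L_r(x_0^k)=L_r(x_{0,1})\times\dots\times L_r(x_{0,k})$ with $L_r(a)=(a-r,a+r)$. For $f\in\mathcal S'(\mathbb R^n)$, $DS_{g^k,e^k}f(x^k,\cdot)=\mathcal F\bigl(f(t)\overline{g^k(t^k-x^k)}\bigr)\in\mathcal S'(\mathbb R^n)$, with $\mathcal F\varphi(\xi)=\int_{\mathbb R^n}e^{-2\pi i t\cdot\xi}\varphi(t)dt$ extended to $\mathcal S'(\mathbb R^n)$. Definition: $f\in\mathcal S'(\mathbb R^n)$ is $k$-directionally regular at $(P_{e^k,x_0^k},\xi_0)$, $\xi_0\ne0$, if there exist $g^k\in(\mathcal D(\mathbb R))^k$ with $g^k(0)\ne0$,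 $r>0$ and an open cone $\Gamma_{\xi_0}$ containing $\xi_0$ such that for every $N\in\mathbb N$ there exists $C_N>0$ with $|DS_{g^k,e^k}f(x^k,\xi)|\le C_N(1+|\xi|^2)^{-N/2}$ for all $x^k\in L_r(x_0^k)$ and $\xi\in\Gamma_{\xi_0}$ (meaning that the restriction of the distribution $DS_{g^k,e^k}f(x^k,\cdot)$ to $\Gamma_{\xi_0}$ is a function satisfying the bound). *)

(* Defs.v *)
From HB Require Import structures.
From mathcomp Require Import all_boot all_order all_algebra.
From mathcomp Require Import complex.
From mathcomp Require Import all_classical all_reals all_analysis.
Set Implicit Arguments.
Unset Strict Implicit.
Unset Printing Implicit Defensive.
Import Order.TTheory GRing.Theory Num.Theory.
Import numFieldNormedType.Exports.
Import Normc.
Local Notation Re := complex.Re.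
Local Notation Im := complex.Im.
Local Open Scope classical_set_scope.
Local Open Scope ring_scope.

(* Lebesgue measure on R^n, as the n-fold product of [lebesgue_measure]. The
   measurable structure of the library is on [n.-tuple R]; the topology and
   the derivatives are on ['rV[R]_n]. The two are identified by [rowt]. *)
Section LebesgueMeasureOnTuples.
Context {R : realType}.
Local Notation RR := (measurableTypeR R).

Definition tcons n (x : RR * n.-tuple RR) : n.+1.-tuple RR :=
  [tuple of x.1 :: x.2].

Definition tuncons n (t : n.+1.-tuple RR) : RR * n.-tuple RR :=
  (thead t, [tuple of behead t]).

Lemma tconsK n : cancel (@tcons n) (@tuncons n).
Proof.
case=> x t; rewrite /tuncons /tcons /= theadE; congr pair.
exact/val_inj.
Qed.

Lemma measurable_tcons n : measurable_fun setT (@tcons n).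
Proof. exact: (measurable_cons measurable_fst measurable_snd). Qed.

HB.instance Definition _ n :=
  isMeasurableFun.Build _ _ _ _ (@tcons n) (@measurable_tcons n).

Lemma measurable_tuncons n : measurable_fun setT (@tuncons n).
Proof.
apply/measurable_fun_pairP; split; first exact: (measurable_tnth ord0).
exact: measurable_behead.
Qed.

Section Step.
Context n (mu : {sigma_finite_measure set (n.-tuple RR) -> \bar R}).

Definition lebesgue_tcons : set (n.+1.-tuple RR) -> \bar R :=
  pushforward (@lebesgue_measure R \x mu)%E (@tcons n).

Let lebesgue_tcons0 : lebesgue_tcons set0 = 0%E.
Proof. exact: measure0. Qed.

Let lebesgue_tcons_ge0 A : (0 <= lebesgue_tcons A)%E.
Proof. exact: measure_ge0. Qed.

Let lebesgue_tcons_sigma_additive : semi_sigma_additive lebesgue_tcons.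
Proof. exact: measure_semi_sigma_additive. Qed.

HB.instance Definition _ := isMeasure.Build _ _ _ lebesgue_tcons
  lebesgue_tcons0 lebesgue_tcons_ge0 lebesgue_tcons_sigma_additive.

Let prod_sigma_finite : sigma_finite setT (@lebesgue_measure R \x mu)%E.
Proof.
have /sigma_finiteP[F [TF ndF Foo]] := sigma_finiteT (@lebesgue_measure R).
have /sigma_finiteP[G [TG ndG Goo]] := sigma_finiteT mu.
exists (fun i => F i `*` G i).
  rewrite -setXTT TF TG predeqE => -[x y]; split.
    move=> [/= [i _ Fix] [j _ Gjy]]; exists (maxn i j) => //; split.
    - by move: x Fix; exact/subsetPset/ndF/leq_maxl.
    - by move: y Gjy; exact/subsetPset/ndG/leq_maxr.
  by move=> [i _ []/= ? ?]; split; exists i.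
move=> i; have [? ?] := Foo i; have [? ?] := Goo i.
split; first exact: measurableX.
by rewrite product_measure1E// lte_mul_pinfty// ge0_fin_numE.
Qed.

Lemma lebesgue_tcons_sigma_finite : sigma_finite setT lebesgue_tcons.
Proof.
have [F FT Ffin] := prod_sigma_finite.
exists (fun i => @tuncons n @^-1` F i).
  by rewrite -preimage_bigcup -FT preimage_setT.
move=> i; have [mF Foo] := Ffin i; split.
  by rewrite -[X in measurable X]setTI; exact: measurable_tuncons.
rewrite /lebesgue_tcons /pushforward -comp_preimage.
by rewrite (_ : _ \o _ = id) ?preimage_id//; apply/funext => x; exact: tconsK.
Qed.

HB.instance Definition _ :=
  @Measure_isSigmaFinite.Build _ _ _ lebesgue_tcons lebesgue_tcons_sigma_finite.

End Step.

Fixpoint lebesgue_tuple n :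
    {sigma_finite_measure set (n.-tuple RR) -> \bar R} :=
  match n with
  | 0 => \d_([tuple] : 0.-tuple RR)
  | m.+1 => lebesgue_tcons (lebesgue_tuple m)
  end.

Lemma lebesgue_tuple_box n (A : 'I_n -> set RR) :
  (forall i, measurable (A i)) ->
  lebesgue_tuple n [set t | forall i, A i (tnth t i)] =
  (\prod_(i < n) lebesgue_measure (A i))%E.
Proof.
elim: n A => [|n IH] A mA.
  rewrite big_ord0 /= diracE mem_set//.
  by case.
rewrite big_ord_recl -IH//= /lebesgue_tcons /pushforward.
rewrite -product_measure1E//; last first.
  rewrite (_ : mkset _ =
    \bigcap_(i in [set: 'I_n]) ((@tnth n RR ^~ i) @^-1` (A (lift ord0 i)))).
    apply: fin_bigcap_measurable => [|i _]; first exact: finite_finset.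
    by rewrite -[X in measurable X]setTI; exact: measurable_tnth.
  by apply/seteqP; split=> [t + i _|t + i]; apply.
congr (_ _); apply/seteqP; split=> -[x t] /=.
  move=> h; split; first exact: (h ord0).
  by move=> i; have := h (lift ord0 i); rewrite tnthS.
move=> [Ax h] i; case: (unliftP ord0 i) => [j|] ->//.
by rewrite tnthS; exact: h.
Qed.

End LebesgueMeasureOnTuples.

Section RealSpace.
Context {R : realType} {n : nat}.
Local Notation C := R[i].
Implicit Types (u phi : 'rV[R]_n -> C) (K Omega : set 'rV[R]_n).

Definition rowt (t : n.-tuple (measurableTypeR R)) : 'rV[R]_n :=
  \row_i tnth t i.

Definition integral_Rn u : C :=
  (\int[lebesgue_tuple n]_t Re (u (rowt t)) +i*
   \int[lebesgue_tuple n]_t Im (u (rowt t)))%C.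

Definition locally_integrable_Rn Omega u : Prop :=
  forall K, compact K -> K `<=` Omega ->
    (lebesgue_tuple n).-integrable (rowt @^-1` K)
      (fun t => (Re (u (rowt t)))%:E) /\
    (lebesgue_tuple n).-integrable (rowt @^-1` K)
      (fun t => (Im (u (rowt t)))%:E).

Definition dotp (x y : 'rV[R]_n) : R := \sum_i x 0 i * y 0 i.

(* [1 + |x|^2] for the Euclidean norm; the library norm on ['rV[R]_n] is the
   sup norm. *)
Definition bracket2 (x : 'rV[R]_n) : R := 1 + dotp x x.

(* [iter_partial [:: i_1; ...; i_m] v] is the mixed partial derivative
   [d_{i_1} ... d_{i_m} v]. *)
Definition iter_partial (a : seq 'I_n) (v : 'rV[R]_n -> R) : 'rV[R]_n -> R :=
  foldr (fun i w => 'D_(delta_mx 0 i) w) v a.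

Definition iter_partialC (a : seq 'I_n) u : 'rV[R]_n -> C := fun x =>
  (iter_partial a (fun t => Re (u t)) x +i*
   iter_partial a (fun t => Im (u t)) x)%C.

Definition smooth_real (v : 'rV[R]_n -> R) : Prop :=
  forall a : seq 'I_n, continuous (iter_partial a v) /\
    forall i x, derivable (iter_partial a v) x (delta_mx 0 i).

Definition smooth u : Prop :=
  smooth_real (fun t => Re (u t)) /\ smooth_real (fun t => Im (u t)).

Definition support_set u : set 'rV[R]_n := closure [set x | u x != 0].

(* [phi] belongs to [D(Omega)] *)
Definition test_function Omega phi : Prop :=
  [/\ smooth phi, compact (support_set phi) & support_set phi `<=` Omega].

Definition seminorm (N : nat) (a : seq 'I_n) phi : \bar R :=
  ereal_sup
    (range (fun t => (bracket2 t ^+ N * normc (iter_partialC a phi t))%:E)).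

Definition schwartz phi : Prop :=
  smooth phi /\ forall N a, (seminorm N a phi < +oo)%E.

(* A distribution is a functional on all functions ['rV[R]_n -> R[i]], of which
   only the values on Schwartz functions are meaningful. *)
Definition functional := ('rV[R]_n -> C) -> C.

Definition linear_on_schwartz (f : functional) : Prop :=
  forall (c : C) phi psi, schwartz phi -> schwartz psi ->
    f (fun t => c * phi t + psi t) = c * f phi + f psi.

(* Continuity for the locally convex topology of the seminorms. *)
Definition continuous_on_schwartz (f : functional) : Prop :=
  forall phi0, schwartz phi0 -> forall eps : R, 0 < eps ->
    exists (N : nat) (delta : R), 0 < delta /\
      forall phi, schwartz phi ->
        (forall a, (size a <= N)%N ->
           (seminorm N a (fun t => phi t - phi0 t)%R < delta%:E)%E) ->
        normc (f phi - f phi0) < eps.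

(* [f] belongs to [S'(R^n)] *)
Definition tempered (f : functional) : Prop :=
  linear_on_schwartz f /\ continuous_on_schwartz f.

Definition fourier phi : 'rV[R]_n -> C := fun xi =>
  integral_Rn (fun t =>
    (cos (2 * pi * dotp t xi) -i* sin (2 * pi * dotp t xi))%C * phi t).

Definition fourier_distr (f : functional) : functional :=
  fun phi => f (fourier phi).

Definition mul_distr (m : 'rV[R]_n -> C) (f : functional) : functional :=
  fun phi => f (fun t => m t * phi t).

(* The restriction of the distribution [f] to the open set [Omega] is the
   locally integrable function [u]. *)
Definition is_function_on Omega (f : functional) u : Prop :=
  locally_integrable_Rn Omega u /\
  forall phi, test_function Omega phi ->
    f phi = integral_Rn (fun t => u t * phi t).

Definition open_cone (Gamma : set 'rV[R]_n) : Prop :=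
  open Gamma /\ forall (c : R) x, 0 < c -> Gamma x -> Gamma (c *: x).

End RealSpace.

(* [g] belongs to [D(R)] *)
Definition test_function1 {R : realType} (g : R -> R[i]) : Prop :=
  (forall m x, derivable ((fun t => Re (g t))^`(m)%classic) x 1 /\
               derivable ((fun t => Im (g t))^`(m)%classic) x 1) /\
  compact (closure [set t | g t != 0]).

Section DirectionalSTFT.
Context {R : realType} {n k : nat} (le_kn : (k <= n)%N).
Local Notation C := R[i].
Implicit Types (g : 'I_k -> R -> C) (x : 'rV[R]_k).

Definition first_coords (t : 'rV[R]_n) : 'rV[R]_k :=
  \row_i t 0 (widen_ord le_kn i).

Definition tensor g (s : 'rV[R]_k) : C := \prod_i g i (s 0 i).

Definition DS g (f : @functional R n) x : @functional R n :=
  fourier_distr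
    (mul_distr (fun t => ((tensor g (first_coords t - x))^*)%C) f).

Definition cube (r : R) (x0 : 'rV[R]_k) : set 'rV[R]_k :=
  [set x | forall i, x0 0 i - r < x 0 i < x0 0 i + r].

(* [h x] is the function representing [DS g f x] on [Gamma]; it does not
   depend on [N]. *)
Definition k_directionally_regular (f : @functional R n) (x0 : 'rV[R]_k)
    (xi0 : 'rV[R]_n) : Prop :=
  exists (g : 'I_k -> R -> C) (r : R) (Gamma : set 'rV[R]_n)
         (h : 'rV[R]_k -> 'rV[R]_n -> C),
  [/\ forall i, test_function1 (g i), tensor g 0 != 0, 0 < r,
      open_cone Gamma /\ Gamma xi0 &
      (forall x, cube r x0 x -> is_function_on Gamma (DS g f x) (h x)) /\
      forall N : nat, exists2 CN : R, 0 < CN &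
        forall x xi, cube r x0 x -> Gamma xi ->
          normc (h x xi) <= CN * bracket2 xi `^ (- (N%:R / 2))].

End DirectionalSTFT.

(* Main.v *)
Require Import Defs.
From mathcomp Require Import all_boot all_order all_algebra.
From mathcomp Require Import complex finmap.
From mathcomp Require Import all_classical all_reals all_analysis.
From mathcomp Require Import measurable_realfun ring lra.
Set Implicit Arguments.
Unset Strict Implicit.
Unset Printing Implicit Defensive.
Import Order.TTheory GRing.Theory Num.Theory.
Import numFieldNormedType.Exports.
Import Normc.
Local Open Scope classical_set_scope.
Local Open Scope ring_scope.
Local Notation Re := complex.Re.
Local Notation Im := complex.Im.

(** Near a point [t0], the distribution [f] is analysed through test functions
[chi] supported in a small box, and the numbers [f (chi e_(-xi))], where [e_xi]
is the plane wave of frequency [xi] ([wave]). The theorem follows from two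
facts: these numbers decay faster than any power of [|xi|], and a tempered
distribution with that property is a smooth function near [t0].

Decay. Fix a direction [xi0] and take the window [g] and the cone given by the
hypothesis at the first coordinates of [t0]. If [om] is a test function with
small support, then [u], the product of the conjugate window with the Fourier
transform of [om], is a Schwartz function, and [f (u e_(-eta))] is the value of
the windowed Fourier transform of [f] at the translate of [om] by [eta]: it
decays rapidly when [eta] is in a smaller cone around [xi0] ([window_decay]).
Moreover [om] can be chosen so that [u] does not vanish at [t0]. Near [t0]
one may thus write [chi = u theta] with a test function [theta]. Expanding
[theta] in waves [e_m] writes [f (chi e_(-xi))] as a superposition of the
numbers [f (u e_(m - xi))]; for small [m] the frequency [xi - m] is still in the
cone, and for large [m] the coefficient is small ([frequency_shift]).

Instead of the Fourier inversion formula, the expansion uses Fejer sums, which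
are finite sums of waves and so can be inserted into [f] by linearity
([fejer_sum]). Their period [L] is comparable to [|xi|]: the Fejer sum agrees
with [theta] up to a small error in a box of that size, and outside of it the
decay of [u] makes up for the error by a power of [|xi|] ([local_decay]). All
that is used about Fejer sums is that they commute with derivatives, are
bounded by twice the supremum of [theta], converge uniformly, and have weights for
which a summable majorant sums up to a polynomial in [L] ([fejer_sum_partials],
[fejer_sum_bound], [fejer_sum_cvg], [fejer_weights]). Compactness of the unit
sphere gives the decay in all directions ([decay_all_directions]).

Smoothness. With period one, the Fejer means of the Fourier series of [chi f]
have uniformly bounded derivatives of all orders, because its coefficients
decay rapidly. A limit along an ultrafilter is smooth ([synthesis_limit]), and
it represents [chi f], because testing a Fejer mean against [psi] is testing
[chi f] against the Fejer sum of [psi] ([local_representative]). Smooth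
representatives near two points agree where both are defined
([representative_unique]), and a partition of unity concludes ([glue]). Bump
functions are made from a factor of one of the given windows ([bump_exists]). *)

(** * Complex numbers and their modulus *)

Section ComplexModulus.
Context {R : realType}.
Implicit Types z w : R[i].

Lemma cReD z w : Re (z + w) = Re z + Re w. Proof. by case: z w => ? ? []. Qed.
Lemma cImD z w : Im (z + w) = Im z + Im w. Proof. by case: z w => ? ? []. Qed.
Lemma cReN z : Re (- z) = - Re z. Proof. by case: z. Qed.
Lemma cImN z : Im (- z) = - Im z. Proof. by case: z. Qed.
Lemma cReM z w : Re (z * w) = Re z * Re w - Im z * Im w.
Proof. by case: z w => ? ? []. Qed.
Lemma cImM z w : Im (z * w) = Re z * Im w + Im z * Re w.
Proof. by case: z w => ? ? []. Qed.
Lemma cReJ z : Re (z^*)%C = Re z. Proof. by case: z. Qed.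
Lemma cImJ z : Im (z^*)%C = - Im z. Proof. by case: z. Qed.

Lemma complex_ext z w : Re z = Re w -> Im z = Im w -> z = w.
Proof. by case: z w => ? ? [? ?] /= -> ->. Qed.

Lemma Re_sum I (r : seq I) (P : pred I) (F : I -> R[i]) :
  Re (\sum_(i <- r | P i) F i) = \sum_(i <- r | P i) Re (F i).
Proof. exact: (big_morph _ cReD (erefl : Re 0 = 0)). Qed.

Lemma Im_sum I (r : seq I) (P : pred I) (F : I -> R[i]) :
  Im (\sum_(i <- r | P i) F i) = \sum_(i <- r | P i) Im (F i).
Proof. exact: (big_morph _ cImD (erefl : Im 0 = 0)). Qed.

Lemma normcE2 z : normc z = Num.sqrt (Re z ^+ 2 + Im z ^+ 2).
Proof. by case: z. Qed.

Lemma normc_ge0 z : 0 <= normc z. Proof. by rewrite normcE2 sqrtr_ge0. Qed.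

Lemma normc_real (x : R) : normc x%:C%C = `|x|.
Proof. by rewrite normcE2 /= expr0n addr0 sqrtr_sqr. Qed.

Lemma sqr_normcE z : normc z ^+ 2 = Re z ^+ 2 + Im z ^+ 2.
Proof. by rewrite normcE2 sqr_sqrtr// addr_ge0 ?sqr_ge0. Qed.

Lemma normcJ z : normc (z^*)%C = normc z.
Proof. by rewrite !normcE2 cReJ cImJ sqrrN. Qed.

Lemma normcB z w : normc (z - w) = normc (w - z).
Proof. by rewrite -opprB normcN. Qed.

Lemma Re_le_normc z : `|Re z| <= normc z.
Proof.
rewrite -(@ler_pXn2r _ 2)// ?nnegrE ?normr_ge0 ?normc_ge0//.
by rewrite sqr_normcE real_normK ?num_real// lerDl sqr_ge0.
Qed.

Lemma Im_le_normc z : `|Im z| <= normc z.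
Proof.
rewrite -(@ler_pXn2r _ 2)// ?nnegrE ?normr_ge0 ?normc_ge0//.
by rewrite sqr_normcE real_normK ?num_real// lerDr sqr_ge0.
Qed.

Lemma normc_le_ReIm z : normc z <= `|Re z| + `|Im z|.
Proof.
rewrite -(@ler_pXn2r _ 2)// ?nnegrE ?normc_ge0 ?addr_ge0//.
rewrite sqr_normcE sqrrD !real_normK ?num_real//.
by rewrite [leRHS]addrAC lerDl mulrn_wge0// mulr_ge0.
Qed.

Lemma normc_eq0 z : (normc z == 0) = (z == 0).
Proof. by apply/eqP/eqP => [/eq0_normc//|->]; rewrite normc0. Qed.

Lemma normc_gt0 z : (0 < normc z) = (z != 0).
Proof. by rewrite lt_neqAle normc_ge0 andbT eq_sym normc_eq0. Qed.

Lemma normc_sum I (r : seq I) (P : pred I) (F : I -> R[i]) :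
  normc (\sum_(i <- r | P i) F i) <= \sum_(i <- r | P i) normc (F i).
Proof.
elim/big_ind2 : _ => [|a b c d ab cd|//]; first by rewrite normc0.
exact: le_trans (le_normcD _ _) (lerD ab cd).
Qed.

Lemma invcE z : z^-1 = (z^*)%C * ((Re (z * (z^*)%C))^-1)%:C%C.
Proof.
have [->|z0] := eqVneq z 0; first by rewrite invr0 conjc0 mul0r.
have zz0 : normc z != 0 by rewrite normc_eq0.
apply: (mulfI z0); rewrite divff// mulrA; apply: complex_ext.
  rewrite /= cReM cReM cImM cReJ cImJ /= mulr0 subr0.
  rewrite mulrN opprK -!expr2 -sqr_normcE divff// sqrf_eq0//.
by rewrite /= cImM cReM cImM cReJ cImJ /= mulr0 add0r mulrN [Im z * _]mulrC addNr mul0r.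
Qed.

End ComplexModulus.

(** * Smooth functions on open sets *)

Section Smooth.
Context {R : realType} {n : nat}.
Local Notation V := ('rV[R]_n).
Local Notation C := (R[i]).
Implicit Types (u v w : V -> C) (U : set V) (x : V) (i : 'I_n).

Definition cont_at x u :=
  {for x, continuous (fun t => Re (u t))} /\
  {for x, continuous (fun t => Im (u t))}.

Definition has_partial i x u (d : C) :=
  is_derive x (delta_mx 0 i) (fun t => Re (u t)) (Re d) /\
  is_derive x (delta_mx 0 i) (fun t => Im (u t)) (Im d).

Definition smooth_on U u := forall a x, U x ->
  cont_at x (iter_partialC a u) /\
  forall i, has_partial i x (iter_partialC a u) (iter_partialC (i :: a) u x).

Lemma smooth_onT u : smooth u <-> smooth_on setT u.
Proof.
split=> [[ru iu] a x _|su].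
  have [cr dr] := ru a; have [ci di] := iu a; split.
    by split => /=; [exact: cr|exact: ci].
  by move=> i; split => /=; apply: derivableP; [exact: dr|exact: di].
split=> a; split=> [x|i x].
- by have [[]] := su a x I.
- by have [_ /(_ i)[[]]] := su a x I.
- by have [[]] := su a x I.
- by have [_ /(_ i)[_ []]] := su a x I.
Qed.

Lemma smooth_onW U U' u : U' `<=` U -> smooth_on U u -> smooth_on U' u.
Proof. by move=> UU su a x /UU; exact: su. Qed.

Lemma has_partial_near i x u v d : (\near x, u x = v x) ->
  has_partial i x u d -> has_partial i x v d.
Proof.
move=> uv [ur ui]; split; [move: ur|move: ui]; apply: near_eq_is_derive.
all: by near do congr (_ _).
Unshelve. all: by end_near. Qed.

Lemma cont_at_near x u v : (\near x, u x = v x) -> cont_at x u -> cont_at x v.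
Proof.
move=> uv [ur ui]; have uvx := nbhs_singleton uv.
split.
  have ev : {near x, (fun t => Re (u t)) =1 (fun t => Re (v t))}.
    by apply: filterS uv => t ->.
  by move=> B /= Bv; apply: (near_eq_cvg ev); apply: ur; rewrite uvx.
have ev : {near x, (fun t => Im (u t)) =1 (fun t => Im (v t))}.
  by apply: filterS uv => t ->.
by move=> B /= Bv; apply: (near_eq_cvg ev); apply: ui; rewrite uvx.
Qed.

Lemma iter_partialC_cons i a u x d :
  has_partial i x (iter_partialC a u) d -> iter_partialC (i :: a) u x = d.
Proof. by move=> [[_ e] [_ e']]; apply: complex_ext => /=. Qed.

(** The induction over multi-indices is done once and for all on a family of
functions that is stable under partial derivatives; only first derivatives then
have to be computed. *)
Lemma smooth_class U (P : (V -> C) -> Prop) : open U ->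
  (forall u, P u -> forall x, U x -> cont_at x u) ->
  (forall u, P u -> forall i,
    exists2 u', P u' & forall x, U x -> has_partial i x u (u' x)) ->
  forall u, P u -> smooth_on U u /\
    forall a, exists2 u', P u' & forall x, U x -> iter_partialC a u x = u' x.
Proof.
move=> oU cP dP u Pu.
have H a : exists2 u', P u' & forall x, U x -> iter_partialC a u x = u' x.
  elim: a => [|i a [v Pv av]]; first by exists u => // x _; exact: complex_ext.
  have [v' Pv' vv'] := dP v Pv i; exists v' => // x Ux.
  apply: iter_partialC_cons; apply: has_partial_near (vv' x Ux).
  by near do (apply/esym/av); exact: open_nbhs_nbhs.
split=> // a x Ux; have [v Pv av] := H a.
have nav : \near x, v x = iter_partialC a u x.
  by near do (apply/esym/av); exact: open_nbhs_nbhs.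
split; first exact: cont_at_near nav (cP _ Pv _ Ux).
move=> i; have [v' Pv' vv'] := dP v Pv i.
have := has_partial_near nav (vv' _ Ux).
by move=> h; rewrite (iter_partialC_cons h).
Unshelve. all: by end_near. Qed.

Lemma cont_at_cst (c : C) x : cont_at x (fun=> c).
Proof. by split; exact: cst_continuous. Qed.

Lemma cont_atD x u v : cont_at x u -> cont_at x v ->
  cont_at x (fun t => u t + v t).
Proof.
move=> [ur ui] [vr vi]; split.
  rewrite (_ : (fun t => Re _) = (fun t => Re (u t)) \+ (fun t => Re (v t))).
    exact: continuousD.
  by apply/funext => t; rewrite cReD.
rewrite (_ : (fun t => Im _) = (fun t => Im (u t)) \+ (fun t => Im (v t))).
  exact: continuousD.
by apply/funext => t; rewrite cImD.
Qed.

Lemma cont_atM x u v : cont_at x u -> cont_at x v ->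
  cont_at x (fun t => u t * v t).
Proof.
move=> [ur ui] [vr vi]; split.
  rewrite (_ : (fun t => Re _) =
      (fun t => Re (u t) * Re (v t) - Im (u t) * Im (v t))).
    by apply: continuousB; exact: continuousM.
  by apply/funext => t; rewrite cReM.
rewrite (_ : (fun t => Im _) =
    (fun t => Re (u t) * Im (v t) + Im (u t) * Re (v t))).
  by apply: continuousD; exact: continuousM.
by apply/funext => t; rewrite cImM.
Qed.

Lemma cont_atJ x u : cont_at x u -> cont_at x (fun t => (u t)^*%C).
Proof.
move=> [ur ui]; split.
  by rewrite (_ : (fun t => Re _) = (fun t => Re (u t)))//;
    apply/funext => t; rewrite cReJ.
rewrite (_ : (fun t => Im _) = (fun t => - Im (u t))); first exact: continuousN.
by apply/funext => t; rewrite cImJ.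
Qed.

Lemma cont_at_Re x u : cont_at x u -> cont_at x (fun t => (Re (u t))%:C%C).
Proof. by move=> [ur ui]; split => //=; exact: cst_continuous. Qed.

Lemma cont_atVRe x u : cont_at x u -> Re (u x) != 0 ->
  cont_at x (fun t => ((Re (u t))^-1)%:C%C).
Proof.
by move=> [ur ui] u0; split => /=; [exact: continuousV|exact: cst_continuous].
Qed.

Lemma cont_atB x u v : cont_at x u -> cont_at x v ->
  cont_at x (fun t => u t - v t).
Proof.
move=> cu cv; rewrite (_ : (fun t => _) = (fun t => u t + (-1) * v t)).
  exact: (cont_atD cu (cont_atM (cont_at_cst (-1) x) cv)).
by apply/funext => t; rewrite mulN1r.
Qed.

Lemma cont_at_normc x u : cont_at x u ->
  {for x, continuous (fun t => normc (u t))}.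
Proof.
move=> [ur ui]; rewrite (_ : (fun t => _) =
    Num.sqrt \o (fun t => Re (u t) * Re (u t) + Im (u t) * Im (u t))).
  apply: continuous_comp; last exact: sqrt_continuous.
  by apply: continuousD; exact: continuousM.
by apply/funext => t; rewrite normcE2 /= !expr2.
Qed.

Lemma has_partial_cst i x (c : C) : has_partial i x (fun=> c) 0.
Proof. by split; exact: is_derive_cst. Qed.

Lemma has_partialD i x u v d e : has_partial i x u d -> has_partial i x v e ->
  has_partial i x (fun t => u t + v t) (d + e).
Proof.
move=> [ur ui] [vr vi]; split.
  rewrite (_ : (fun t => Re _) = (fun t => Re (u t)) + (fun t => Re (v t))).
    by rewrite cReD; exact: is_deriveD.
  by apply/funext => t; rewrite cReD.
rewrite (_ : (fun t => Im _) = (fun t => Im (u t)) + (fun t => Im (v t))).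
  by rewrite cImD; exact: is_deriveD.
by apply/funext => t; rewrite cImD.
Qed.

Lemma has_partialM i x u v d e : has_partial i x u d -> has_partial i x v e ->
  has_partial i x (fun t => u t * v t) (d * v x + u x * e).
Proof.
move=> [ur ui] [vr vi]; split.
  rewrite (_ : (fun t => Re _) = (fun t => Re (u t)) * (fun t => Re (v t))
      - (fun t => Im (u t)) * (fun t => Im (v t))).
    apply: is_derive_eq (is_deriveB (is_deriveM ur vr) (is_deriveM ui vi)) _.
    rewrite cReD !cReM /GRing.scale/=; ring.
  by apply/funext => t; rewrite cReM.
rewrite (_ : (fun t => Im _) = (fun t => Re (u t)) * (fun t => Im (v t))
    + (fun t => Im (u t)) * (fun t => Re (v t))).
  apply: is_derive_eq (is_deriveD (is_deriveM ur vi) (is_deriveM ui vr)) _.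
  rewrite cImD !cImM /GRing.scale/=; ring.
by apply/funext => t; rewrite cImM.
Qed.

Lemma has_partialJ i x u d : has_partial i x u d ->
  has_partial i x (fun t => (u t)^*%C) (d^*)%C.
Proof.
move=> [ur ui]; split.
  by rewrite (_ : (fun t => Re _) = (fun t => Re (u t))) ?cReJ//;
    apply/funext => t; rewrite cReJ.
rewrite (_ : (fun t => Im _) = - (fun t => Im (u t))).
  by rewrite cImJ; exact: is_deriveN.
by apply/funext => t; rewrite cImJ.
Qed.

Lemma has_partial_Re i x u d : has_partial i x u d ->
  has_partial i x (fun t => (Re (u t))%:C%C) (Re d)%:C%C.
Proof. by move=> [ur ui]; split => //=; exact: is_derive_cst. Qed.

Lemma has_partialVRe i x u d : has_partial i x u d -> Re (u x) != 0 ->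
  has_partial i x (fun t => ((Re (u t))^-1)%:C%C)
    (- ((Re (u x))^-1)%:C%C * ((Re (u x))^-1)%:C%C * (Re d)%:C%C).
Proof.
move=> [[ur <-] ui] u0; split => /=.
  rewrite !(mulr0, oppr0, subr0, mul0r, addr0).
  apply: DeriveDef; first exact: derivableV.
  by rewrite (deriveV u0 ur) /GRing.scale/= expr2 invfM !mulNr.
rewrite !(mulr0, oppr0, subr0, mul0r, addr0).
exact: is_derive_cst.
Qed.

(** With reciprocals of real parts instead of complex inverses, the real quotient
rule shows that the family is stable under partial derivatives; complex inverses
are recovered by [invcE]. *)
Inductive smooth_expr U : (V -> C) -> Prop :=
| SE_base u : smooth_on U u -> smooth_expr U u
| SE_D u v : smooth_expr U u -> smooth_expr U v ->
    smooth_expr U (fun t => u t + v t)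
| SE_M u v : smooth_expr U u -> smooth_expr U v ->
    smooth_expr U (fun t => u t * v t)
| SE_J u : smooth_expr U u -> smooth_expr U (fun t => (u t)^*%C)
| SE_Re u : smooth_expr U u -> smooth_expr U (fun t => (Re (u t))%:C%C)
| SE_VRe u : smooth_expr U u -> (forall x, U x -> Re (u x) != 0) ->
    smooth_expr U (fun t => ((Re (u t))^-1)%:C%C).

Lemma smooth_on_cont U u x : smooth_on U u -> U x -> cont_at x u.
Proof.
move=> su Ux; have [+ _] := su [::] x Ux.
by rewrite (_ : iter_partialC [::] u = u)//; apply/funext => t; exact: complex_ext.
Qed.

Lemma iter_partialC_nil u : iter_partialC [::] u = u.
Proof. by apply/funext => t; exact: complex_ext. Qed.

Lemma iter_partialC_rcons a i u :
  iter_partialC (rcons a i) u = iter_partialC a (iter_partialC [:: i] u).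
Proof. by apply/funext => x; rewrite /iter_partialC /iter_partial -!cats1 !foldr_cat. Qed.

Lemma smooth_on_partial U i u : smooth_on U u ->
  smooth_on U (iter_partialC [:: i] u).
Proof.
move=> su a x Ux; have [c p] := su (rcons a i) x Ux.
split => [|j]; first by rewrite -iter_partialC_rcons.
by have := p j; rewrite -rcons_cons !iter_partialC_rcons.
Qed.

Lemma smooth_on_has_partial U i u x : smooth_on U u -> U x ->
  has_partial i x u (iter_partialC [:: i] u x).
Proof.
by move=> su Ux; have [_ /(_ i)] := su [::] x Ux; rewrite iter_partialC_nil.
Qed.

Lemma smooth_on_cst U (c : C) : open U -> smooth_on U (fun=> c).
Proof.
move=> oU; have [|||su _] := @smooth_class U (fun u => exists c, u = fun=> c) oU _ _ (fun=> c : C).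
- by move=> _ [{}c ->] y _; exact: cont_at_cst.
- move=> _ [{}c ->] j; exists (fun=> 0); first by exists 0.
  by move=> y _; exact: has_partial_cst.
- by exists c.
exact: su.
Qed.

Lemma smooth_on_expr U u : open U -> smooth_expr U u -> smooth_on U u.
Proof.
move=> oU /(@smooth_class U (smooth_expr U) oU) [] //.
  move=> {}u; elim=> {u}.
  - by move=> u su x; exact: smooth_on_cont.
  - by move=> u v _ cu _ cv x Ux; apply: cont_atD; [exact: cu|exact: cv].
  - by move=> u v _ cu _ cv x Ux; apply: cont_atM; [exact: cu|exact: cv].
  - by move=> u _ cu x Ux; apply: cont_atJ; exact: cu.
  - by move=> u _ cu x Ux; apply: cont_at_Re; exact: cu.
  - by move=> u _ cu u0 x Ux; apply: cont_atVRe; [exact: cu|exact: u0].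
move=> {}u eu i; elim: eu => {u}.
- move=> u su; exists (iter_partialC [:: i] u).
    exact/SE_base/smooth_on_partial.
  by move=> x; exact: smooth_on_has_partial.
- move=> u v eu [u' eu' uu'] ev [v' ev' vv'].
  exists (fun t => u' t + v' t); first exact: SE_D.
  by move=> x Ux; apply: has_partialD; [exact: uu'|exact: vv'].
- move=> u v eu [u' eu' uu'] ev [v' ev' vv'].
  exists (fun t => u' t * v t + u t * v' t).
    by apply: SE_D; exact: SE_M.
  by move=> x Ux; apply: has_partialM; [exact: uu'|exact: vv'].
- move=> u eu [u' eu' uu'].
  exists (fun t => (u' t)^*%C); first exact: SE_J.
  by move=> x Ux; apply: has_partialJ; exact: uu'.
- move=> u eu [u' eu' uu'].
  exists (fun t => (Re (u' t))%:C%C); first exact: SE_Re.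
  by move=> x Ux; apply: has_partial_Re; exact: uu'.
- move=> u eu [u' eu' uu'] u0.
  exists (fun x => (-1) * (((Re (u x))^-1)%:C%C * ((Re (u x))^-1)%:C%C) * (Re (u' x))%:C%C).
    apply: SE_M; last exact: SE_Re.
    apply: SE_M; last by apply: SE_M; exact: SE_VRe.
    exact/SE_base/smooth_on_cst.
  move=> x Ux; rewrite mulrA mulN1r; apply: has_partialVRe; [exact: uu'|exact: u0].
Qed.

End Smooth.

Section SmoothClosure.
Context {R : realType} {n : nat}.
Local Notation V := ('rV[R]_n).
Local Notation C := (R[i]).
Implicit Types (u v w : V -> C) (U : set V) (x : V) (i : 'I_n).

Lemma smooth_onD U u v : open U -> smooth_on U u -> smooth_on U v ->
  smooth_on U (fun t => u t + v t).
Proof. by move=> oU su sv; apply: smooth_on_expr => //; apply: SE_D; exact: SE_base. Qed.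

Lemma smooth_onM U u v : open U -> smooth_on U u -> smooth_on U v ->
  smooth_on U (fun t => u t * v t).
Proof. by move=> oU su sv; apply: smooth_on_expr => //; apply: SE_M; exact: SE_base. Qed.

Lemma smooth_onJ U u : open U -> smooth_on U u ->
  smooth_on U (fun t => (u t)^*%C).
Proof. by move=> oU su; apply: smooth_on_expr => //; apply: SE_J; exact: SE_base. Qed.

Lemma smooth_onV U u : open U -> smooth_on U u -> (forall x, U x -> u x != 0) ->
  smooth_on U (fun t => (u t)^-1).
Proof.
move=> oU su u0; rewrite (_ : (fun t => _) =
  fun t => (u t)^*%C * ((Re (u t * (u t)^*%C))^-1)%:C%C); last first.
  by apply/funext => t; rewrite invcE.
apply: smooth_on_expr => //; apply: SE_M; first exact/SE_J/SE_base.
apply: SE_VRe => [|x /u0 ux0].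
  by apply: SE_M; [exact: SE_base|exact/SE_J/SE_base].
by rewrite cReM cReJ cImJ mulrN opprK -!expr2 -sqr_normcE sqrf_eq0 normc_eq0.
Qed.

Lemma iter_partialC_eq_on U u v : open U -> (forall x, U x -> u x = v x) ->
  forall a x, U x -> iter_partialC a u x = iter_partialC a v x.
Proof.
move=> oU uv; elim=> [|i a IH] x Ux; first by rewrite !iter_partialC_nil uv.
apply: complex_ext => /=; apply: near_eq_derive.
  have : \near x, iter_partialC a u x = iter_partialC a v x.
    by near do apply: IH; exact: open_nbhs_nbhs.
  by apply: filterS => t /(congr1 (@Re R)).
have : \near x, iter_partialC a u x = iter_partialC a v x.
  by near do apply: IH; exact: open_nbhs_nbhs.
by apply: filterS => t /(congr1 (@Im R)).
Unshelve. all: by end_near. Qed.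

Lemma smooth_on_eq U u v : open U -> (forall x, U x -> u x = v x) ->
  smooth_on U u -> smooth_on U v.
Proof.
move=> oU uv su a x Ux; have [c p] := su a x Ux.
have E b := iter_partialC_eq_on oU uv b.
have nE : \near x, iter_partialC a u x = iter_partialC a v x.
  by near do apply: E; exact: open_nbhs_nbhs.
split; first exact: cont_at_near nE c.
by move=> i; rewrite -E//; apply: has_partial_near nE _; exact: p.
Unshelve. all: by end_near. Qed.

Lemma smooth_on_bigcover U u :
  (forall x, U x -> exists2 W, W x & smooth_on W u) -> smooth_on U u.
Proof. by move=> h a x /h[W Wx sW]; exact: sW. Qed.

Lemma iter_partialC0 U u : open U -> (forall x, U x -> u x = 0) ->
  forall a x, U x -> iter_partialC a u x = 0.
Proof.
move=> oU u0 a x Ux.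
rewrite (@iter_partialC_eq_on U u (fun=> 0) oU)//.
suff -> : iter_partialC a (fun _ : V => 0 : C) = fun=> 0 by [].
elim: a => [|i a IH]; first exact: iter_partialC_nil.
apply/funext => y; apply: iter_partialC_cons; rewrite IH; exact: has_partial_cst.
Qed.

(** An inductive copy of [smooth], which conversion cannot unfold into
iterated derivatives. [Test] and [Schwartz] wrap [test_function] and [schwartz]
in the same way. *)
Variant Smooth u : Prop := mkSmooth of smooth_on setT u.

Lemma SmoothP u : smooth u <-> Smooth u.
Proof. by split=> [/smooth_onT //|[]/smooth_onT]. Qed.

Lemma Smooth_on u U : Smooth u -> smooth_on U u.
Proof. by case; apply: smooth_onW. Qed.

Lemma SmoothD u v : Smooth u -> Smooth v -> Smooth (fun t => u t + v t).
Proof. by move=> [su] [sv]; apply/mkSmooth/smooth_onD => //; exact: openT. Qed.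

Lemma SmoothM u v : Smooth u -> Smooth v -> Smooth (fun t => u t * v t).
Proof. by move=> [su] [sv]; apply/mkSmooth/smooth_onM => //; exact: openT. Qed.

Lemma SmoothJ u : Smooth u -> Smooth (fun t => (u t)^*%C).
Proof. by move=> [su]; apply/mkSmooth/smooth_onJ => //; exact: openT. Qed.

Lemma Smooth_cst (c : C) : Smooth (fun _ : V => c).
Proof. by apply/mkSmooth/smooth_on_cst; exact: openT. Qed.

Lemma SmoothZ (c : C) u : Smooth u -> Smooth (fun t => c * u t).
Proof. by move=> su; apply: SmoothM => //; exact: Smooth_cst. Qed.

Lemma SmoothB u v : Smooth u -> Smooth v -> Smooth (fun t => u t - v t).
Proof.
move=> su sv; rewrite (_ : (fun t => _) = fun t => u t + (-1) * v t).
  by apply: SmoothD => //; exact: SmoothZ.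
by apply/funext => t; rewrite mulN1r.
Qed.

Lemma Smooth_sum (I : finType) (F : I -> V -> C) :
  (forall j, Smooth (F j)) -> Smooth (fun t => \sum_j F j t).
Proof.
move=> sF; elim: (index_enum I) => [|j s IH].
  rewrite (_ : (fun t => _) = fun=> 0); first exact: Smooth_cst.
  by apply/funext => t; rewrite big_nil.
rewrite (_ : (fun t => _) = fun t => F j t + \sum_(j <- s) F j t).
  exact: SmoothD.
by apply/funext => t; rewrite big_cons.
Qed.

Lemma Smooth_prod (I : finType) (F : I -> V -> C) :
  (forall j, Smooth (F j)) -> Smooth (fun t => \prod_j F j t).
Proof.
move=> sF; elim: (index_enum I) => [|j s IH].
  rewrite (_ : (fun t => _) = fun=> 1); first exact: Smooth_cst.
  by apply/funext => t; rewrite big_nil.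
rewrite (_ : (fun t => _) = fun t => F j t * \prod_(j <- s) F j t).
  exact: SmoothM.
by apply/funext => t; rewrite big_cons.
Qed.

Lemma Smooth_partial i u : Smooth u -> Smooth (iter_partialC [:: i] u).
Proof. by move=> [su]; apply/mkSmooth/smooth_on_partial. Qed.

Lemma Smooth_iter_partial a u : Smooth u -> Smooth (iter_partialC a u).
Proof.
elim/last_ind: a u => [|a i IH] u su; first by rewrite iter_partialC_nil.
by rewrite iter_partialC_rcons; apply/IH/Smooth_partial.
Qed.

Lemma Smooth_has_partial i u x : Smooth u ->
  has_partial i x u (iter_partialC [:: i] u x).
Proof. by move=> [su]; exact: smooth_on_has_partial su I. Qed.

Lemma Smooth_cont u x : Smooth u -> cont_at x u.
Proof. by move=> [su]; exact: smooth_on_cont su I. Qed.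

Lemma partial_uniq i u v : (forall x, has_partial i x u (v x)) ->
  iter_partialC [:: i] u = v.
Proof.
by move=> h; apply/funext => x; apply: iter_partialC_cons; rewrite iter_partialC_nil.
Qed.

Lemma partialD i u v : Smooth u -> Smooth v ->
  iter_partialC [:: i] (fun t => u t + v t) =
  fun t => iter_partialC [:: i] u t + iter_partialC [:: i] v t.
Proof.
by move=> su sv; apply: partial_uniq => x; apply: has_partialD; exact: Smooth_has_partial.
Qed.

Lemma partialM i u v : Smooth u -> Smooth v ->
  iter_partialC [:: i] (fun t => u t * v t) =
  fun t => iter_partialC [:: i] u t * v t + u t * iter_partialC [:: i] v t.
Proof.
by move=> su sv; apply: partial_uniq => x; apply: has_partialM; exact: Smooth_has_partial.
Qed.

Lemma iter_partialCD a u v : Smooth u -> Smooth v ->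
  iter_partialC a (fun t => u t + v t) =
  fun t => iter_partialC a u t + iter_partialC a v t.
Proof.
elim/last_ind: a u v => [|a i IH] u v su sv; first by rewrite !iter_partialC_nil.
rewrite !iter_partialC_rcons partialD; [|exact: su|exact: sv].
by rewrite IH; [|exact: Smooth_partial|exact: Smooth_partial].
Qed.

Lemma iter_partialCZ a (c : C) u : Smooth u ->
  iter_partialC a (fun t => c * u t) = fun t => c * iter_partialC a u t.
Proof.
elim/last_ind: a u => [|a i IH] u su; first by rewrite !iter_partialC_nil.
rewrite !iter_partialC_rcons -IH; last exact: Smooth_partial.
congr (iter_partialC a _); apply: partial_uniq => x.
have -> : c * iter_partialC [:: i] u x = 0 * u x + c * iter_partialC [:: i] u x.
  by rewrite mul0r add0r.
by apply: has_partialM; [exact: has_partial_cst|exact: Smooth_has_partial].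
Qed.

Lemma iter_partialCB a u v : Smooth u -> Smooth v ->
  iter_partialC a (fun t => u t - v t) =
  fun t => iter_partialC a u t - iter_partialC a v t.
Proof.
move=> su sv; rewrite (_ : (fun t => u t - v t) = fun t => u t + (-1) * v t).
  rewrite iter_partialCD//; last exact: SmoothZ.
  by rewrite iter_partialCZ//; apply/funext => t; rewrite mulN1r.
by apply/funext => t; rewrite mulN1r.
Qed.

Lemma iter_partialC_sum (I : finType) a (F : I -> V -> C) :
  (forall j, Smooth (F j)) ->
  iter_partialC a (fun t => \sum_j F j t) = fun t => \sum_j iter_partialC a (F j) t.
Proof.
move=> sF; suff : Smooth (fun t => \sum_(j <- index_enum I) F j t) /\
    iter_partialC a (fun t => \sum_(j <- index_enum I) F j t) =
    fun t => \sum_(j <- index_enum I) iter_partialC a (F j) t by case.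
elim: (index_enum I) => [|j s [ss IH]].
  rewrite (_ : (fun t => \sum_(j <- [::]) F j t) = fun=> 0); last first.
    by apply/funext => t; rewrite big_nil.
  split; first exact: Smooth_cst.
  apply/funext => x; rewrite big_nil; apply: (@iter_partialC0 setT) => //.
  exact: openT.
rewrite (_ : (fun t => \sum_(j <- j :: s) F j t) =
    fun t => F j t + \sum_(j <- s) F j t); last first.
  by apply/funext => t; rewrite big_cons.
split; first exact: SmoothD.
by rewrite iter_partialCD// IH; apply/funext => t; rewrite big_cons.
Qed.

(** Each derivative falling on a product doubles the number of terms. *)
Lemma leibniz_bound m u v x (A B : R) : Smooth u -> Smooth v ->
  (forall a, (size a <= m)%N -> normc (iter_partialC a u x) <= A) ->
  (forall a, (size a <= m)%N -> normc (iter_partialC a v x) <= B) ->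
  forall a, (size a <= m)%N ->
    normc (iter_partialC a (fun t => u t * v t) x) <= 2 ^+ m * (A * B).
Proof.
elim: m u v => [|m IH] u v su sv uA vB.
  move=> [|//] _; rewrite iter_partialC_nil normcM expr0 mul1r ler_pM ?normc_ge0//.
    by have := uA [::] isT; rewrite iter_partialC_nil.
  by have := vB [::] isT; rewrite iter_partialC_nil.
have A0 : 0 <= A by exact: le_trans (normc_ge0 _) (uA [::] isT).
have B0 : 0 <= B by exact: le_trans (normc_ge0 _) (vB [::] isT).
have AB0 : 0 <= A * B by exact: mulr_ge0.
move=> a; case/lastP: a => [_|a i].
  rewrite iter_partialC_nil normcM.
  have h1 : normc (u x) * normc (v x) <= A * B.
    rewrite ler_pM ?normc_ge0//.
      by have := uA [::] isT; rewrite iter_partialC_nil.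
    by have := vB [::] isT; rewrite iter_partialC_nil.
  by rewrite (le_trans h1)// ler_peMl// exprn_ege1// ler1n.
rewrite size_rcons ltnS => am.
have H : forall u v, Smooth u -> Smooth v ->
    (forall a : seq 'I_n, (size a <= m)%N -> normc (iter_partialC a u x) <= A) ->
    (forall a : seq 'I_n, (size a <= m)%N -> normc (iter_partialC a v x) <= B) ->
    normc (iter_partialC a (fun t : V => u t * v t) x) <= 2 ^+ m * (A * B).
  by move=> u' v' su' sv' hu hv; exact: IH.
rewrite iter_partialC_rcons partialM// iter_partialCD; last 2 first.
  exact: SmoothM (Smooth_partial i su) sv.
  exact: SmoothM su (Smooth_partial i sv).
apply: le_trans (le_normcD _ _) _.
rewrite exprS -mulrA mulr_natl mulr2n; apply: lerD.
- apply: H (Smooth_partial i su) sv _ _ => b bm.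
    by rewrite -iter_partialC_rcons uA// size_rcons.
  by rewrite vB// (leq_trans bm).
- apply: H su (Smooth_partial i sv) _ _ => b bm.
    by rewrite uA// (leq_trans bm).
  by rewrite -iter_partialC_rcons vB// size_rcons.
Qed.

(** * Functions with compact support *)

Lemma support_setP u x : ~ support_set u x -> u x = 0.
Proof. by move=> h; apply/eqP; apply: contrapT => /negP ux; apply: h; exact: subset_closure. Qed.

Lemma support_set_sub u K : closed K -> (forall x, u x != 0 -> K x) ->
  support_set u `<=` K.
Proof. by move=> cK uK; rewrite /support_set [K](closure_id K).1//; exact: closureS. Qed.

Lemma iter_partialC_supp u a x : ~ support_set u x -> iter_partialC a u x = 0.
Proof.
move=> ux; apply: (@iter_partialC0 (~` support_set u)) => //.
  exact/closed_openC/closed_closure.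
by move=> y /support_setP.
Qed.

End SmoothClosure.

(** * Test functions and rapidly decreasing functions *)

Section FiniteBounds.
Context {I : finType} {T : Type} (F : set_system T) {FF : Filter F}.

(** There are finitely many multi-indices of a given order, so a property that
holds eventually for each of them holds eventually for all of them. *)
Lemma near_seq_size (Q : seq I -> T -> Prop) m :
  (forall a, \forall B \near F, Q a B) ->
  \forall B \near F, forall a, (size a <= m)%N -> Q a B.
Proof.
elim: m Q => [|m IH] Q hQ.
  by near=> B => -[|//] _; near: B.
have h i : \forall B \near F, forall a, (size a <= m)%N -> Q (i :: a) B.
  by apply: (IH (fun a => Q (i :: a))) => a; exact: hQ.
near=> B => -[_|i a]; first by near: B.
rewrite ltnS; have : forall i a, (size a <= m)%N -> Q (i :: a) B.
  by near: B; exact: filter_forall h.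
exact.
Unshelve. all: by end_near. Qed.

End FiniteBounds.

Lemma pinfty_bound {R : realType} (P : R -> Prop) :
  (exists B, forall B', B <= B' -> P B') -> \forall B \near +oo, P B.
Proof. by move=> [B hB]; near=> B'; apply: hB; near: B'; apply: nbhs_pinfty_ge; exact: num_real.
Unshelve. all: by end_near. Qed.

Section RowNorm.
Context {R : realType} {n : nat}.
Implicit Types x y : 'rV[R]_n.

Lemma coord_le_norm x i : `|x 0 i| <= `|x|.
Proof. by rewrite [leRHS]/Num.norm/= mx_normrE; apply/bigmax_geP; right; exists (0, i). Qed.

Lemma row_norm_le x r : 0 <= r -> (forall i, `|x 0 i| <= r) -> `|x| <= r.
Proof.
move=> r0 h; rewrite [leLHS]/Num.norm/= mx_normrE; apply/bigmax_leP; split => //.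
by move=> [j i] _ /=; rewrite (ord1 j).
Qed.

Lemma dotpDl x y z : dotp (x + y) z = dotp x z + dotp y z.
Proof. by rewrite /dotp -big_split/=; apply: eq_bigr => i _; rewrite mxE mulrDl. Qed.

Lemma dotpC x y : dotp x y = dotp y x.
Proof. by apply: eq_bigr => i _; rewrite mulrC. Qed.

Lemma dotpDr x y z : dotp z (x + y) = dotp z x + dotp z y.
Proof. by rewrite dotpC dotpDl !(dotpC z). Qed.

Lemma dotpNl x z : dotp (- x) z = - dotp x z.
Proof. by rewrite /dotp -sumrN; apply: eq_bigr => i _; rewrite mxE mulNr. Qed.

Lemma dotpNr x z : dotp z (- x) = - dotp z x.
Proof. by rewrite dotpC dotpNl dotpC. Qed.

Lemma dotpZl (c : R) x z : dotp (c *: x) z = c * dotp x z.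
Proof. by rewrite /dotp mulr_sumr; apply: eq_bigr => i _; rewrite mxE mulrA. Qed.

Lemma dotp_delta (i : 'I_n) (z : 'rV[R]_n) : dotp (delta_mx 0 i) z = z 0 i.
Proof.
rewrite /dotp (bigD1 i)//= big1 ?addr0 => [|j ji]; rewrite mxE eqxx/=.
  by rewrite eqxx mul1r.
by rewrite (negbTE ji) mul0r.
Qed.

Lemma dotp_le_norm x z : `|dotp x z| <= n%:R * (`|x| * `|z|).
Proof.
rewrite (le_trans (ler_norm_sum _ _ _))//.
rewrite (_ : n%:R * _ = \sum_(i < n) (`|x| * `|z|)).
  by apply: ler_sum => i _; rewrite normrM ler_pM// coord_le_norm.
by rewrite sumr_const card_ord mulr_natl.
Qed.

Lemma coord2_le_bracket2 x i : 1 + x 0 i ^+ 2 <= bracket2 x.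
Proof.
rewrite /bracket2 /dotp lerD2l (bigD1 i)//= -expr2 lerDl.
by apply: sumr_ge0 => j _; rewrite -expr2 sqr_ge0.
Qed.

Lemma bracket2_ge1 x : 1 <= bracket2 x.
Proof. by rewrite /bracket2 lerDl; apply: sumr_ge0 => j _; rewrite -expr2 sqr_ge0. Qed.

Lemma bracket2_gt0 x : 0 < bracket2 x.
Proof. exact: lt_le_trans ltr01 (bracket2_ge1 x). Qed.

Lemma norm2_le_bracket2 x : `|x| ^+ 2 <= bracket2 x.
Proof.
have b0 := ltW (bracket2_gt0 x).
rewrite -[leRHS]sqr_sqrtr// ler_pXn2r ?nnegrE ?sqrtr_ge0//.
apply: row_norm_le; rewrite ?sqrtr_ge0// => i.
rewrite -(@ler_pXn2r _ 2)// ?nnegrE ?sqrtr_ge0// sqr_sqrtr//.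
by rewrite real_normK ?num_real// (le_trans _ (coord2_le_bracket2 x i))// lerDr.
Qed.

Lemma norm_le_bracket2 x : 1 + `|x| <= 2 * bracket2 x.
Proof.
have h1 := bracket2_ge1 x; have h2 := norm2_le_bracket2 x.
have : 2 * `|x| <= 1 + `|x| ^+ 2 by have := sqr_ge0 (`|x| - 1); lra.
by lra.
Qed.

End RowNorm.

Section TestFunctions.
Context {R : realType} {n : nat}.
Local Notation V := ('rV[R]_n).
Local Notation C := (R[i]).
Implicit Types (u v w : V -> C) (U : set V) (x : V) (i : 'I_n).

Variant Test U u : Prop := mkTest of
  Smooth u & compact (support_set u) & support_set u `<=` U.

Lemma TestP U u : test_function U u <-> Test U u.
Proof. by split=> [[/SmoothP ? ? ?]|[/SmoothP ? ? ?]]; split. Qed.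

Lemma Test_Smooth U u : Test U u -> Smooth u. Proof. by case. Qed.

Lemma TestW U U' u : U `<=` U' -> Test U u -> Test U' u.
Proof. by move=> UU [s c h]; split => // x /h/UU. Qed.

Lemma Test_supp U u x : Test U u -> u x != 0 -> U x.
Proof. by move=> [_ _ +] ux; apply; exact: subset_closure. Qed.

Lemma Test_out U u x : Test U u -> ~ U x -> u x = 0.
Proof. by move=> [_ _ h] Ux; apply: support_setP => /h. Qed.

Lemma Test_sub U u v : Test U u -> Smooth v ->
  (forall x, v x != 0 -> support_set u x) -> Test U v.
Proof.
move=> [su cu hu] sv h.
have vu : support_set v `<=` support_set u.
  by apply: support_set_sub => //; exact: closed_closure.
split => //; last exact: subset_trans vu hu.
by apply: subclosed_compact cu vu; exact: closed_closure.
Qed.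

Lemma Test_mulr U u w : Test U u -> Smooth w -> Test U (fun t => u t * w t).
Proof.
move=> tu sw; apply: (Test_sub tu) => [|x].
  exact: SmoothM (Test_Smooth tu) sw.
by move=> ux; apply: contrapT => /support_setP u0; rewrite u0 mul0r eqxx in ux.
Qed.

Lemma Test_lin U (c : C) u v : Test U u -> Test U v ->
  Test U (fun t => c * u t + v t).
Proof.
move=> [su cu hu] [sv cv hv].
have h : support_set (fun t => c * u t + v t) `<=` support_set u `|` support_set v.
  apply: support_set_sub => [|x].
    by apply: closedU; exact: closed_closure.
  move=> uv; apply: contrapT => /not_orP[/support_setP u0 /support_setP v0].
  by rewrite u0 v0 mulr0 addr0 eqxx in uv.
split.
- by apply: SmoothD => //; exact: SmoothZ.
- apply: subclosed_compact h; first exact: closed_closure.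
  exact: compactU.
- by move=> x /h[/hu|/hv].
Qed.

Lemma Test0 U : Test U (fun=> 0).
Proof.
have e : support_set (fun=> 0 : C) = set0 :> set V.
  rewrite /support_set (_ : [set x | _] = set0) ?closure0//.
  by apply/seteqP; split => // x /=; rewrite eqxx.
split; rewrite ?e //; [exact: Smooth_cst|exact: compact0].
Qed.

Lemma Test_iter U u a : Test U u -> Test U (iter_partialC a u).
Proof.
move=> tu; apply: (Test_sub tu); first exact/Smooth_iter_partial/Test_Smooth/tu.
by move=> x ux; apply: contrapT => /(iter_partialC_supp a) u0; rewrite u0 eqxx in ux.
Qed.

(** The product is smooth on [W], and it vanishes identically off the support of
[u]; these two open sets cover the space. *)
Lemma Test_mul_smooth_on U W u (G : V -> C) : open W -> U `<=` W -> Test U u -> smooth_on W G ->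
  Test U (fun t => G t * u t).
Proof.
move=> oW UW tu sG; have su := Test_Smooth tu.
apply: (Test_sub tu); last first.
  by move=> x ux; apply: contrapT => /support_setP u0; rewrite u0 mulr0 eqxx in ux.
split; apply: smooth_on_bigcover => x _.
have [hx|hx] := pselect (support_set u x).
  exists W; first by apply: UW; case: tu => _ _; apply.
  by apply: (smooth_onM oW sG); exact: Smooth_on.
have oU : open (~` support_set u) by exact/closed_openC/closed_closure.
exists (~` support_set u) => //.
apply: (@smooth_on_eq _ _ _ (fun=> 0)) => //; last exact: smooth_on_cst.
by move=> y /support_setP ->; rewrite mulr0.
Qed.

Lemma open_neq0 w : Smooth w -> open [set x | w x != 0].
Proof.
move=> sw; rewrite (_ : mkset _ = (fun x => normc (w x)) @^-1` [set r | 0 < r]).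
  apply: open_comp; last exact: open_gt.
  by move=> x _; apply: cont_at_normc; exact: Smooth_cont.
by apply/seteqP; split => x /=; rewrite normc_gt0.
Qed.

Lemma Test_div U u w : Test U u -> Smooth w -> (forall x, U x -> w x != 0) ->
  Test U (fun t => u t / w t).
Proof.
move=> tu sw w0; rewrite (_ : (fun t => _) = fun t => (w t)^-1 * u t); last first.
  by apply/funext => t; rewrite mulrC.
have oW := open_neq0 sw.
apply: (Test_mul_smooth_on oW _ tu); first exact: w0.
by apply: smooth_onV => //; exact: Smooth_on.
Qed.

Lemma cont_bounded_on_compact (v : V -> R) (K : set V) : compact K ->
  (forall x, {for x, continuous v}) -> exists B, forall x, K x -> v x <= B.
Proof.
move=> cK cv; have [[x0 Kx0]|K0] := pselect (K !=set0).
  have [||c _ hc] := @EVT_max_rV R n v K _ cK; first by exists x0.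
    exact: continuous_subspaceT.
  by exists (v c) => x Kx; apply: hc; rewrite inE.
by exists 0 => x Kx; exfalso; apply: K0; exists x.
Qed.

Definition Bounded_derivatives u :=
  Smooth u /\ forall a, exists B, forall x, normc (iter_partialC a u x) <= B.

Variant Schwartz u : Prop := mkSchwartz of Smooth u &
  forall N a, exists B, forall x, bracket2 x ^+ N * normc (iter_partialC a u x) <= B.

Lemma seminorm_le N a u (B : R) :
  (forall x, bracket2 x ^+ N * normc (iter_partialC a u x) <= B) ->
  (seminorm N a u <= B%:E)%E.
Proof. by move=> h; apply: ge_ereal_sup => _ [x _ <-]; rewrite lee_fin. Qed.

Lemma SchwartzP u : schwartz u <-> Schwartz u.
Proof.
split=> [[/SmoothP su h]|[su h]].
  split=> // N a; have := h N a.
  have ub x : ((bracket2 x ^+ N * normc (iter_partialC a u x))%:E <= seminorm N a u)%E.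
    by apply: ereal_sup_ubound; exists x.
  move: ub; case: (seminorm N a u) => [B|//|] ub _.
    by exists B => x; rewrite -lee_fin.
  by exists 0 => x; have := ub x; rewrite leeNy_eq.
split; first exact/SmoothP.
move=> N a; have [B hB] := h N a.
exact: le_lt_trans (seminorm_le hB) (ltry _).
Qed.

Lemma cont_bracket2 x : {for x, continuous (@bracket2 R n)}.
Proof.
rewrite (_ : @bracket2 R n = (fun t => 1 + \sum_i (t 0 i * t 0 i))) //.
apply: continuousD; first exact: cst_continuous.
elim: (index_enum _) => [|i s IH].
  rewrite (_ : (fun t => _) = fun=> 0); first exact: cst_continuous.
  by apply/funext => t; rewrite big_nil.
rewrite (_ : (fun t : V => _) =
    (fun t : V => t 0 i * t 0 i + \sum_(j <- s) t 0 j * t 0 j)).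
  apply: continuousD => //.
  by apply: continuousM; exact: coord_continuous.
by apply/funext => t; rewrite big_cons.
Qed.

Lemma Test_Schwartz U u : Test U u -> Schwartz u.
Proof.
move=> [su cu _]; split => // N a.
have [x|B hB] := @cont_bounded_on_compact
  (fun x => bracket2 x ^+ N * normc (iter_partialC a u x)) _ cu.
  apply: continuousM; last exact/cont_at_normc/Smooth_cont/Smooth_iter_partial.
  rewrite (_ : (fun x => _) = (@GRing.exp R ^~ N) \o @bracket2 R n)//.
  by apply: continuous_comp; [exact: cont_bracket2|exact: exprn_continuous].
exists (Num.max B 0) => x; rewrite le_max.
have [/hB -> //|/(iter_partialC_supp a) ->] := pselect (support_set u x).
by rewrite normc0 mulr0 lexx orbT.
Qed.

Lemma Schwartz_bounded u : Schwartz u -> Bounded_derivatives u.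
Proof.
move=> [su h]; split => // a; have [B hB] := h 0%N a.
by exists B => x; have := hB x; rewrite expr0 mul1r.
Qed.

Lemma Schwartz_unif u : Schwartz u -> forall N m, exists2 B, 0 < B &
  forall a x, (size a <= m)%N -> bracket2 x ^+ N * normc (iter_partialC a u x) <= B.
Proof.
move=> [su h] N m.
have : \forall B \near +oo, forall a : seq 'I_n, (size a <= m)%N ->
    forall x, bracket2 x ^+ N * normc (iter_partialC a u x) <= B.
  apply: near_seq_size => a; apply: pinfty_bound.
  by have [B hB] := h N a; exists B => B' BB' x; exact: le_trans BB'.
move=> hB.
have [B [B0 hB']] := filter_ex (filterI (nbhs_pinfty_gt (num_real (0 : R))) hB).
by exists B => // a x am; exact: hB'.
Qed.

Lemma bounded_unif u : Bounded_derivatives u -> forall m, exists2 B, 0 < B &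
  forall a x, (size a <= m)%N -> normc (iter_partialC a u x) <= B.
Proof.
move=> [su h] m.
have : \forall B \near +oo, forall a : seq 'I_n, (size a <= m)%N ->
    forall x, normc (iter_partialC a u x) <= B.
  apply: near_seq_size => a; apply: pinfty_bound.
  by have [B hB] := h a; exists B => B' BB' x; exact: le_trans BB'.
move=> hB.
have [B [B0 hB']] := filter_ex (filterI (nbhs_pinfty_gt (num_real (0 : R))) hB).
by exists B => // a x am; exact: hB'.
Qed.

Lemma Schwartz_mul u v : Schwartz u -> Bounded_derivatives v ->
  Schwartz (fun t => u t * v t).
Proof.
move=> Su bv; have [su _] := Su; have [sv _] := bv.
split; first exact: SmoothM.
move=> N a; have [A A0 hA] := Schwartz_unif Su N (size a).
have [B B0 hB] := bounded_unif bv (size a).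
exists (2 ^+ size a * (A * B)) => x.
have b0 : 0 < bracket2 x ^+ N by rewrite exprn_gt0// bracket2_gt0.
rewrite mulrC -ler_pdivlMr// -mulrA [A * B / _]mulrAC.
apply: (leibniz_bound su sv) (leqnn _) => b bm; last exact: hB.
by rewrite ler_pdivlMr// mulrC hA.
Qed.

Lemma bounded_mul u v : Bounded_derivatives u -> Bounded_derivatives v ->
  Bounded_derivatives (fun t => u t * v t).
Proof.
move=> bu bv; have [su _] := bu; have [sv _] := bv.
split=> [|a]; first exact: SmoothM.
have [A A0 hA] := bounded_unif bu (size a).
have [B B0 hB] := bounded_unif bv (size a).
exists (2 ^+ size a * (A * B)) => x.
apply: (leibniz_bound su sv) (leqnn _) => b bm; [exact: hA|exact: hB].
Qed.

Lemma bounded_cst (c : C) : Bounded_derivatives (fun=> c).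
Proof.
split=> [|a]; first exact: Smooth_cst.
exists (normc c) => x.
case/lastP: a => [|a i]; first by rewrite iter_partialC_nil.
rewrite iter_partialC_rcons (@partial_uniq _ _ i (fun=> c) (fun=> 0)); last first.
  by move=> y; exact: has_partial_cst.
by rewrite (@iter_partialC0 _ _ setT) ?normc0 ?normc_ge0//; exact: openT.
Qed.

Lemma bounded_prod (I : finType) (F : I -> V -> C) :
  (forall j, Bounded_derivatives (F j)) ->
  Bounded_derivatives (fun t => \prod_j F j t).
Proof.
move=> sF; elim: (index_enum I) => [|j s IH].
  rewrite (_ : (fun t => _) = fun=> 1); first exact: bounded_cst.
  by apply/funext => t; rewrite big_nil.
rewrite (_ : (fun t => _) = fun t => F j t * \prod_(j <- s) F j t).
  exact: bounded_mul.
by apply/funext => t; rewrite big_cons.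
Qed.

Lemma Schwartz_lin (c : C) u v : Schwartz u -> Schwartz v ->
  Schwartz (fun t => c * u t + v t).
Proof.
move=> [su hu] [sv hv]; split; first by apply: SmoothD => //; exact: SmoothZ.
move=> N a; have [A hA] := hu N a; have [B hB] := hv N a.
exists (normc c * A + B) => x.
rewrite iter_partialCD//; last exact: SmoothZ.
have b0 : 0 <= bracket2 x ^+ N by rewrite exprn_ge0// ltW// bracket2_gt0.
rewrite (le_trans (ler_wpM2l b0 (le_normcD _ _)))// mulrDr lerD//.
rewrite iter_partialCZ// normcM mulrCA ler_wpM2l ?normc_ge0//.
Qed.

End TestFunctions.

(** * Exponentials *)

Section Trigonometry.
Context {R : realType}.
Implicit Types x y : R.

Lemma mvt0 (f df : R -> R) : (forall x, is_derive x 1 f (df x)) ->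
  forall x, exists2 c, `|c| <= `|x| & f x - f 0 = df c * x.
Proof.
move=> hf x.
have cf a b : {within `[a, b], continuous f}.
  apply: continuous_subspaceT => y.
  by apply/differentiable_continuous/derivable1_diffP; case: (hf y).
have [x0|x0] := leP 0 x.
  have [c] := MVT_segment x0 (fun x _ => hf x) (cf 0 x).
  rewrite in_itv/= subr0 => /andP[c0 cx] e; exists c => //.
  by rewrite !ger0_norm.
have [c] := MVT_segment (ltW x0) (fun x _ => hf x) (cf x 0).
rewrite in_itv/= sub0r => /andP[c0 cx] e; exists c.
  by rewrite !ler0_norm ?lerN2// ltW.
by rewrite -opprB e mulrN opprK.
Qed.

Lemma sin_le x : `|sin x| <= `|x|.
Proof.
have [c _] := mvt0 (@is_derive_sin R) x; rewrite sin0 subr0 => ->.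
by rewrite normrM ler_piMl// cos_max.
Qed.

Lemma cosB1_le x : `|cos x - 1| <= `|x|.
Proof.
have [c _] := mvt0 (@is_derive_cos R) x; rewrite cos0 => ->.
by rewrite normrM normrN ler_piMl// sin_max.
Qed.

Lemma cosB1_le2 x : `|cos x - 1| <= x ^+ 2.
Proof.
have [c cx] := mvt0 (@is_derive_cos R) x; rewrite cos0 => ->.
rewrite normrM normrN -[leRHS]real_normK ?num_real// expr2 ler_wpM2r//.
exact: le_trans (sin_le _) cx.
Qed.

Lemma sinBid_le2 x : `|sin x - x| <= x ^+ 2.
Proof.
have h y : is_derive y 1 (fun t : R => sin t - t) (cos y - 1).
  exact: is_deriveB.
have [c cx] := mvt0 h x; rewrite sin0 !subr0 => ->.
rewrite normrM -[leRHS]real_normK ?num_real// expr2 ler_wpM2r//.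
exact: le_trans (cosB1_le _) cx.
Qed.

(** A crude Jordan inequality: the derivative of [sin t - t / 3] is at least [1/6]
when [|t| <= 1]. *)
Lemma sin2_ge x : `|x| <= 1 -> x ^+ 2 / 9 <= sin x ^+ 2.
Proof.
move=> x1; have h y : is_derive y 1 (fun t : R => sin t - t / 3) (cos y - 1/3).
  apply: is_derive_eq => //; rewrite /GRing.scale/=; lra.
suff H : `|x| / 3 <= `|sin x|.
  have := ler_pM (divr_ge0 (normr_ge0 x) (ler0n R 3)) (divr_ge0 (normr_ge0 x) (ler0n R 3)) H H.
  rewrite -!expr2 exprMn !real_normK ?num_real//; lra.
have sx : `|sin x| = `|sin `|x| |.
  by have [x0|x0] := leP 0 x; [rewrite (ger0_norm x0)|rewrite (ltr0_norm x0) sinN normrN].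
rewrite sx; apply: le_trans (ler_norm _); set y := `|x|.
have [c cy] := mvt0 h y; rewrite sin0 mul0r !subr0 => e.
have hc : `|c| <= 1 by rewrite (le_trans cy)// normr_id.
have cosc : cos c = 1 - 2 * sin (c / 2) ^+ 2.
  rewrite {1}(_ : c = (c / 2) *+ 2); last by rewrite mulr2n; lra.
  rewrite cos_mulr2n cos2sin2 mulr2n; ring.
have s2 : sin (c / 2) ^+ 2 <= 1 / 4.
  rewrite -[leLHS]real_normK ?num_real//.
  have := sin_le (c / 2); rewrite normrM [ `|2^-1|]ger0_norm ?invr_ge0// => sc.
  have s0 := normr_ge0 (sin (c / 2)); nra.
have y0 : 0 <= y by exact: normr_ge0.
nra.
Qed.

Lemma realcM (x y : R) : (x * y)%:C%C = x%:C%C * y%:C%C :> R[i].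
Proof. by apply: complex_ext; rewrite /= !(mulr0, mul0r, subr0, addr0). Qed.

Definition expi x : R[i] := (cos x +i* sin x)%C.

Lemma expiD x y : expi (x + y) = expi x * expi y.
Proof. by rewrite /expi cosD sinD; apply: complex_ext => //=; rewrite addrC. Qed.

Lemma expi0 : expi 0 = 1. Proof. by rewrite /expi cos0 sin0. Qed.

Lemma normc_expi x : normc (expi x) = 1.
Proof. by rewrite /normc/= cos2Dsin2 sqrtr1. Qed.

Lemma expiN x : expi (- x) = (cos x -i* sin x)%C.
Proof. by rewrite /expi cosN sinN. Qed.

Lemma expiK x : expi (- x) * expi x = 1.
Proof. by rewrite -expiD addNr expi0. Qed.

Lemma expi_sum (I : finType) (F : I -> R) :
  expi (\sum_i F i) = \prod_i expi (F i).
Proof. exact: (big_morph _ expiD expi0). Qed.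

Lemma expi_lip x y : normc (expi x - expi y) <= 2 * `|x - y|.
Proof.
have -> : expi x - expi y = expi y * (expi (x - y) - 1).
  by rewrite mulrBr mulr1 -expiD [y + _]addrC subrK.
rewrite normcM normc_expi mul1r (le_trans (normc_le_ReIm _))//=.
by rewrite subr0 mulr_natl mulr2n lerD ?cosB1_le ?sin_le.
Qed.

Lemma expi_taylor x h :
  normc (expi (x + h) - expi x - h%:C%C * ('i%C * expi x)) <= 2 * h ^+ 2.
Proof.
have -> : expi (x + h) - expi x - h%:C%C * ('i%C * expi x) =
    expi x * (expi h - 1 - h%:C%C * 'i%C).
  by rewrite expiD !mulrBr mulr1; congr (_ - _); ring.
rewrite normcM normc_expi mul1r (le_trans (normc_le_ReIm _))//=.
rewrite !(mulr0, mul0r, mulr1, subr0, addr0, add0r, oppr0).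
by rewrite mulr_natl mulr2n lerD ?cosB1_le2 ?sinBid_le2.
Qed.

End Trigonometry.

(** * Families closed under differentiation *)

Section Families.
Context {R : realType} {n : nat}.
Local Notation V := ('rV[R]_n).
Local Notation C := (R[i]).

Lemma is_derive_quadratic (v : V -> R) (x e : V) (d K : R) :
  (forall h : R, `|v (x + h *: e) - v x - h * d| <= K * h ^+ 2) ->
  is_derive x e v d.
Proof.
move=> H.
have K0 : 0 <= K.
  by have := le_trans (normr_ge0 _) (H 1); rewrite expr1n mulr1.
have L : (fun h => h^-1 *: ((v \o shift x) (h *: e) - v x)) @ 0^' --> d.
  apply/cvgrPdist_le => eps eps0.
  near=> h.
  have h0 : h != 0 by near: h; exact: nbhs_dnbhs_neq.
  have hK : (K + 1) * `|h| <= eps.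
    rewrite -ler_pdivlMl; last lra.
    near: h; apply: dnbhs0_le; apply: mulr_gt0 => //; rewrite invr_gt0; lra.
  rewrite /= distrC [h *: e + x]addrC.
  have -> : h^-1 *: (v (x + h *: e) - v x) - d = h^-1 * (v (x + h *: e) - v x - h * d).
    by rewrite /GRing.scale/= [in RHS]mulrBr mulKf.
  rewrite normrM normfV ler_pdivrMl ?normr_gt0//.
  apply: le_trans (H h) _.
  rewrite -[h ^+ 2]real_normK ?num_real// expr2 mulrCA ler_wpM2l//.
  by apply: le_trans hK; rewrite ler_wpM2r//; lra.
apply: DeriveDef; first by apply/cvg_ex; exists d.
exact: (cvg_lim _ L).
Unshelve. all: by end_near. Qed.

Lemma lipschitz_continuous (v : V -> R) (K : R) :
  (forall x y, `|v x - v y| <= K * `|x - y|) -> forall x, {for x, continuous v}.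
Proof.
move=> H; suff: forall x : V, v y @[y --> x] --> v x by [].
move=> x B /nbhs_ballP[e /= e0 eB].
have K0 : 0 < `|K| + 1 by have := normr_ge0 K; lra.
have d0 : 0 < e / (`|K| + 1) by exact: divr_gt0.
apply: filterS (nbhsx_ballx x _ d0) => y; rewrite mx_norm_ball /ball_/= => hy.
apply: eB; rewrite /ball/=; apply: le_lt_trans (H x y) _.
rewrite ltr_pdivlMr// mulrC in hy.
by apply: le_lt_trans hy; rewrite ler_wpM2r// (le_trans (ler_norm _))// lerDl.
Qed.

(** How smoothness of integrals and limits of exponentials is established
without exchanging a limit and a derivative: a first order Taylor estimate with
a uniform constant survives integration and passage to the limit. *)
Lemma smooth_family (G : seq 'I_n -> V -> C) :
  (forall a, exists K : R, forall x y, normc (G a x - G a y) <= K * `|x - y|) ->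
  (forall a i, exists K : R, forall x (h : R),
    normc (G a (x + h *: delta_mx 0 i) - G a x - h%:C%C * G (i :: a) x) <=
      K * h ^+ 2) ->
  Smooth (G [::]) /\ forall a, iter_partialC a (G [::]) = G a.
Proof.
move=> lipG taylorG.
have hp a i x : has_partial i x (G a) (G (i :: a) x).
  have [K hK] := taylorG a i.
  have E (h : R) : `|Re (G a (x + h *: delta_mx 0 i)) - Re (G a x) - h * Re (G (i :: a) x)| <= K * h ^+ 2.
    apply: le_trans (hK x h); apply: le_trans (Re_le_normc _).
    by rewrite !(cReD, cReN, cReM)/= mul0r subr0.
  have E' (h : R) : `|Im (G a (x + h *: delta_mx 0 i)) - Im (G a x) - h * Im (G (i :: a) x)| <= K * h ^+ 2.
    apply: le_trans (hK x h); apply: le_trans (Im_le_normc _).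
    by rewrite !(cImD, cImN, cImM)/= mul0r addr0.
  by split; apply: is_derive_quadratic; [exact: E|exact: E'].
have iG a : iter_partialC a (G [::]) = G a.
  elim: a => [|i a IH]; first by rewrite iter_partialC_nil.
  by apply/funext => x; apply: iter_partialC_cons; rewrite IH.
split=> //.
have oT := @openT V.
have [||//|sG _] := @smooth_class _ _ setT (fun u => exists a, u = G a) oT _ _ (G [::]).
- move=> _ [a ->] x _; have [K hK] := lipG a.
  split; apply: (@lipschitz_continuous _ K) => y z.
    by apply: le_trans (hK y z); apply: le_trans (Re_le_normc _); rewrite cReD cReN.
  by apply: le_trans (hK y z); apply: le_trans (Im_le_normc _); rewrite cImD cImN.
- by move=> _ [a ->] i; exists (G (i :: a)); [exists (i :: a)|move=> x _; exact: hp].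
- by exists [::].
by split.
Qed.

(** The plane wave of frequency [xi]. *)
Definition wave (xi x : V) : C := expi (2 * pi * dotp x xi).

Definition wave_coef (xi : V) (a : seq 'I_n) : C :=
  \prod_(i <- a) ('i%C * (2 * pi * xi 0 i)%:C%C).

Lemma normc_wave xi x : normc (wave xi x) = 1.
Proof. exact: normc_expi. Qed.

Lemma waveD xi eta x : wave (xi + eta) x = wave xi x * wave eta x.
Proof. by rewrite /wave dotpDr mulrDr expiD. Qed.

Lemma waveDx xi x y : wave xi (x + y) = wave xi x * wave xi y.
Proof. by rewrite /wave dotpDl mulrDr expiD. Qed.

Lemma wave0 x : wave 0 x = 1.
Proof. by rewrite /wave -(scale0r 0) dotpC dotpZl mul0r mulr0 expi0. Qed.

Lemma waveNx xi x : wave xi (- x) = wave (- xi) x.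
Proof. by rewrite /wave dotpNl dotpNr. Qed.

Lemma waveC xi x : wave xi x = wave x xi.
Proof. by rewrite /wave dotpC. Qed.

Lemma wave_lip xi x y :
  normc (wave xi x - wave xi y) <= 4 * pi * n%:R * `|xi| * `|x - y|.
Proof.
have pi0 := @pi_ge0 R.
apply: le_trans (expi_lip _ _) _.
rewrite -mulrBr -dotpNl -dotpDl normrM ger0_norm; last by rewrite mulr_ge0.
have := dotp_le_norm (x - y) xi => h.
have : 2 * (2 * pi) * `|dotp (x - y) xi| <= 2 * (2 * pi) * (n%:R * (`|x - y| * `|xi|)).
  by rewrite ler_wpM2l// mulr_ge0// mulr_ge0.
by rewrite !mulrA => /le_trans; apply; rewrite le_eqVlt; apply/orP; left; apply/eqP; ring.
Qed.

Lemma wave_taylor xi x i (h : R) :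
  normc (wave xi (x + h *: delta_mx 0 i) - wave xi x -
    h%:C%C * ('i%C * (2 * pi * xi 0 i)%:C%C * wave xi x)) <=
  2 * (2 * pi * xi 0 i) ^+ 2 * h ^+ 2.
Proof.
rewrite /wave dotpDl dotpZl dotp_delta mulrDr.
set y := 2 * pi * dotp x xi; set c := 2 * pi * (h * xi 0 i).
have := expi_taylor y c.
have -> : c = h * (2 * pi * xi 0 i) by rewrite /c; ring.
set d := 2 * pi * xi 0 i; rewrite exprMn.
have -> : h%:C%C * ('i%C * d%:C%C * expi y) = (h * d)%:C%C * ('i%C * expi y).
  by rewrite realcM; ring.
by rewrite mulrCA mulrA mulrC mulrA => /le_trans; apply; rewrite le_eqVlt; apply/orP; left; apply/eqP; ring.
Qed.

Lemma wave_partials xi : Smooth (wave xi) /\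
  forall a, iter_partialC a (wave xi) = fun x => wave_coef xi a * wave xi x.
Proof.
pose G a x := wave_coef xi a * wave xi x.
have G0 : G [::] = wave xi by apply/funext => x; rewrite /G /wave_coef big_nil mul1r.
have [||sG hG] := @smooth_family G; last by rewrite G0 in sG hG.
- move=> a.
  exists (normc (wave_coef xi a) * (4 * pi * n%:R * `|xi|)) => x y.
  by rewrite /G -mulrBr normcM -[leRHS]mulrA ler_wpM2l ?normc_ge0// wave_lip.
move=> a i; exists (normc (wave_coef xi a) * (2 * (2 * pi * xi 0 i) ^+ 2)) => x h.
rewrite /G /wave_coef big_cons.
set c := \prod_(_ <- _) _; set d := 'i%C * _.
have -> : h%:C%C * (d * c * wave xi x) = c * (h%:C%C * (d * wave xi x)) by ring.
rewrite -!mulrBr normcM -[leRHS]mulrA ler_wpM2l ?normc_ge0//; exact: wave_taylor.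
Qed.

Lemma wave_coef_le xi a : normc (wave_coef xi a) <= (1 + 2 * pi * `|xi|) ^+ size a.
Proof.
have pi0 := @pi_ge0 R.
rewrite /wave_coef; elim: a => [|i a IH]; first by rewrite big_nil normc1.
rewrite big_cons normcM [size _]/= exprS ler_pM ?normc_ge0//.
rewrite normcM normc_real normrM ger0_norm ?mulr_ge0//.
have -> : normc ('i%C : C) = 1 by rewrite /normc expr0n expr1n add0r sqrtr1.
by rewrite mul1r ler_wpDl// ler_wpM2l ?mulr_ge0// coord_le_norm.
Qed.

Lemma wave_bounded xi : Bounded_derivatives (wave xi).
Proof.
have [sw hw] := wave_partials xi; split => // a.
by exists (normc (wave_coef xi a)) => x; rewrite hw normcM normc_wave mulr1.
Qed.

Lemma has_partial_shift i x c (u : V -> C) d : has_partial i (x - c) u d ->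
  has_partial i x (fun t => u (t - c)) d.
Proof.
have H (v : V -> R) e : is_derive (x - c) (delta_mx 0 i) v e ->
    is_derive x (delta_mx 0 i) (fun t => v (t - c)) e.
  have E : (fun h : R => h^-1 *: (((fun t => v (t - c)) \o shift x) (h *: delta_mx 0 i) - v (x - c))) =
           (fun h : R => h^-1 *: ((v \o shift (x - c)) (h *: delta_mx 0 i) - v (x - c))).
    by apply/funext => h /=; rewrite addrA.
  by move=> [hd <-]; split; rewrite /derivable /derive E.
by move=> [hr hi]; split; [exact: (H (fun t => Re (u t)))|exact: (H (fun t => Im (u t)))].
Qed.

Lemma cont_at_shift (x c : V) (u : V -> C) : cont_at (x - c) u ->
  cont_at x (fun t => u (t - c)).
Proof.
have H (v : V -> R) : {for (x - c), continuous v} -> {for x, continuous (fun t : V => v (t - c))}.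
  move=> hv; apply: (@continuous_comp _ _ _ (fun t : V => t - c) v); last exact: hv.
  by apply: continuousB; [exact: cvg_id|exact: cst_continuous].
by move=> [hr hi]; split; [exact: (H (fun t => Re (u t)))|exact: (H (fun t => Im (u t)))].
Qed.

Lemma Smooth_shift c (u : V -> C) : Smooth u -> Smooth (fun t => u (t - c)).
Proof.
move=> su; split.
have [||//|s _] := @smooth_class _ _ setT
  (fun v => exists2 w, Smooth w & v = fun t => w (t - c)) (@openT V) _ _ (fun t => u (t - c)).
- by move=> _ [w sw ->] x _; apply/cont_at_shift/Smooth_cont.
- move=> _ [w sw ->] i; exists (fun t => iter_partialC [:: i] w (t - c)).
    by exists (iter_partialC [:: i] w) => //; exact: Smooth_partial.
  by move=> x _; apply/has_partial_shift/Smooth_has_partial.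
- by exists u.
exact: s.
Qed.

End Families.

(** * Integration on the space of rows *)

Section TupleMeasure.
Context {R : realType}.
Local Notation RR := (measurableTypeR R).
Local Notation leb := (@lebesgue_measure R).
Implicit Types n : nat.

Lemma measurable_shiftR (s : R) : measurable_fun setT (fun x : RR => (x + s : RR)).
Proof. by apply: measurable_funD => //; exact: measurable_id. Qed.

Lemma lebesgue_measure_shift (s : R) (A : set RR) : measurable A ->
  leb ((fun x : RR => (x + s : RR)) @^-1` A) = leb A.
Proof.
move=> mA; pose phi (x : RR) : RR := x + s.
have mphi : measurable_fun setT phi by exact: measurable_shiftR.
suff E : leb A = pushforward leb phi A by rewrite E.
apply: lebesgue_measure_unique => // _ [[a b]] _ <-.
rewrite -[RHS]/(leb (phi @^-1` _)) (_ : phi @^-1` _ = `]a - s, b - s]%classic); last first.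
  by apply/seteqP; split => x /=; rewrite !in_itv/= ltrBlDr lerBrDr.
by rewrite !lebesgue_measure_itv/= !lte_fin ltrD2r -!EFinB opprD addrACA subrr addr0.
Qed.

Definition tshift n (s : n.-tuple RR) (t : n.-tuple RR) : n.-tuple RR :=
  [tuple (tnth t i + tnth s i : RR) | i < n].

Lemma tnth_tshift n (s t : n.-tuple RR) i : tnth (tshift s t) i = tnth t i + tnth s i.
Proof. by rewrite tnth_mktuple. Qed.

Lemma measurable_tshift n (s : n.-tuple RR) : measurable_fun setT (tshift s).
Proof.
apply/measurable_fun_tnthP => i.
rewrite (_ : _ \o _ = (fun x : RR => (x + tnth s i : RR)) \o (fun t : n.-tuple RR => tnth t i)).
  apply: measurableT_comp; first exact: measurable_shiftR.
  exact: measurable_tnth.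
by apply/funext => t /=; rewrite tnth_tshift.
Qed.

Lemma lebesgue_tuple_shift n (s : n.-tuple RR) (A : set (n.-tuple RR)) :
  measurable A -> lebesgue_tuple n (tshift s @^-1` A) = lebesgue_tuple n A.
Proof.
elim: n s A => [|n IH] s A mA.
  by congr (lebesgue_tuple 0 _); apply/seteqP; split => t /=; rewrite (tuple0 (tshift s t)) (tuple0 t).
rewrite /= /lebesgue_tcons /pushforward.
pose s0 := thead s; pose s' := [tuple of behead s].
pose phi (z : RR * n.-tuple RR) : RR * n.-tuple RR := (z.1 + s0, tshift s' z.2).
have mphi : measurable_fun setT phi.
  apply/measurable_fun_pairP; split.
    by apply: (measurableT_comp (measurable_shiftR s0)); exact: measurable_fst.
  by apply: (measurableT_comp (measurable_tshift s')); exact: measurable_snd.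
rewrite (_ : tcons (n:=n) @^-1` (tshift s @^-1` A) = phi @^-1` (tcons (n:=n) @^-1` A)); last first.
  suff E z : tshift s (tcons z) = tcons (phi z).
    by apply/seteqP; split => z /=; rewrite E.
  apply/eq_from_tnth => i; rewrite tnth_tshift.
  case: (unliftP ord0 i) => [j ->|->].
    rewrite !tnthS /= tnth_tshift; congr (_ + _).
    by rewrite [in LHS](tuple_eta s) tnthS.
  by rewrite [in LHS](tuple_eta s) !tnth0.
have mA' : measurable (tcons (n:=n) @^-1` A).
  by rewrite -[X in measurable X]setTI; exact: measurable_tcons.
suff E : (leb \x lebesgue_tuple n)%E (tcons (n:=n) @^-1` A) =
    pushforward (leb \x lebesgue_tuple n)%E phi (tcons (n:=n) @^-1` A) by rewrite E.
apply: product_measure_unique => // B D mB mD.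
rewrite -[LHS]/((leb \x lebesgue_tuple n)%E (phi @^-1` (B `*` D))) (_ : phi @^-1` _ =
  ((fun x : RR => (x + s0 : RR)) @^-1` B) `*` (tshift s' @^-1` D)); last first.
  by apply/seteqP; split => -[x t].
rewrite product_measure1E//; last 2 first.
- by rewrite -[X in measurable X]setTI; exact: measurable_shiftR.
- by rewrite -[X in measurable X]setTI; exact: measurable_tshift.
by rewrite IH//; congr (_ * _)%E; exact: lebesgue_measure_shift.
Qed.

(** By induction on the dimension, from Tonelli's theorem. *)
Lemma integral_tensor n (Phi : 'I_n -> RR -> R) :
  (forall i, measurable_fun setT (Phi i)) -> (forall i x, 0 <= Phi i x) ->
  (\int[lebesgue_tuple n]_t (\prod_i Phi i (tnth t i))%:E =
   \prod_i \int[leb]_x (Phi i x)%:E)%E.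
Proof.
elim: n Phi => [|n IH] Phi mP P0.
  by rewrite big_ord0; under eq_integral do rewrite big_ord0; rewrite integral_dirac// diracT mul1e.
have mprod m (Psi : 'I_m -> RR -> R) : (forall i, measurable_fun setT (Psi i)) ->
    measurable_fun setT (fun t : m.-tuple RR => \prod_i Psi i (tnth t i)).
  move=> mPsi; apply: measurable_prod => i _.
  by apply: (measurableT_comp (mPsi i)); exact: measurable_tnth.
rewrite big_ord_recl -IH//.
rewrite ge0_integral_pushforward//=; last 2 first.
- by apply/measurable_EFinP; exact: mprod.
- by move=> t _; rewrite lee_fin prodr_ge0.
rewrite preimage_setT fubini_tonelli1; last 2 first.
- apply/measurable_EFinP; apply: (measurableT_comp (mprod _ _ mP)).
  exact: measurable_tcons.
- by move=> z; rewrite lee_fin prodr_ge0.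
rewrite /fubini_F /=.
set J := (\int[lebesgue_tuple n]_t _)%E.
transitivity (\int[leb]_x ((Phi ord0 x)%:E * J))%E.
  apply: eq_integral => x _; rewrite -ge0_integralZl//; last 3 first.
  - by apply/measurable_EFinP; exact: (mprod _ (fun i => Phi (lift ord0 i))).
  - by move=> t _; rewrite lee_fin prodr_ge0.
  - by rewrite lee_fin.
  apply: eq_integral => t _; rewrite big_ord_recl tnth0 -EFinM.
  congr (_ * _)%:E; apply: eq_bigr => i _; congr (Phi _ _).
  by rewrite /tcons /= tnthS.
rewrite ge0_integralZr//; last 3 first.
- exact/measurable_EFinP.
- by move=> x _; rewrite lee_fin.
- by apply: integral_ge0 => t _; rewrite lee_fin prodr_ge0.
Qed.

Lemma measurable_tbox n (A : 'I_n -> set RR) : (forall i, measurable (A i)) ->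
  measurable [set t : n.-tuple RR | forall i, A i (tnth t i)].
Proof.
move=> mA; rewrite (_ : mkset _ =
  \bigcap_(i in [set: 'I_n]) ((@tnth n RR ^~ i) @^-1` (A i))).
  apply: fin_bigcap_measurable => [|i _]; first exact: finite_finset.
  by rewrite -[X in measurable X]setTI; exact: measurable_tnth.
by apply/seteqP; split=> [t + i _|t + i]; apply.
Qed.

(** An open set is a countable union of cubes with rational centres and radii
[1/(m+1)]; this links the topology of rows with the product sigma-algebra of
tuples. *)
Lemma measurable_rowt_open n (U : set 'rV[R]_n) : open U ->
  measurable (@rowt R n @^-1` U).
Proof.
move=> oU.
pose F (p : {ffun 'I_n -> rat} * nat) : set (n.-tuple RR) :=
  if `[< forall y : 'rV[R]_n, (forall i, `|y 0 i - ratr (p.1 i)| < (p.2.+1%:R)^-1) -> U y >]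
  then [set t | forall i, `](ratr (p.1 i) - p.2.+1%:R^-1), (ratr (p.1 i) + p.2.+1%:R^-1)[%classic (tnth t i)]
  else set0.
have hin (y q e : R) : (y \in `](q - e), (q + e)[) = (`|y - q| < e).
  by rewrite in_itv/= ltr_distl.
rewrite (_ : _ @^-1` U = \bigcup_p F p).
  apply: countable_bigcupT_measurable => [|p]; first exact: countableP.
  rewrite /F.
  case: asboolP => // _.
  apply: (@measurable_tbox _ (fun i => `](ratr (p.1 i) - p.2.+1%:R^-1), (ratr (p.1 i) + p.2.+1%:R^-1)[%classic : set RR)).
  by move=> i; exact: measurable_itv.
apply/seteqP; split => [t /= Ut|t [p _]]; last first.
  rewrite /F; case: asboolP => // h /= ht; apply: h => i.
  by rewrite mxE; have := ht i; rewrite /= hin.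
have /nbhs_ballP[e /= e0 eU] : nbhs (rowt t) U by exact: open_nbhs_nbhs.
have [m me] : exists m : nat, (m.+1%:R : R)^-1 * 2 < e.
  exists (Num.truncn (2 / e)); rewrite mulrC ltr_pdivrMr// -ltr_pdivrMl// mulrC.
  exact: truncnS_gt.
have m0 : 0 < (m.+1%:R : R)^-1 by rewrite invr_gt0.
have hq i : {q : rat | `|tnth t i - ratr q| < m.+1%:R^-1}.
  have h : tnth t i - m.+1%:R^-1 < tnth t i + m.+1%:R^-1.
    by rewrite ltrD2l (lt_trans _ m0)// oppr_lt0.
  have [q] := cid (rat_in_itvoo h); rewrite hin => hq.
  by exists q; rewrite distrC.
exists ([ffun i => sval (hq i)], m) => //; rewrite /F.
case: asboolP => [_ i /=|[]].
  by rewrite /= hin ffunE; exact: (svalP (hq i)).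
move=> y hy; apply: eU; rewrite mx_norm_ball /ball_/=.
apply: le_lt_trans me.
apply: row_norm_le => [|i]; first by rewrite mulr_ge0// ltW.
rewrite !mxE; have := hy i; have := svalP (hq i) => /=; rewrite ffunE.
set q := ratr _; set a := tnth t i => h1 h2.
have -> : a - y 0 i = (a - q) - (y 0 i - q) by ring.
by rewrite (le_trans (ler_normB _ _))// mulr_natr mulr2n ltW// ltrD.
Qed.

Lemma measurable_rowt_continuous n (v : 'rV[R]_n -> R) :
  (forall x, {for x, continuous v}) -> measurable_fun setT (v \o @rowt R n).
Proof.
move=> cv; apply: (measurability _ (RGenOInfty.measurableE R)).
move=> _ [_ [a ->] <-]; rewrite setTI comp_preimage; apply: measurable_rowt_open.
apply: open_comp; first by move=> x _; exact: cv.
by rewrite set_itvE; exact: open_gt.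
Qed.

End TupleMeasure.

Section IntegralBound.
Context d (T : measurableType d) {R : realType} (mu : {measure set T -> \bar R}).

(** The integral of a non-negative function is the supremum of the integrals of the
simple functions below it, hence monotone, measurable or not. *)
Lemma ge0_le_integral_nonmeas (f g : T -> \bar R) :
  (forall x, 0 <= f x)%E -> (forall x, f x <= g x)%E ->
  (\int[mu]_x f x <= \int[mu]_x g x)%E.
Proof.
move=> f0 fg; have g0 x : (0 <= g x)%E by exact: le_trans (f0 x) (fg x).
rewrite !ge0_integralTE//; apply: ereal_sup_le => _ [h /= hf <-].
by exists h => //= x; exact: le_trans (hf x) (fg x).
Qed.

(** The positive and the negative part of [g] are both below [p]. Of the functions
that represent the windowed Fourier transforms in a cone only a bound is known;
their integrals are estimated by it alone. *)
Lemma Rintegral_bound (g p : T -> R) (J : R) : (forall x, `|g x| <= p x) ->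
  (\int[mu]_x (p x)%:E <= J%:E)%E -> `|\int[mu]_x g x| <= J.
Proof.
move=> gp hJ; rewrite /Rintegral integralE.
set P := (\int[mu]_x _)%E; set N := (\int[mu]_x _)%E.
have P0 : (0 <= P)%E by apply: integral_ge0 => x _; exact: funepos_ge0.
have N0 : (0 <= N)%E by apply: integral_ge0 => x _; exact: funeneg_ge0.
have PJ : (P <= J%:E)%E.
  apply: le_trans hJ; apply: ge0_le_integral_nonmeas => x; first exact: funepos_ge0.
  rewrite funepos.unlock ge_max !lee_fin; have := gp x; rewrite ler_norml => /andP[h1 h2].
  by rewrite h2/= (le_trans (normr_ge0 _) (gp x)).
have NJ : (N <= J%:E)%E.
  apply: le_trans hJ; apply: ge0_le_integral_nonmeas => x; first exact: funeneg_ge0.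
  rewrite funeneg.unlock ge_max !lee_fin; have := gp x; rewrite ler_norml => /andP[h1 h2].
  by rewrite lerNl h1/= (le_trans (normr_ge0 _) (gp x)).
have -> : P = (fine P)%:E by rewrite fineK// ge0_fin_numE// (le_lt_trans PJ)// ltry.
have -> : N = (fine N)%:E by rewrite fineK// ge0_fin_numE// (le_lt_trans NJ)// ltry.
have fP : 0 <= fine P <= J.
  by rewrite fine_ge0//= -lee_fin fineK// ge0_fin_numE// (le_lt_trans PJ)// ltry.
have fN : 0 <= fine N <= J.
  by rewrite fine_ge0//= -lee_fin fineK// ge0_fin_numE// (le_lt_trans NJ)// ltry.
rewrite -EFinB /= ler_norml; lra.
Qed.

End IntegralBound.

Section IntegralRows.
Context {R : realType} {n : nat}.
Local Notation V := ('rV[R]_n).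
Local Notation C := (R[i]).
Local Notation RR := (measurableTypeR R).
Local Notation mu := (lebesgue_tuple n).
Implicit Types (u v w : V -> C) (x c : V) (i : 'I_n) (r : R).

Definition box c r : set V := [set x | forall i, `|x 0 i - c 0 i| <= r].

Lemma box_norm c r x : 0 <= r -> box c r x <-> `|x - c| <= r.
Proof.
move=> r0; split=> [h|h i].
  by apply: row_norm_le => // i; rewrite !mxE; exact: h.
by apply: le_trans h; have := coord_le_norm (x - c) i; rewrite !mxE.
Qed.

Let itvbox c r := fun i : 'I_n => (`[c 0 i - r, c 0 i + r]%classic : set RR).

Lemma rowt_box c r : @rowt R n @^-1` box c r =
  [set t | forall i, itvbox c r i (tnth t i)].
Proof.
by apply/seteqP; split => t /= h i; have := h i; rewrite /itvbox /= mxE in_itv/= ler_distl.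
Qed.

Lemma measurable_box c r : measurable (@rowt R n @^-1` box c r).
Proof. by rewrite rowt_box; apply: measurable_tbox => i; exact: measurable_itv. Qed.

Lemma measure_box c r : 0 <= r -> mu (@rowt R n @^-1` box c r) = ((2 * r) ^+ n)%:E.
Proof.
move=> r0; rewrite rowt_box lebesgue_tuple_box; last by move=> i; exact: measurable_itv.
rewrite (eq_bigr (fun=> (2 * r)%:E)) => [|i _].
  by rewrite prodEFin prodr_const card_ord.
rewrite /itvbox lebesgue_measure_itv/= lte_fin.
have e : c 0 i + r - (c 0 i - r) = 2 * r by ring.
rewrite -EFinB e.
case: ifPn => // h; congr EFin.
have : r <= 0 by move: h; rewrite -leNgt; lra.
lra.
Qed.

Lemma compact_box c r : compact (box c r).
Proof.
rewrite (_ : box c r = [set v : V | forall i, `[c 0 i - r, c 0 i + r]%classic (v ord0 i)]).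
  by apply: (@rV_compact _ _ (fun i => `[c 0 i - r, c 0 i + r]%classic)) => i; exact: segment_compact.
by apply/seteqP; split => t /= h i; have := h i; rewrite /= in_itv/= ler_distl.
Qed.

Variant Cc u : Prop := mkCc of
  (forall x, cont_at x u) & exists r, forall x, u x != 0 -> box 0 r x.

Lemma Test_Cc U u : Test U u -> Cc u.
Proof.
move=> [su cu _]; split=> [x|]; first exact: Smooth_cont.
have [M [_ hM]] := compact_bounded cu.
exists (`|M| + 1) => x ux; apply/box_norm; first by rewrite addr_ge0.
rewrite subr0; apply: (hM (`|M| + 1)); first by rewrite (le_lt_trans (ler_norm _))// ltrDl.
by apply: subset_closure.
Qed.

Lemma Cc_mul u v : (forall x, cont_at x v) -> Cc u -> Cc (fun t => v t * u t).
Proof.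
move=> cv [cu [r hr]]; split; first by move=> x; exact: cont_atM.
by exists r => x; rewrite mulf_eq0 => /norP[_]; exact: hr.
Qed.

Lemma box_incl c r r' x : r <= r' -> box c r x -> box c r' x.
Proof. by move=> rr h i; exact: le_trans (h i) rr. Qed.

Lemma Cc_lin (k : C) u v : Cc u -> Cc v -> Cc (fun t => k * u t + v t).
Proof.
move=> [cu [r hr]] [cv [r' hr']]; split.
  by move=> x; apply: cont_atD (cont_atM (cont_at_cst k x) (cu x)) (cv x).
exists (Num.max r r') => x ne; have [ux|ux] := eqVneq (u x) 0.
  rewrite ux mulr0 add0r in ne; apply: box_incl (hr' _ ne); by rewrite le_max lexx orbT.
by apply: box_incl (hr _ ux); rewrite le_max lexx.
Qed.

Lemma Cc_shift u c : Cc u -> Cc (fun t => u (t + c)).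
Proof.
move=> [cu [r hr]]; split.
  by move=> x; rewrite -[c]opprK; apply: cont_at_shift.
exists (r + `|c|) => x /hr h i; have := h i; rewrite !mxE !subr0 => h'.
have := coord_le_norm c i => hc.
have -> : x 0 i = (x 0 i + c 0 i) - c 0 i by ring.
by rewrite (le_trans (ler_normB _ _))// lerD.
Qed.

Lemma real_integrable (v : V -> R) r : (forall x, {for x, continuous v}) ->
  (forall x, v x != 0 -> box 0 r x) -> mu.-integrable setT (fun t => (v (rowt t))%:E).
Proof.
move=> cv hr0; pose r' := Num.max r 0.
have hr x : v x != 0 -> box 0 r' x.
  by move=> /hr0; apply: box_incl; rewrite le_max lexx.
have [|B hB] := @cont_bounded_on_compact R n (fun x => `|v x|) _ (@compact_box 0 r').
  by move=> x; apply: (@continuous_comp _ _ _ v Num.norm) => //; exact: norm_continuous.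
pose A := @rowt R n @^-1` box 0 r'.
have mA : measurable A by exact: measurable_box.
apply: (@le_integrable _ _ _ mu setT measurableT _ (fun t => (B%:E * (\1_A t)%:E)%E)).
- by apply/measurable_EFinP; exact: measurable_rowt_continuous.
- move=> t _; rewrite -EFinM !abse_EFin lee_fin.
  have [->|/hr vt] := eqVneq (v (rowt t)) 0; first by rewrite normr0.
  rewrite indicE mem_set// mulr1.
  by rewrite (le_trans _ (ler_norm _))// hB.
- apply: integrableZl => //; apply/integrableP; split.
    by apply/measurable_EFinP; exact: (measurable_indic mA).
  rewrite (eq_integral (fun t => (\1_A t)%:E)); last first.
    by move=> t _; rewrite gee0_abs// lee_fin.
  have -> : (\int[mu]_x (\1_A x)%:E)%E = mu A.
    by have := integral_indic mu measurableT mA; rewrite setIT => <-.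
  by rewrite measure_box ?ltry// le_max lexx orbT.
Qed.

Definition integrable_rows u :=
  mu.-integrable setT (EFin \o (fun t => Re (u (rowt t)))) /\
  mu.-integrable setT (EFin \o (fun t => Im (u (rowt t)))).

Lemma Cc_integrable u : Cc u -> integrable_rows u.
Proof.
move=> [cu [r hr]]; split.
  apply: (@real_integrable (fun x => Re (u x)) r) => [x|x]; first by case: (cu x).
  by move=> ux; apply: hr; apply: contraNneq ux => ->.
apply: (@real_integrable (fun x => Im (u x)) r) => [x|x]; first by case: (cu x).
by move=> ux; apply: hr; apply: contraNneq ux => ->.
Qed.

Lemma integral_RnE u : integral_Rn u =
  (\int[mu]_t Re (u (rowt t)) +i* \int[mu]_t Im (u (rowt t)))%C.
Proof. by []. Qed.

Lemma integral_lin_gen (k : C) u v : integrable_rows u -> integrable_rows v ->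
  integral_Rn (fun t => k * u t + v t) = k * integral_Rn u + integral_Rn v.
Proof.
move=> [ur ui] [vr vi].
have lin (a b : R) (g h l : n.-tuple RR -> R) :
    mu.-integrable setT (EFin \o g) -> mu.-integrable setT (EFin \o h) ->
    mu.-integrable setT (EFin \o l) ->
    \int[mu]_t (a * g t + b * h t + l t) =
    a * \int[mu]_t g t + b * \int[mu]_t h t + \int[mu]_t l t.
  move=> ig ih il.
  have iag : mu.-integrable setT (EFin \o (fun t => a * g t)) by exact: (integrableZl measurableT _ ig).
  have ibh : mu.-integrable setT (EFin \o (fun t => b * h t)) by exact: (integrableZl measurableT _ ih).
  have igh : mu.-integrable setT (EFin \o (fun t => a * g t + b * h t)) by exact: (integrableD measurableT iag ibh).
  by rewrite RintegralD// RintegralD// RintegralZl// RintegralZl.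
apply: complex_ext; rewrite ?cReD ?cImD ?cReM ?cImM /=.
  under eq_Rintegral do rewrite cReD cReM -mulNr.
  by rewrite lin// mulNr.
under eq_Rintegral do rewrite cImD cImM.
by rewrite lin.
Qed.

Lemma integral_lin (k : C) u v : Cc u -> Cc v ->
  integral_Rn (fun t => k * u t + v t) = k * integral_Rn u + integral_Rn v.
Proof. by move=> /Cc_integrable iu /Cc_integrable iv; exact: integral_lin_gen. Qed.

Lemma integral_Rn0 : integral_Rn (fun _ : V => 0) = 0.
Proof. by rewrite integral_RnE; apply: complex_ext; rewrite /= Rintegral_cst//= mul0r. Qed.

Lemma Cc0 : Cc (fun=> 0).
Proof. by split=> [x|]; [exact: cont_at_cst|exists 0 => x; rewrite eqxx]. Qed.

Lemma integralZ (k : C) u : Cc u -> integral_Rn (fun t => k * u t) = k * integral_Rn u.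
Proof.
move=> cu; have := integral_lin k cu Cc0; rewrite integral_Rn0 addr0 => <-.
by congr integral_Rn; apply/funext => t; rewrite addr0.
Qed.

Lemma integral_sum (I : finType) (k : I -> C) (F : I -> V -> C) :
  (forall j, Cc (F j)) ->
  Cc (fun t => \sum_j k j * F j t) /\
  integral_Rn (fun t => \sum_j k j * F j t) = \sum_j k j * integral_Rn (F j).
Proof.
move=> cF; elim: (index_enum I) => [|j s [IH1 IH2]].
  rewrite (_ : (fun t => _) = fun=> 0); last by apply/funext => t; rewrite big_nil.
  by split; [exact: Cc0|rewrite integral_Rn0 big_nil].
rewrite (_ : (fun t => _) = fun t => k j * F j t + \sum_(j <- s) k j * F j t); last first.
  by apply/funext => t; rewrite big_cons.
split; first exact: Cc_lin.
by rewrite integral_lin// big_cons IH2.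
Qed.

(** The factor [2] comes from bounding the real and the imaginary part
separately. *)
Lemma integral_bound u (p : V -> R) (J : R) : (forall x, normc (u x) <= p x) ->
  (\int[mu]_t (p (rowt t))%:E <= J%:E)%E -> normc (integral_Rn u) <= 2 * J.
Proof.
move=> up hJ; rewrite integral_RnE (le_trans (normc_le_ReIm _))//=.
rewrite mulr_natl mulr2n lerD//; apply: Rintegral_bound hJ => t.
  exact: le_trans (Re_le_normc _) (up _).
exact: le_trans (Im_le_normc _) (up _).
Qed.

Lemma integral_box_bound u c r (B : R) : 0 <= r -> 0 <= B ->
  (forall x, normc (u x) <= B) -> (forall x, u x != 0 -> box c r x) ->
  normc (integral_Rn u) <= 2 * (B * (2 * r) ^+ n).
Proof.
move=> r0 B0 hB hr.
pose A := @rowt R n @^-1` box c r.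
have mA : measurable A by exact: measurable_box.
apply: (@integral_bound u (fun x => B * \1_(box c r) x)) => [x|].
  have [ux|/hr ux] := eqVneq (u x) 0; first by rewrite ux normc0 mulr_ge0.
  by rewrite indicE mem_set// mulr1.
under eq_integral do rewrite EFinM.
rewrite ge0_integralZl//=; last first.
  by apply/measurable_EFinP; exact: (measurable_indic mA).
have -> : (\int[mu]_t (\1_(box c r) (rowt t))%:E)%E = mu A.
  by have := integral_indic mu measurableT mA; rewrite setIT => <-.
by rewrite measure_box// -EFinM.
Qed.

Lemma integral_shift u c : Cc u ->
  integral_Rn (fun t => u (t + c)) = integral_Rn u.
Proof.
move=> cu; have cuc := Cc_shift c cu.
pose s : n.-tuple RR := [tuple (c 0 i : RR) | i < n].
have rs t : rowt t + c = rowt (tshift s t).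
  by apply/rowP => i; rewrite !mxE tnth_tshift tnth_mktuple.
have key (v : V -> R) : (forall x, {for x, continuous v}) ->
    mu.-integrable setT (EFin \o (fun t => v (rowt t + c))) ->
    \int[mu]_t v (rowt t + c) = \int[mu]_t v (rowt t).
  move=> cv iv; rewrite /Rintegral; congr fine.
  under eq_integral do rewrite rs.
  have mv : measurable_fun setT (EFin \o (v \o @rowt R n)).
    by apply/measurable_EFinP; exact: measurable_rowt_continuous.
  have := @integral_pushforward _ _ _ _ R _ (measurable_tshift s) mu setT _ mv _ measurableT.
  rewrite preimage_setT => <-; last first.
    apply: eq_integrable iv => // t _ /=.
    by rewrite rs.
  have mshift := measurable_tshift s.
  by apply: eq_measure_integral => A mA _ /=; exact: lebesgue_tuple_shift.
have [ir ii] := Cc_integrable cuc.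
have [hc _] := cu.
apply: complex_ext => /=.
  by apply: (key (fun x => Re (u x))) => // x; case: (hc x).
by apply: (key (fun x => Im (u x))) => // x; case: (hc x).
Qed.

(** * Integration by parts *)

Lemma is_derive_line (v : V -> R) (x e : V) (d : R) (s : R) :
  is_derive (x + s *: e) e v d -> is_derive s 1 (fun s : R => v (x + s *: e)) d.
Proof.
have E : (fun h : R => h^-1 *: (((fun s : R => v (x + s *: e)) \o shift s) (h *: 1) - v (x + s *: e))) =
         (fun h : R => h^-1 *: ((v \o shift (x + s *: e)) (h *: e) - v (x + s *: e))).
  apply/funext => h /=; congr (_ *: (v _ - _)).
  by rewrite scalerDl [h *: 1]mulr1 addrCA.
by move=> [hd <-]; split; rewrite /derivable /derive E.
Qed.

(** Two applications of the mean value theorem on the line [x + s e]. *)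
Lemma real_taylor2 (v v' v'' : V -> R) (e : V) (B : R) :
  (forall x, is_derive x e v (v' x)) -> (forall x, is_derive x e v' (v'' x)) ->
  (forall x, `|v'' x| <= B) ->
  forall x (h : R), `|v (x + h *: e) - v x - h * v' x| <= B * h ^+ 2.
Proof.
move=> dv dv' hB x h.
have d1 (s : R) : is_derive s 1 (fun s : R => v (x + s *: e) - s * v' x)
    (v' (x + s *: e) - v' x).
  have h1 := is_derive_line (dv (x + s *: e)).
  have h2 : is_derive s 1 (fun s : R => s * v' x : R) (v' x : R).
    apply: is_derive_eq; rewrite /GRing.scale/= mulr0 add0r mulr1.
    by [].
  exact: is_deriveB.
have [c ch] := mvt0 d1 h; rewrite scale0r addr0 mul0r subr0 => e1.
rewrite addrAC e1.
have [c' _] := mvt0 (fun s => is_derive_line (dv' (x + s *: e))) c.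
rewrite scale0r addr0 => ->.
rewrite !normrM -[h ^+ 2]real_normK ?num_real// expr2 mulrA.
by rewrite ler_wpM2r// ler_pM.
Qed.

Lemma partial_taylor u i (B : R) : Smooth u ->
  (forall x, normc (iter_partialC [:: i; i] u x) <= B) ->
  forall x (h : R),
    normc (u (x + h *: delta_mx 0 i) - u x - h%:C%C * iter_partialC [:: i] u x)
    <= 2 * (B * h ^+ 2).
Proof.
move=> su hB x h.
have p1 y := Smooth_has_partial i y su.
have p2 y : has_partial i y (iter_partialC [:: i] u) (iter_partialC [:: i; i] u y).
  have := Smooth_has_partial i y (Smooth_partial i su).
  by rewrite -(iter_partialC_rcons [:: i]).
rewrite (le_trans (normc_le_ReIm _))// mulr_natl mulr2n.
rewrite !(cReD, cImD, cReN, cImN, cReM, cImM)/= !mul0r subr0 addr0.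
apply: lerD.
  apply: (@real_taylor2 (fun x => Re (u x)) (fun x => Re (iter_partialC [:: i] u x))
    (fun x => Re (iter_partialC [:: i; i] u x))) => [y|y|y].
  - exact: (proj1 (p1 y)).
  - exact: (proj1 (p2 y)).
  - exact: le_trans (Re_le_normc _) (hB y).
apply: (@real_taylor2 (fun x => Im (u x)) (fun x => Im (iter_partialC [:: i] u x))
  (fun x => Im (iter_partialC [:: i; i] u x))) => [y|y|y].
- exact: (proj2 (p1 y)).
- exact: (proj2 (p2 y)).
- exact: le_trans (Im_le_normc _) (hB y).
Qed.

(** The integral of a difference quotient vanishes by translation invariance,
and difference quotients converge uniformly to the derivative. *)
Lemma integral_partial U u i : Test U u -> integral_Rn (iter_partialC [:: i] u) = 0.
Proof.
move=> tu; have su := Test_Smooth tu.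
have cu := Test_Cc tu; have cpu := Test_Cc (Test_iter [:: i] tu).
have [B B0 hB] := bounded_unif (Schwartz_bounded (Test_Schwartz tu)) 2.
have [_ [r0 hr0]] := cu; have [_ [r1 hr1]] := cpu.
pose r := Num.max (Num.max r0 r1) 0 + 1.
have rr0 : r0 + 1 <= r by rewrite lerD2r !le_max lexx.
have rr1 : r1 <= r by rewrite (@le_trans _ _ (r1 + 1)) ?lerDl// lerD2r !le_max lexx orbT.
have r_ge0 : 0 <= r by rewrite addr_ge0// le_max lexx orbT.
set z := integral_Rn _.
pose K := 2 * (2 * B * (2 * r) ^+ n).
have K0 : 0 <= K by rewrite !mulr_ge0// ?exprn_ge0// ?mulr_ge0// ltW.
have key (h : R) : 0 < h <= 1 -> normc z <= K * h.
  move=> /andP[h0 h1].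
  pose w t := h%:C%C * iter_partialC [:: i] u t + ((-1) * u (t + h *: delta_mx 0 i) + u t).
  have cs := Cc_shift (h *: delta_mx 0 i) cu.
  have cw2 := Cc_lin (-1) cs cu.
  have wint : integral_Rn w = h%:C%C * z.
    by rewrite /w integral_lin// integral_lin// integral_shift// mulN1r addNr addr0.
  have wB x : normc (w x) <= 2 * (B * h ^+ 2).
    have := @partial_taylor u i B su (fun y => hB [:: i; i] y isT) x h.
    rewrite -normcN; congr (normc _ <= _); rewrite /w; ring.
  have wS x : w x != 0 -> box 0 r x.
    move=> wx; have [ux|/hr0] := eqVneq (u x) 0; last first.
      by apply: box_incl; apply: le_trans rr0; rewrite lerDl.
    have [dx|/hr1] := eqVneq (iter_partialC [:: i] u x) 0; last exact: box_incl.
    have [ux'|/hr0 ux'] := eqVneq (u (x + h *: delta_mx 0 i)) 0.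
      by move: wx; rewrite /w ux dx ux' !mulr0 !addr0 eqxx.
    move=> j; have := ux' j; rewrite !mxE !subr0 => hj.
    apply: le_trans rr0.
    set d := _ && _ in hj.
    have hd : `|h * d%:R| <= 1.
      by rewrite normrM ger0_norm ?(ltW h0)//; case: d {hj}; rewrite ?normr1 ?normr0 ?mulr1 ?mulr0.
    have -> : x 0 j = (x 0 j + h * d%:R) - h * d%:R by ring.
    by rewrite (le_trans (ler_normB _ _))// lerD.
  have := @integral_box_bound w 0 r (2 * (B * h ^+ 2)) r_ge0 _ wB wS.
  rewrite wint normcM normc_real ger0_norm ?(ltW h0)// => /(_ _).
  have h2 : 0 <= 2 * (B * h ^+ 2) by rewrite mulr_ge0// mulr_ge0 ?sqr_ge0// ltW.
  move=> /(_ h2) H; rewrite -(ler_pM2l h0) (le_trans H)//.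
  by rewrite /K le_eqVlt; apply/orP; left; apply/eqP; ring.
apply/eqP; rewrite -normc_eq0 eq_le normc_ge0 andbT.
apply/ler_addgt0Pr => e e0; rewrite add0r.
have K1 : 0 < K + 1 by lra.
pose h := Num.min 1 (e / (K + 1)).
have h0 : 0 < h by rewrite lt_min ltr01 divr_gt0.
have h1 : h <= 1 by rewrite ge_min lexx.
apply: le_trans (key h _) _; first by rewrite h0 h1.
have : h <= e / (K + 1) by rewrite ge_min lexx orbT.
rewrite ler_pdivlMr// => ?; nra.
Qed.

End IntegralRows.

(** * Bump functions *)

Section OneVariable.
Context {R : realType} {n : nat}.
Local Notation V := ('rV[R]_n).
Local Notation C := (R[i]).
Implicit Types (g : R -> C) (i : 'I_n).

Definition derivC g m : R -> C := fun t =>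
  ((fun t => Re (g t))^`(m)%classic t +i* (fun t => Im (g t))^`(m)%classic t)%C.

Lemma derivC0 g : derivC g 0 = g.
Proof. by apply/funext => t; exact: complex_ext. Qed.

Lemma derivC_vanish g (U : set R) : open U -> (forall t, U t -> g t = 0) ->
  forall m t, U t -> derivC g m t = 0.
Proof.
move=> oU g0.
have H (v : R -> R) : (forall t, U t -> v t = 0) -> forall m t, U t -> v^`(m)%classic t = 0.
  move=> v0; elim=> [|m IH] t Ut; first by rewrite derive1n0 v0.
  rewrite derive1nS derive1E.
  have -> : 'D_1 (v^`(m)%classic) t = 'D_1 (fun=> 0 : R) t.
    apply: near_eq_derive; have : nbhs t U by exact: open_nbhs_nbhs.
    by apply: filterS => s Us; rewrite IH.
  by rewrite derive_cst.
move=> m t Ut; apply: complex_ext => /=.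
  by apply: (H (fun t => Re (g t))) => // s /g0 ->.
by apply: (H (fun t => Im (g t))) => // s /g0 ->.
Qed.

Lemma derivC_bounded g m : test_function1 g -> exists B, forall t, normc (derivC g m t) <= B.
Proof.
move=> [dg cg]; set K := closure _ in cg.
have cont (v : R -> R) : (forall m x, derivable (v^`(m)%classic) x 1) -> forall m, continuous (v^`(m)%classic).
  by move=> dv p x; apply/differentiable_continuous/derivable1_diffP.
have bdd (v : R -> R) : continuous v -> exists B, forall t, K t -> `|v t| <= B.
  move=> cv; have [[x0 Kx0]|K0] := pselect (K !=set0).
    have [||c _ hc] := @compact_EVT_max _ R (fun t => `|v t|) K _ cg; first by exists x0.
      apply: continuous_subspaceT => x.
      by apply: (@continuous_comp _ _ _ v Num.norm); [exact: cv|exact: norm_continuous].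
    by exists `|v c| => x Kx; apply: hc; rewrite inE.
  by exists 0 => x Kx; exfalso; apply: K0; exists x.
have [Br hBr] := bdd _ (cont _ (fun m x => proj1 (dg m x)) m).
have [Bi hBi] := bdd _ (cont _ (fun m x => proj2 (dg m x)) m).
exists (Num.max 0 (Br + Bi)) => t; rewrite le_max.
have [Kt|Kt] := pselect (K t).
  apply/orP; right; apply: le_trans (normc_le_ReIm _) _.
  by rewrite lerD//=; [exact: hBr|exact: hBi].
have oK : open (~` K) by exact/closed_openC/closed_closure.
rewrite (derivC_vanish oK)//; first by rewrite normc0 lexx.
by move=> s Ks; apply/eqP; apply: contrapT => /negP gs; apply: Ks; exact: subset_closure.
Qed.

Lemma derivC_has_partial g m i j (c l : R) (x : V) : test_function1 g ->
  has_partial j x (fun t : V => derivC g m (l * (t 0 i - c)))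
    (if j == i then l%:C%C * derivC g m.+1 (l * (x 0 i - c)) else 0).
Proof.
move=> [dg _].
have H (v : R -> R) : (forall y, derivable v y 1) ->
    is_derive x (delta_mx 0 j) (fun t : V => v (l * (t 0 i - c)))
      (if j == i then l * v^`()%classic (l * (x 0 i - c)) else 0).
  move=> dv; case: eqVneq => [->|ji].
    have E : (fun h : R => h^-1 *: (((fun t : V => v (l * (t 0 i - c))) \o shift x) (h *: delta_mx 0 i) - v (l * (x 0 i - c)))) =
        (fun h : R => h^-1 *: (((fun s => v (l * (s + (x 0 i - c)))) \o shift 0) (h *: 1) - v (l * (0 + (x 0 i - c))))).
      apply/funext => h /=; rewrite !mxE !eqxx mulr1 addr0 add0r.
      by congr (_ *: (v _ - _)); rewrite [h *: 1]mulr1; ring.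
    have d1 : is_derive (0 : R) 1 (fun s => v (l * (s + (x 0 i - c)))) (l * v^`()%classic (l * (x 0 i - c))).
      have da : is_derive (0 : R) 1 (fun s : R => l * (s + (x 0 i - c))) l.
        by apply: is_derive_eq; rewrite /GRing.scale/=; ring.
      have db : is_derive (l * (0 + (x 0 i - c))) 1 v (v^`()%classic (l * (x 0 i - c))).
        by rewrite add0r derive1E; apply: derivableP.
      have -> : l * v^`()%classic (l * (x 0 i - c)) = v^`()%classic (l * (x 0 i - c)) * l by rewrite mulrC.
      exact: (@is_derive1_comp R v (fun s : R => l * (s + (x 0 i - c))) 0 _ _ db da).
    case: d1 => hd <-; split; first by rewrite /derivable E.
    by rewrite /derive E.
  have E : (fun h : R => h^-1 *: (((fun t : V => v (l * (t 0 i - c))) \o shift x) (h *: delta_mx 0 j) - v (l * (x 0 i - c)))) =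
        (fun h : R => h^-1 *: (((fun t : V => v (l * (x 0 i - c))) \o shift x) (h *: delta_mx 0 j) - v (l * (x 0 i - c)))).
      apply/funext => h /=; rewrite !mxE eqxx [i == j]eq_sym (negbTE ji) mulr0 add0r.
      by [].
  case: (@is_derive_cst R V R (v (l * (x 0 i - c))) x (delta_mx 0 j)) => hd hv; split.
    by move: hd; rewrite /derivable E.
  by rewrite -[RHS]hv /derive E.
split.
  have := H _ (fun y => proj1 (dg m y)); case: eqVneq => // _.
  by rewrite cReM /= mul0r subr0.
have := H _ (fun y => proj2 (dg m y)); case: eqVneq => // _.
by rewrite cImM /= mul0r addr0.
Qed.

(** The derivatives of the pullback are multiples of the pullbacks of the
derivatives of [g], which are bounded because their support is compact. *)
Lemma pullback_bounded g i (c l : R) : test_function1 g ->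
  Bounded_derivatives (fun t : V => g (l * (t 0 i - c))).
Proof.
move=> tg.
pose P (u : V -> C) := exists k m, u = fun t => k * derivC g m (l * (t 0 i - c)).
have Pp u : P u -> forall j, exists2 u', P u' & forall x, has_partial j x u (u' x).
  move=> [k [m ->]] j.
  exists (fun x => (if j == i then k * l%:C%C else 0) * derivC g m.+1 (l * (x 0 i - c))).
    by exists (if j == i then k * l%:C%C else 0), m.+1.
  move=> x; have := has_partialM (has_partial_cst j x k) (derivC_has_partial m i j c l x tg).
  by rewrite mul0r add0r; case: eqVneq => _; rewrite ?mulr0 ?mul0r// mulrA.
have [||//|su hu] := @smooth_class _ _ setT P (@openT V) _ _ (fun t : V => g (l * (t 0 i - c))).
- move=> u [k [m ->]] x _; apply: cont_atM; first exact: cont_at_cst.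
  have hv (v : R -> R) : (forall y, derivable v y 1) ->
      {for x, continuous (fun t : V => v (l * (t 0 i - c)))}.
    move=> dv; apply: (@continuous_comp _ _ _ (fun t : V => l * (t 0 i - c)) v).
      apply: continuousM; first exact: cst_continuous.
      apply: continuousB; last exact: cst_continuous.
      exact: coord_continuous.
    exact/differentiable_continuous/derivable1_diffP.
  case: tg => dg _; split; first exact: hv (fun y => proj1 (dg m y)).
  exact: hv (fun y => proj2 (dg m y)).
- by move=> u Pu j; have [u' Pu' h] := Pp u Pu j; exists u' => // x _; exact: h.
- by exists 1, 0%N; apply/funext => t; rewrite derivC0 mul1r.
split=> // a; have [u' [k [m ->]] hu'] := hu a.
have [B hB] := derivC_bounded m tg.
exists (normc k * B) => x; rewrite hu'// normcM ler_wpM2l ?normc_ge0//.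
Qed.

(** Products of dilated copies of one compactly supported function of one
variable give bump functions at every point and every scale; taking [|g|^2]
makes them non-negative. *)
Lemma bump_exists g (c : V) (r : R) : test_function1 g -> g 0 != 0 -> 0 < r ->
  exists2 b : V -> C, Test (box c r) b &
    b c != 0 /\ forall x, exists2 y : R, 0 <= y & b x = y%:C%C.
Proof.
move=> tg g0 r0.
have [M M0 hM] : exists2 M : R, 0 < M & forall t, g t != 0 -> `|t| <= M.
  have [_ cg] := tg; have [M [_ hM]] := compact_bounded cg.
  exists (`|M| + 1) => [|t gt]; first by rewrite ltr_wpDl.
  by apply: hM; [rewrite (le_lt_trans (ler_norm _))// ltrDl|exact: subset_closure].
pose l := M / r.
have l0 : 0 < l by rewrite divr_gt0.
pose G i (t : V) := g (l * (t 0 i - c 0 i)).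
have sG i : Smooth (G i) by case: (@pullback_bounded g i (c 0 i) l tg).
pose b (t : V) := \prod_i (G i t * (G i t)^*%C).
have bE t : b t = (\prod_i (normc (G i t) ^+ 2))%:C%C.
  rewrite /b (big_morph (fun x : R => x%:C%C) realcM (erefl _)).
  apply: eq_bigr => i _; apply: complex_ext; rewrite /= ?cReM ?cImM cReJ cImJ.
    by rewrite sqr_normcE mulrN opprK !expr2.
  by rewrite mulrN mulrC addNr.
have bS x : b x != 0 -> box c r x.
  move=> bx i; have : G i x != 0.
    apply: contraNneq bx => gi; rewrite /b (bigD1 i)//= gi mul0r mul0r //.
  move=> /hM; rewrite normrM gtr0_norm// /l => h.
  by rewrite -(ler_pM2l l0) (le_trans h)// /l divfK// gt_eqF.
have sb : Smooth b.
  by apply: Smooth_prod => i; apply: SmoothM => //; exact: SmoothJ.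
have cS : support_set b `<=` box c r.
  by apply: support_set_sub => //; apply: compact_closed (@compact_box _ _ c r).
exists b.
  split => //; apply: subclosed_compact (@compact_box _ _ c r) cS.
  exact: closed_closure.
split.
  rewrite /b; apply/prodf_neq0 => i _; rewrite /G subrr mulr0 mulf_neq0//.
  by rewrite conjc_eq0.
move=> x; exists (\prod_i (normc (G i x) ^+ 2)); last exact: bE.
by apply: prodr_ge0 => i _; rewrite exprn_ge0// normc_ge0.
Qed.

End OneVariable.

(** * The Fourier transform of test functions *)

Section Fourier.
Context {R : realType} {n : nat}.
Local Notation V := ('rV[R]_n).
Local Notation C := (R[i]).
Implicit Types (u v w : V -> C) (x c xi eta t : V) (i : 'I_n) (r : R).

Lemma fourierE u xi : fourier u xi = integral_Rn (fun t => wave (- xi) t * u t).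
Proof.
rewrite /fourier; congr integral_Rn; apply/funext => t.
by rewrite /wave dotpNr mulrN expiN.
Qed.

Lemma cont_wave xi x : cont_at x (wave xi).
Proof. by apply: Smooth_cont; case: (wave_partials xi). Qed.

Lemma Cc_wave xi u : Cc u -> Cc (fun t => wave xi t * u t).
Proof. by apply: Cc_mul => x; exact: cont_wave. Qed.

Lemma fourier_lin (k : C) u v xi : Cc u -> Cc v ->
  fourier (fun t => k * u t + v t) xi = k * fourier u xi + fourier v xi.
Proof.
move=> cu cv; rewrite !fourierE -integral_lin; [|exact: Cc_wave|exact: Cc_wave].
by congr integral_Rn; apply/funext => t; ring.
Qed.

Lemma fourier_shift u eta : Cc u ->
  fourier (fun t => u (t - eta)) = fun t => wave (- eta) t * fourier u t.
Proof.
move=> cu; apply/funext => t; rewrite !fourierE.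
have cw : Cc (fun s => wave (- t) s * u (s - eta)) by apply/Cc_wave/Cc_shift.
rewrite -(integral_shift eta cw) -integralZ; last exact: Cc_wave.
congr integral_Rn; apply/funext => s; rewrite addrK waveDx.
have -> : wave (- t) eta = wave (- eta) t by rewrite waveC waveNx.
by ring.
Qed.

Lemma fourier_partial U u i xi : Test U u ->
  fourier (iter_partialC [:: i] u) xi = 'i%C * (2 * pi * xi 0 i)%:C%C * fourier u xi.
Proof.
move=> tu; have su := Test_Smooth tu; have [sw hw] := wave_partials (- xi).
have tuw : Test U (fun t => wave (- xi) t * u t).
  rewrite (_ : (fun t => _) = fun t => u t * wave (- xi) t); first exact: Test_mulr.
  by apply/funext => t; rewrite mulrC.
have := integral_partial i tuw; rewrite partialM// hw.
rewrite !fourierE; set I1 := integral_Rn (fun t => wave (- xi) t * u t).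
set I2 := integral_Rn (fun t => wave (- xi) t * iter_partialC [:: i] u t).
have -> : (fun t => wave_coef (- xi) [:: i] * wave (- xi) t * u t +
      wave (- xi) t * iter_partialC [:: i] u t) =
    (fun t => wave_coef (- xi) [:: i] * (wave (- xi) t * u t) +
      wave (- xi) t * iter_partialC [:: i] u t).
  by apply/funext => t; rewrite mulrA.
rewrite integral_lin; last 2 first.
- exact: Test_Cc tuw.
- by apply/Cc_wave/Test_Cc/(Test_iter [:: i] tu).
rewrite -/I1 -/I2 => /eqP; rewrite addrC addr_eq0 => /eqP ->.
rewrite /wave_coef big_seq1 !mxE mulrN.
have -> : (- (2 * pi * xi 0 i))%:C%C = - (2 * pi * xi 0 i)%:C%C :> C.
  by apply: complex_ext; rewrite /= ?oppr0.
by rewrite mulrN mulNr opprK.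
Qed.

Lemma smooth_coord i : Smooth (fun t : V => (t 0 i)%:C%C).
Proof.
pose P (u : V -> C) := (u = fun t => (t 0 i)%:C%C) \/ exists c : C, u = fun=> c.
have [||//|su _] := @smooth_class _ _ setT P (@openT V) _ _ (fun t : V => (t 0 i)%:C%C).
- move=> u [->|[c ->]] x _; last exact: cont_at_cst.
  by split => /=; [exact: coord_continuous|exact: cst_continuous].
- move=> u [->|[c ->]] j; last first.
    by exists (fun=> 0); [right; exists 0|move=> x _; exact: has_partial_cst].
  exists (fun=> ((j == i)%:R : R)%:C%C); first by right; exists (((j == i)%:R : R)%:C%C).
  move=> x _; split => /=; last exact: is_derive_cst.
  apply: (@is_derive_quadratic _ _ _ _ _ _ 0) => h.
  rewrite !mxE eqxx [i == j]eq_sym /= (_ : _ - _ = 0); last by ring.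
  by rewrite normr0 mul0r.
- by left.
by split.
Qed.

Lemma smooth_wave_coef a : Smooth (fun t : V => wave_coef (- t) a).
Proof.
rewrite /wave_coef; elim: a => [|i a IH].
  rewrite (_ : (fun t => _) = fun=> 1); first exact: Smooth_cst.
  by apply/funext => t; rewrite big_nil.
rewrite (_ : (fun t => _) = fun t : V =>
   ('i%C * (- (2 * pi))%:C%C) * (t 0 i)%:C%C * \prod_(i0 <- a) ('i%C * (2 * pi * (- t) 0 i0)%:C%C)).
  apply: SmoothM => //; apply: SmoothM; [exact: Smooth_cst|exact: smooth_coord].
apply/funext => t; rewrite big_cons mxE; congr (_ * _).
by rewrite -[RHS]mulrA -realcM; congr ('i%C * _%:C%C); ring.
Qed.

Lemma Test_wave_coef U u a : Test U u -> Test U (fun t => u t * wave_coef (- t) a).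
Proof. by move=> tu; apply: Test_mulr => //; exact: smooth_wave_coef. Qed.

(** Differentiation under the integral sign: the Taylor estimate for the waves is
uniform on the support of [u], and [smooth_family] concludes. *)
Lemma fourier_smooth U u : Test U u -> Smooth (fourier u) /\
  forall a, iter_partialC a (fourier u) = fourier (fun t => u t * wave_coef (- t) a).
Proof.
move=> tu.
have F0 : fourier (fun t => u t * wave_coef (- t) [::]) = fourier u.
  by congr fourier; apply/funext => t; rewrite /wave_coef big_nil mulr1.
have flip xi t : wave (- xi) t = wave (- t) xi by rewrite waveC waveNx.
have [_ [r0 hr0]] := Test_Cc tu.
pose r := Num.max 0 r0.
have r_ge0 : 0 <= r by rewrite le_max lexx.
have hr x : u x != 0 -> `|x| <= r.
  move=> /hr0 h; rewrite -[x]subr0; apply/box_norm => //.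
  by apply: box_incl h; rewrite le_max lexx orbT.
have pi0 := @pi_ge0 R.
have n0 : 0 <= n%:R :> R by exact: ler0n.
have [||sF hF] := @smooth_family R n (fun a => fourier (fun t => u t * wave_coef (- t) a)).
- move=> a; have ta := Test_wave_coef a tu.
  have [B B0 hB] := bounded_unif (Schwartz_bounded (Test_Schwartz ta)) 0.
  have {}hB t : normc (u t * wave_coef (- t) a) <= B.
    by have := hB [::] t isT; rewrite iter_partialC_nil.
  exists (2 * (4 * pi * n%:R * r * B * (2 * r) ^+ n)) => x y; rewrite !fourierE.
  have -> : integral_Rn (fun t => wave (- x) t * (u t * wave_coef (- t) a)) -
      integral_Rn (fun t => wave (- y) t * (u t * wave_coef (- t) a)) =
     integral_Rn (fun t => (-1) * (wave (- y) t * (u t * wave_coef (- t) a)) + wave (- x) t * (u t * wave_coef (- t) a)).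
    rewrite integral_lin; [|exact/Cc_wave/Test_Cc/ta|exact/Cc_wave/Test_Cc/ta].
    by rewrite mulN1r addrC.
  have xy0 := normr_ge0 (x - y).
  rewrite [leRHS](_ : _ = 2 * (4 * pi * n%:R * r * `|x - y| * B * (2 * r) ^+ n)); last by ring.
  apply: (@integral_box_bound R n _ 0 r _ r_ge0).
  + by rewrite !mulr_ge0// ltW.
  + move=> t; rewrite mulN1r addrC -mulrBl normcM (flip x t) (flip y t).
    have [ut|/hr ut] := eqVneq (u t) 0.
      by rewrite ut mul0r normc0 mulr0 !mulr_ge0// ltW.
    apply: ler_pM; rewrite ?normc_ge0//.
    apply: le_trans (wave_lip _ _ _) _; rewrite normrN ler_wpM2r// ler_wpM2l// !mulr_ge0//.
  + move=> t h; apply/box_norm => //; rewrite subr0; apply: hr.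
    by apply: contraNneq h => ->; rewrite !(mul0r, mulr0, addr0).
- move=> a i; have ta := Test_wave_coef a tu.
  have [B B0 hB] := bounded_unif (Schwartz_bounded (Test_Schwartz ta)) 0.
  have {}hB t : normc (u t * wave_coef (- t) a) <= B.
    by have := hB [::] t isT; rewrite iter_partialC_nil.
  exists (2 * (2 * (2 * pi * r) ^+ 2 * B * (2 * r) ^+ n)) => x h; rewrite !fourierE.
  set y := x + _.
  pose W t := (- h%:C%C) * (wave (- x) t * (u t * wave_coef (- t) (i :: a))) +
     ((-1) * (wave (- x) t * (u t * wave_coef (- t) a)) + wave (- y) t * (u t * wave_coef (- t) a)).
  have WE t : W t = (wave (- t) y - wave (- t) x - h%:C%C * ('i%C * (2 * pi * (- t) 0 i)%:C%C * wave (- t) x)) * (u t * wave_coef (- t) a).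
    by rewrite /W /wave_coef big_cons (flip x t) (flip y t); ring.
  have c1 b z : Cc (fun t => wave z t * (u t * wave_coef (- t) b)).
    exact/Cc_wave/Test_Cc/(Test_wave_coef b tu).
  have -> : integral_Rn (fun t => wave (- y) t * (u t * wave_coef (- t) a)) -
      integral_Rn (fun t => wave (- x) t * (u t * wave_coef (- t) a)) -
      h%:C%C * integral_Rn (fun t => wave (- x) t * (u t * wave_coef (- t) (i :: a))) = integral_Rn W.
    rewrite /W integral_lin; [|exact: c1|by apply: Cc_lin; exact: c1].
    by rewrite integral_lin; [ring|exact: c1|exact: c1].
  have K0 : 0 <= 2 * (2 * pi * r) ^+ 2 * h ^+ 2 * B.
    have h1 := sqr_ge0 h; have h2 := sqr_ge0 (2 * pi * r).
    by apply: mulr_ge0; [apply: mulr_ge0 => //; exact: mulr_ge0|exact: ltW].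
  rewrite [leRHS](_ : _ = 2 * (2 * (2 * pi * r) ^+ 2 * h ^+ 2 * B * (2 * r) ^+ n)); last by ring.
  apply: (@integral_box_bound R n _ 0 r _ r_ge0).
  + exact: K0.
  + move=> t; rewrite WE normcM.
    have [ut|/hr ut] := eqVneq (u t) 0.
      by rewrite ut mul0r normc0 mulr0 K0.
    apply: ler_pM; rewrite ?normc_ge0//.
    apply: le_trans (wave_taylor _ _ _ _) _; rewrite ler_wpM2r ?sqr_ge0// ler_wpM2l//.
    rewrite -[leLHS]real_normK ?num_real// ler_pXn2r ?nnegrE ?mulr_ge0//.
    rewrite normrM ger0_norm ?mulr_ge0// ler_wpM2l ?mulr_ge0//.
    by rewrite mxE normrN (le_trans (coord_le_norm _ _)).
  + move=> t; rewrite WE => wt; apply/box_norm => //; rewrite subr0; apply: hr.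
    by apply: contraNneq wt => ->; rewrite !(mul0r, mulr0, addr0).
by rewrite -F0.
Qed.

Lemma fourier_bounded U u : Test U u -> exists B, forall xi, normc (fourier u xi) <= B.
Proof.
move=> tu; have [cu [r0 hr0]] := Test_Cc tu.
have [B B0 hB] := bounded_unif (Schwartz_bounded (Test_Schwartz tu)) 0.
pose r := Num.max 0 r0.
have r_ge0 : 0 <= r by rewrite le_max lexx.
exists (2 * (B * (2 * r) ^+ n)) => xi; rewrite fourierE.
apply: (@integral_box_bound _ _ _ 0) => //; first exact: ltW.
  move=> t; rewrite normcM normc_wave mul1r.
  by have := hB [::] t isT; rewrite iter_partialC_nil.
move=> t h; have : u t != 0 by apply: contraNneq h => ->; rewrite mulr0.
by move/hr0; apply: box_incl; rewrite le_max lexx orbT.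
Qed.

Lemma Test_sum U (I : finType) (F : I -> V -> C) : (forall j, Test U (F j)) ->
  Test U (fun t => \sum_j F j t).
Proof.
move=> tF; elim: (index_enum I) => [|j s IH].
  rewrite (_ : (fun t => _) = fun=> 0); first exact: Test0.
  by apply/funext => t; rewrite big_nil.
rewrite (_ : (fun t => _) = fun t => 1 * F j t + \sum_(j <- s) F j t).
  exact: Test_lin.
by apply/funext => t; rewrite big_cons mul1r.
Qed.

(** Multiplication by [bracket2] on the Fourier side is [1 - Laplacian/4pi^2]. *)
Lemma fourier_bracket2 U u : Test U u -> exists2 v, Test U v &
  forall xi, fourier v xi = (bracket2 xi)%:C%C * fourier u xi.
Proof.
move=> tu; pose k : C := (- ((2 * pi) ^+ 2)^-1)%:C%C.
pose D i := iter_partialC [:: i] (iter_partialC [:: i] u).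
have tD i : Test U (D i) by exact/Test_iter/Test_iter.
have ts : Test U (fun t => \sum_i D i t) by exact: Test_sum.
exists (fun t => k * (\sum_i D i t) + u t); first exact: Test_lin.
move=> xi; rewrite fourier_lin; [|exact: Test_Cc ts|exact: Test_Cc tu].
have -> : fourier (fun t => \sum_i D i t) xi = \sum_i fourier (D i) xi.
  rewrite fourierE; have [_ E] := @integral_sum _ n 'I_n (fun=> 1) (fun i t => wave (- xi) t * D i t) (fun i => Cc_wave (- xi) (Test_Cc (tD i))).
  transitivity (\sum_i 1 * integral_Rn (fun t => wave (- xi) t * D i t)).
    rewrite -E; congr integral_Rn; apply/funext => t; rewrite mulr_sumr.
    by apply: eq_bigr => i _; rewrite mul1r.
  by apply: eq_bigr => i _; rewrite mul1r -fourierE.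
have DE i : fourier (D i) xi = (- (2 * pi) ^+ 2 * (xi 0 i * xi 0 i))%:C%C * fourier u xi.
  rewrite /D (fourier_partial i xi (Test_iter [:: i] tu)) (fourier_partial i xi tu) mulrA.
  congr (_ * _); apply: complex_ext; rewrite /= ?cReM ?cImM /= !(mul0r, mulr0, mul1r, subr0, add0r, addr0) ?cReM ?cImM /=; ring.
rewrite (eq_bigr _ (fun i _ => DE i)) -mulr_suml mulrA -[X in _ + X]mul1r -mulrDl; congr (_ * _).
have -> : \sum_i (- (2 * pi) ^+ 2 * (xi 0 i * xi 0 i))%:C%C = (- (2 * pi) ^+ 2 * dotp xi xi)%:C%C :> C.
  apply: complex_ext; first by rewrite Re_sum /= /dotp mulr_sumr.
  by rewrite Im_sum /= big1.
have p2 : (2 * pi : R) != 0 by rewrite mulf_neq0// gt_eqF// pi_gt0.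
rewrite /k -realcM; apply: complex_ext; rewrite ?cReD ?cImD /= ?addr0// /bracket2 addrC.
have E (A d : R) : A != 0 -> - A^-1 * (- A * d) = d by move=> A0; field.
by rewrite E// expf_neq0.
Qed.

(** Derivatives and, by [fourier_bracket2], multiplication by [bracket2] amount to
changing the test function. *)
Lemma fourier_Schwartz U u : Test U u -> Schwartz (fourier u).
Proof.
move=> tu; have [sF hF] := fourier_smooth tu; split => // N a; rewrite hF.
move: (Test_wave_coef a tu); move: (fun t => u t * wave_coef (- t) a) => {tu hF sF}u tu.
elim: N u tu => [|N IH] u tu.
  have [B hB] := fourier_bounded tu; exists B => x; by rewrite expr0 mul1r.
have [v tv hv] := fourier_bracket2 tu; have [B hB] := IH v tv.
exists B => x; have := hB x; rewrite hv normcM normc_real ger0_norm; last exact/ltW/bracket2_gt0.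
by rewrite exprSr mulrA.
Qed.

End Fourier.

(** * Fejer summation in several variables *)

Section FejerKernel.
Context {R : realType}.
Local Notation C := (R[i]).
Local Notation RR := (measurableTypeR R).
Implicit Types (s x y : R) (N : nat).

(** Doubling the angle extends the range up to [2 > pi / 2], so that
[sin (pi * s)] is controlled for [s] in half a period. *)
Lemma sin2_ge2 x : `|x| <= 2 -> x ^+ 2 / 36 <= sin x ^+ 2.
Proof.
move=> x2; have h1 : `|x / 2| <= 1 by rewrite normrM [ `|2^-1|]ger0_norm ?invr_ge0//; lra.
have s1 := sin2_ge h1.
have xE : x = (x / 2) *+ 2 by rewrite mulr2n; lra.
have cosx2 : 1 / 4 <= cos (x / 2) ^+ 2.
  have s2 := sin_le (x / 4).
  have : cos (x / 2) = 1 - 2 * sin (x / 4) ^+ 2.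
    rewrite (_ : x / 2 = (x / 4) *+ 2); last by rewrite mulr2n; field.
    rewrite cos_mulr2n cos2sin2 mulr2n; ring.
  have h4 : `|x / 4| <= 1 / 2 by rewrite normrM [ `|4^-1|]ger0_norm ?invr_ge0//; lra.
  have : sin (x / 4) ^+ 2 <= 1 / 4.
    rewrite -[leLHS]real_normK ?num_real//; have := normr_ge0 (sin (x / 4)); nra.
  have := sqr_ge0 (sin (x / 4)); nra.
rewrite {2}xE sin_mulr2n mulr2n.
have -> : (cos (x / 2) * sin (x / 2) + cos (x / 2) * sin (x / 2)) ^+ 2 =
  4 * (cos (x / 2) ^+ 2 * sin (x / 2) ^+ 2) by ring.
have := sqr_ge0 (sin (x / 2)); have := sqr_ge0 x.
have : (x / 2) ^+ 2 = x ^+ 2 / 4 by field.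
nra.
Qed.

(** Written as a square, the Fejer kernel is visibly non-negative;
[fejer_double_sum] gives its Fourier coefficients. *)
Definition fejer N s : R :=
  N%:R^-1 * normc (\sum_(j < N) expi (2 * pi * (j%:R * s))) ^+ 2.

Lemma fejer_ge0 N s : 0 <= fejer N s.
Proof. by rewrite mulr_ge0 ?invr_ge0// exprn_ge0// normc_ge0. Qed.

Lemma expiJ x : ((expi x)^*)%C = expi (- x) :> C.
Proof. by rewrite expiN. Qed.

Lemma fejer_double_sum N s : (fejer N s)%:C%C =
  (N%:R^-1)%:C%C * \sum_(q : 'I_N * 'I_N) expi (2 * pi * ((q.1%:R - q.2%:R) * s)) :> C.
Proof.
rewrite realcM; congr (_ * _).
set D := \sum_(j < N) _.
have -> : (normc D ^+ 2)%:C%C = D * (D^*)%C.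
  apply: complex_ext; rewrite ?cReM ?cImM cReJ cImJ /= ?sqr_normcE; first by ring.
  by ring.
rewrite /D rmorph_sum /= big_distrlr/= pair_bigA/=; apply: eq_bigr => q _.
by rewrite -expiN -expiD; congr expi; ring.
Qed.

Lemma expi_nat (j : nat) : expi (2 * pi * j%:R) = 1 :> C.
Proof.
elim: j => [|j IH]; first by rewrite mulr0 expi0.
rewrite -(natr1 j) mulrDr mulr1 expiD IH mul1r /expi.
by rewrite (_ : 2 * pi = pi *+ 2) ?cos2pi ?sin2pi// mulr_natl.
Qed.

(** Multiplication by [sin^2] clears the denominator of the geometric sum. This
replaces the usual estimate of the mass of the kernel away from the origin. *)
Lemma fejer_sin2 N s : (0 < N)%N -> fejer N s * sin (pi * s) ^+ 2 <= N%:R^-1.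
Proof.
move=> N0; rewrite /fejer -mulrA ler_piMr ?invr_ge0//.
pose z := expi (2 * pi * s) : C.
have -> : \sum_(j < N) expi (2 * pi * (j%:R * s)) = \sum_(j < N) z ^+ j :> C.
  apply: eq_bigr => j _; elim: (nat_of_ord j) => [|m IH].
    by rewrite expr0 mul0r mulr0 expi0.
  by rewrite exprS -IH -expiD -natr1; congr expi; ring.
have g := subrX1 z N.
have zN : normc (z ^+ N - 1) <= 2.
  apply: le_trans (le_normcD _ _) _; rewrite normcN normc1.
  suff -> : normc (z ^+ N) = 1 by lra.
  elim: N {N0 g} => [|m IH]; first by rewrite expr0 normc1.
  by rewrite exprS normcM normc_expi mul1r.
have z1 : normc (z - 1) ^+ 2 = 4 * sin (pi * s) ^+ 2.
  rewrite sqr_normcE /z /expi /= subr0.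
  have -> : 2 * pi * s = (pi * s) *+ 2 by rewrite mulr2n; ring.
  rewrite cos_mulr2n sin_mulr2n cos2sin2 !mulr2n.
  have := cos2Dsin2 (pi * s); set a := cos _; set b := sin _ => h.
  have : a ^+ 2 = 1 - b ^+ 2 by lra.
  have -> : (1 - b ^+ 2 + (1 - b ^+ 2) - 1 - 1) ^+ 2 = 4 * (b ^+ 2 * b ^+ 2) by ring.
  have -> : (a * b + a * b) ^+ 2 = 4 * (a ^+ 2 * b ^+ 2) by ring.
  by move=> ->; ring.
have : normc (z - 1) ^+ 2 * normc (\sum_(j < N) z ^+ j) ^+ 2 <= 4.
  rewrite -exprMn -normcM -g.
  have := normc_ge0 (z ^+ N - 1); nra.
rewrite z1; lra.
Qed.

Lemma continuous_fejer N (x l : R) : continuous (fun y : R => fejer N (l * (x - y))).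
Proof.
suff: forall y : R, {for y, continuous (fun y : R => fejer N (l * (x - y)))} by [].
move=> y; rewrite /fejer; apply: continuousM; first exact: cst_continuous.
rewrite (_ : (fun y => _) = fun y =>
   (\sum_(j < N) cos (2 * pi * (j%:R * (l * (x - y))))) ^+ 2 +
   (\sum_(j < N) sin (2 * pi * (j%:R * (l * (x - y))))) ^+ 2); last first.
  by apply/funext => z; rewrite sqr_normcE Re_sum Im_sum.
have lin j z : {for z, continuous (fun y : R => 2 * pi * (j%:R * (l * (x - y))))}.
  do 3 (apply: continuousM; first exact: cst_continuous).
  by apply: continuousB; [exact: cst_continuous|exact: cvg_id].
have sum (F : R -> R) : continuous F -> {for y, continuous (fun y => (\sum_(j < N) F (2 * pi * (j%:R * (l * (x - y))))) ^+ 2)}.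
  move=> cF; rewrite (_ : (fun y => _) = (@GRing.exp R ^~ 2%N) \o (fun y => \sum_(j < N) F (2 * pi * (j%:R * (l * (x - y))))))//.
  apply: continuous_comp; last exact: exprn_continuous.
  elim: (index_enum _) => [|j js IH].
    rewrite (_ : (fun y => _) = fun=> 0); first exact: cst_continuous.
    by apply/funext => t; rewrite big_nil.
  rewrite (_ : (fun y => _) = (fun y => F (2 * pi * (j%:R * (l * (x - y)))) +
      \sum_(i <- js) F (2 * pi * (i%:R * (l * (x - y)))))).
    apply: continuousD => //.
    apply: (@continuous_comp _ _ _ (fun y : R => 2 * pi * (j%:R * (l * (x - y)))) F) => //; exact: cF.
  by apply/funext => t; rewrite big_cons.
by apply: continuousD; apply: sum; [exact: continuous_cos|exact: continuous_sin].
Qed.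

Lemma FTC2 (f F : R -> R) (a b : R) : a < b -> continuous f ->
  (forall y, is_derive y 1 F (f y)) ->
  (\int[lebesgue_measure]_(y in `[a, b]) (f y)%:E = (F b - F a)%:E)%E.
Proof.
move=> ab cf dF.
have cF : continuous F.
  by move=> y; apply/differentiable_continuous/derivable1_diffP; case: (dF y).
rewrite (@continuous_FTC2 _ f F)//.
- exact: continuous_subspaceT.
- split=> [y _||]; first by case: (dF y).
  + exact: cvg_at_right_filter (cF a).
  + exact: cvg_at_left_filter (cF b).
- by move=> y _; rewrite derive1E; case: (dF y).
Qed.

(** The terms of the double sum with two different indices integrate to zero over
a period; the [N] diagonal ones give the mass. *)
Lemma integral_fejer N (x a L : R) : (0 < N)%N -> 0 < L ->
  (\int[lebesgue_measure]_(y in `[a, (a + L)%R]) (fejer N (L^-1 * (x - y)))%:E = L%:E)%E.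
Proof.
move=> N0 L0.
pose k (q : 'I_N * 'I_N) : R := 2 * pi * ((q.1%:R - q.2%:R) * L^-1).
pose G q (y : R) : R := if q.1 == q.2 then y else - (k q)^-1 * sin (k q * (x - y)).
have pi0 := @pi_gt0 R.
have k0 q : q.1 != q.2 -> k q != 0.
  move=> q12; apply: mulf_neq0; first by rewrite mulf_neq0// gt_eqF.
  apply: mulf_neq0; last by rewrite invr_eq0 gt_eqF.
  by rewrite subr_eq0 eqr_nat.
have fE y : fejer N (L^-1 * (x - y)) = N%:R^-1 * \sum_q cos (k q * (x - y)).
  have := congr1 (@Re R) (fejer_double_sum N (L^-1 * (x - y))).
  rewrite cReM /= mul0r subr0 Re_sum => ->; congr (_ * _).
  by apply: eq_bigr => q _; rewrite /= /k; congr cos; ring.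
have dG q y : is_derive y 1 (G q) (cos (k q * (x - y))).
  rewrite /G; have [e|/k0 kq] := eqVneq q.1 q.2.
    rewrite /k e subrr mul0r mulr0 mul0r cos0; exact: is_derive_id.
  have d1 : is_derive y 1 (fun y : R => k q * (x - y)) (- k q).
    by apply: is_derive_eq; rewrite /GRing.scale/=; ring.
  have d2 := @is_derive1_comp R sin (fun y : R => k q * (x - y)) y _ _ (is_derive_sin _) d1.
  have d3 := @is_deriveM R R^o (fun=> - (k q)^-1) _ y 1 _ _ (is_derive_cst _ _ _) d2.
  apply: is_derive_eq d3 _; rewrite /GRing.scale/=; field; exact: kq.
pose F y := N%:R^-1 * \sum_q G q y.
have dF y : is_derive y 1 F (fejer N (L^-1 * (x - y))).
  rewrite fE.
  have dS : is_derive y 1 (fun y => \sum_q G q y) (\sum_q cos (k q * (x - y))).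
    elim: (index_enum _) => [|q qs IH].
      rewrite big_nil (_ : (fun y => _) = fun=> 0); first exact: is_derive_cst.
      by apply/funext => t; rewrite big_nil.
    rewrite big_cons (_ : (fun y => _) = G q + (fun y => \sum_(q <- qs) G q y)).
      exact: is_deriveD.
    by apply/funext => t; rewrite big_cons.
  have := @is_deriveM R R^o (fun=> N%:R^-1) _ y 1 _ _ (is_derive_cst _ _ _) dS.
  by move/is_derive_eq; apply; rewrite /GRing.scale/= mulr0 addr0.
rewrite (@FTC2 _ F)//; last 2 first.
- by rewrite ltrDl.
- exact: continuous_fejer.
congr EFin; rewrite /F -mulrBr -sumrB.
have -> : \sum_q (G q (a + L) - G q a) = \sum_(q : 'I_N * 'I_N) (if q.1 == q.2 then L else 0).
  apply: eq_bigr => q _; rewrite /G; case: eqVneq => [_|/k0 kq].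
    by rewrite addrAC subrr add0r.
  rewrite -mulrBr; apply/eqP; rewrite mulf_eq0; apply/orP; right; rewrite subr_eq0.
  have E (j : nat) y : expi (2 * pi * (j%:R * L^-1) * (y - L)) = expi (2 * pi * (j%:R * L^-1) * y) :> C.
    have -> : 2 * pi * (j%:R * L^-1) * (y - L) = 2 * pi * (j%:R * L^-1) * y - 2 * pi * j%:R.
      by field; rewrite gt_eqF.
    rewrite expiD -[RHS]mulr1; congr (_ * _).
    by have := expiK (2 * pi * j%:R : R); rewrite expi_nat mulr1.
  have E2 y : expi (k q * y) = expi (2 * pi * (q.1%:R * L^-1) * y) * (expi (2 * pi * (q.2%:R * L^-1) * y))^*%C :> C.
    by rewrite expiJ -expiD; congr expi; rewrite /k; ring.
  have := congr1 (@Im R) (E2 (x - a - L)); rewrite !E -E2 /= => h.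
  by apply/eqP; rewrite -h; congr sin; ring.
rewrite -(pair_bigA _ (fun i j : 'I_N => if i == j then L else 0))/=.
rewrite (eq_bigr (fun=> L)) => [|i _]; last first.
  by rewrite -big_mkcond/= (big_pred1 i)// => j; rewrite eq_sym.
by rewrite sumr_const card_ord -[L *+ N]mulr_natl mulKf// pnatr_eq0 -lt0n.
Qed.

Lemma measurable_fejer N (x L : R) :
  measurable_fun setT (fun y : RR => fejer N (L^-1 * (x - y))).
Proof. by apply: continuous_measurable_fun; exact: continuous_fejer. Qed.

End FejerKernel.

Section FejerSums.
Context {R : realType} {n : nat}.
Local Notation V := ('rV[R]_n).
Local Notation C := (R[i]).
Local Notation RR := (measurableTypeR R).
Local Notation mu := (lebesgue_tuple n).
Implicit Types (u v theta : V -> C) (x c t : V) (i : 'I_n) (L : R) (N : nat).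

Definition freq L N (p : {ffun 'I_n -> 'I_N * 'I_N}) : V :=
  \row_i (((p i).1%:R - (p i).2%:R) * L^-1).

(** The Fejer mean of the [L]-periodization of [theta]. With the frequencies
indexed by pairs, the triangular weights [1 - |m| / N] appear as multiplicities. *)
Definition fejer_sum L N theta : V -> C := fun x =>
  ((N%:R * L) ^- n)%:C%C *
  \sum_(p : {ffun 'I_n -> 'I_N * 'I_N}) fourier theta (freq L p) * wave (freq L p) x.

Definition kernel L N x t : R := L ^- n * \prod_i fejer N (L^-1 * (x 0 i - t 0 i)).

Lemma sum_wave_freq L N x t : (0 < N)%N ->
  \sum_(p : {ffun 'I_n -> 'I_N * 'I_N}) wave (freq L p) (x - t) =
  (N%:R ^+ n * \prod_i fejer N (L^-1 * (x 0 i - t 0 i)))%:C%C.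
Proof.
move=> N0; have N1 : N%:R != 0 :> R by rewrite pnatr_eq0 -lt0n.
rewrite realcM (big_morph (fun x : R => x%:C%C) realcM (erefl _)).
rewrite (eq_bigr _ (fun i _ => fejer_double_sum N (L^-1 * (x 0 i - t 0 i)))).
rewrite big_split/= prodr_const card_ord mulrA.
have -> : (N%:R ^+ n)%:C%C * (N%:R^-1)%:C%C ^+ n = 1 :> C.
  have -> : ((N%:R^-1 : R)%:C%C ^+ n : C) = ((N%:R ^- n : R)%:C%C).
    elim: n => [|m IH]; first by rewrite expr0 expr0 invr1.
    by rewrite exprS IH -realcM exprS invfM.
  by rewrite -realcM divff// expf_neq0.
rewrite mul1r bigA_distr_bigA/=; apply: eq_bigr => p _.
rewrite /wave /dotp mulr_sumr expi_sum; apply: eq_bigr => i _.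
by rewrite !mxE; congr expi; ring.
Qed.

(** In convolution form, the kernel is non-negative. *)
Lemma fejer_sumE L N theta x : (0 < N)%N -> 0 < L -> Cc theta ->
  fejer_sum L N theta x = integral_Rn (fun t => (kernel L N x t)%:C%C * theta t).
Proof.
move=> N0 L0 ct; rewrite /fejer_sum.
pose F (p : {ffun 'I_n -> 'I_N * 'I_N}) t := wave (- freq L p) t * theta t.
have cF p : Cc (F p) by exact: Cc_wave.
have [cS E] := integral_sum (fun p => wave (freq L p) x) cF.
rewrite (eq_bigr (fun p => wave (freq L p) x * integral_Rn (F p))); last first.
  by move=> p _; rewrite fourierE mulrC.
rewrite -E -integralZ//; congr integral_Rn; apply/funext => t.
rewrite (eq_bigr (fun p => wave (freq L p) (x - t) * theta t)); last first.
  by move=> p _; rewrite /F mulrA -waveNx -waveDx.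
rewrite /kernel -mulr_suml mulrA; congr (_ * _).
rewrite sum_wave_freq// -realcM; congr (_%:C%C).
rewrite mulrA; congr (_ * _).
have N1 : N%:R != 0 :> R by rewrite pnatr_eq0 -lt0n.
by rewrite exprMn invfM mulrAC mulVf ?mul1r// expf_neq0.
Qed.

Lemma kernel_ge0 L N x t : 0 < L -> 0 <= kernel L N x t.
Proof.
move=> L0; rewrite mulr_ge0//; first by rewrite invr_ge0 exprn_ge0// ltW.
by apply: prodr_ge0 => i _; exact: fejer_ge0.
Qed.

Lemma indic_box_prod c (r : R) t : \1_(box c r) t =
  \prod_i \1_`[c 0 i - r, c 0 i + r] (t 0 i) :> R.
Proof.
have [h|h] := pselect (box c r t).
  rewrite indicE mem_set//= big1// => i _; rewrite indicE mem_set//=.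
  by rewrite in_itv/= -ler_distl; exact: h.
rewrite indicE memNset//=; apply/esym/eqP; rewrite prodf_seq_eq0.
have [i hi] : exists i, ~ `|t 0 i - c 0 i| <= r by apply/existsNP.
apply/hasP; exists i; first by rewrite mem_index_enum.
rewrite /= indicE memNset//= in_itv/= -ler_distl; exact: hi.
Qed.

(** One factor of the kernel on a period, possibly replaced by a constant. *)
Definition factor L N x c (e : 'I_n -> option R) (j : 'I_n) (y : RR) : R :=
  \1_`[c 0 j - L / 2, c 0 j + L / 2] y *
  (if e j is Some k then k else fejer N (L^-1 * (x 0 j - y))).

Lemma integral_factor L N x c e j : (0 < N)%N -> 0 < L ->
  (forall j k, e j = Some k -> 0 <= k) ->
  (\int[lebesgue_measure]_y (factor L N x c e j y)%:E =
    (L * (if e j is Some k then k else 1))%:E)%E.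
Proof.
move=> N0 L0 e0.
have hL : c 0 j + L / 2 = c 0 j - L / 2 + L by lra.
pose I : set RR := `[c 0 j - L / 2, c 0 j - L / 2 + L]%classic.
have mI : measurable I by exact: measurable_itv.
rewrite /factor hL.
case ej : (e j) => [k|].
  transitivity (\int[lebesgue_measure]_y (k%:E * (\1_I y)%:E))%E.
    by apply: eq_integral => y _; rewrite -EFinM mulrC.
  rewrite ge0_integralZl//=; last 2 first.
  - by apply/measurable_EFinP; exact: (measurable_indic mI).
  - by rewrite lee_fin; exact: e0 ej.
  have -> : (\int[lebesgue_measure]_y (\1_I y)%:E)%E = lebesgue_measure I.
    by have := integral_indic lebesgue_measure measurableT mI; rewrite setIT => <-.
  rewrite /I lebesgue_measure_itv/= lte_fin ltrDl L0 -EFinB -EFinM.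
  by congr EFin; ring.
rewrite mulr1 -(@integral_fejer R N (x 0 j) (c 0 j - L / 2) L)//.
rewrite [RHS]integral_mkcond; apply: eq_integral => y _.
rewrite /patch; case: ifPn => hy.
  by rewrite indicE hy mul1r.
by rewrite indicE (negbTE hy) mul0r.
Qed.

Lemma integral_prod_factor L N x c e : (0 < N)%N -> 0 < L ->
  (forall j k, e j = Some k -> 0 <= k) ->
  (\int[mu]_t (\prod_j factor L N x c e j (rowt t 0 j))%:E =
    (\prod_j (L * (if e j is Some k then k else 1)))%:E)%E.
Proof.
move=> N0 L0 e0.
transitivity (\prod_(j < n) \int[lebesgue_measure]_y (factor L N x c e j y)%:E)%E.
  rewrite -integral_tensor.
  - apply: eq_integral => t _; congr EFin; apply: eq_bigr => j _; by rewrite mxE.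
  - move=> j; apply: measurable_funM.
      by apply: measurable_indic; exact: measurable_itv.
    case: (e j) => [k|]; [exact: measurable_cst|exact: measurable_fejer].
  - move=> j y; rewrite /factor mulr_ge0//.
    by case ej : (e j) => [k|]; [exact: e0 ej|exact: fejer_ge0].
rewrite -prodEFin; apply: eq_bigr => j _; exact: integral_factor.
Qed.

Lemma measurable_factor L N x c e :
  measurable_fun setT (fun t : n.-tuple RR => \prod_j factor L N x c e j (rowt t 0 j)).
Proof.
apply: measurable_prod => j _.
rewrite (_ : (fun t : n.-tuple RR => _) = factor L N x c e j \o (fun t : n.-tuple RR => tnth t j)); last first.
  by apply/funext => t /=; rewrite mxE.
apply: measurableT_comp; last exact: measurable_tnth.
apply: measurable_funM; last by case: (e j) => [k|]; [exact: measurable_cst|exact: measurable_fejer].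
by apply: measurable_indic; exact: measurable_itv.
Qed.

Lemma integral_kernel L N x c : (0 < N)%N -> 0 < L ->
  (\int[mu]_t (\1_(box c (L / 2)) (rowt t) * kernel L N x (rowt t))%:E = 1)%E.
Proof.
move=> N0 L0.
have e0 (j : 'I_n) (k : R) : None = Some k -> 0 <= k by [].
have := @integral_prod_factor L N x c (fun=> None) N0 L0 e0.
rewrite (eq_bigr (fun=> L)) => [|j _]; last by rewrite mulr1.
rewrite prodr_const card_ord => H.
have P0 (t : n.-tuple RR) : (0 <= (\prod_j factor L N x c (fun=> None) j (rowt t 0 j))%:E)%E.
  by rewrite lee_fin prodr_ge0// => j _; rewrite /factor mulr_ge0// fejer_ge0.
transitivity ((L ^- n)%:E * \int[mu]_t (\prod_j factor L N x c (fun=> None) j (rowt t 0 j))%:E)%E.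
  rewrite -ge0_integralZl//; last 2 first.
  - by apply/measurable_EFinP; exact: measurable_factor.
  - by rewrite lee_fin invr_ge0 exprn_ge0// ltW.
  apply: eq_integral => t _; rewrite -EFinM; congr EFin.
  by rewrite indic_box_prod /kernel mulrCA -big_split.
rewrite H// -EFinM mulVf// expf_neq0// gt_eqF//.
Qed.

(** Only the [i]-th factor sees the sine, and it gains [1 / N]. *)
Lemma integral_kernel_sin2 L N x c i : (0 < N)%N -> 0 < L ->
  (\int[mu]_t (\1_(box c (L / 2)) (rowt t) * kernel L N x (rowt t) *
     sin (pi * (L^-1 * (x 0 i - rowt t 0%R i))) ^+ 2)%:E <= (N%:R^-1)%:E)%E.
Proof.
move=> N0 L0; pose e j : option R := if j == i then Some N%:R^-1 else None.
have e0 j k : e j = Some k -> 0 <= k.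
  by rewrite /e; case: ifP => // _ [<-]; rewrite invr_ge0.
have := @integral_prod_factor L N x c e N0 L0 e0.
have -> : \prod_j (L * (if e j is Some k then k else 1)) = L ^+ n * N%:R^-1.
  rewrite big_split/= prodr_const card_ord; congr (_ * _).
  rewrite (bigD1 i)//= /e eqxx big1 ?mulr1// => j ji.
  by rewrite (negbTE ji).
move=> H.
have P0 (t : n.-tuple RR) : (0 <= (\prod_j factor L N x c e j (rowt t 0 j))%:E)%E.
  rewrite lee_fin prodr_ge0// => j _; rewrite /factor mulr_ge0//.
  by case ej : (e j) => [k|]; [exact: e0 ej|exact: fejer_ge0].
have Ln0 : 0 <= L ^- n by rewrite invr_ge0 exprn_ge0// ltW.
have -> : (N%:R^-1)%:E = ((L ^- n)%:E * \int[mu]_t (\prod_j factor L N x c e j (rowt t 0 j))%:E)%E.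
  by rewrite H -EFinM mulKf// expf_neq0// gt_eqF.
rewrite -ge0_integralZl//; last first.
  by apply/measurable_EFinP; exact: measurable_factor.
apply: ge0_le_integral_nonmeas => t.
  by rewrite lee_fin mulr_ge0 ?sqr_ge0// mulr_ge0// kernel_ge0.
rewrite -EFinM lee_fin indic_box_prod /kernel [X in X * _]mulrCA -mulrA ler_wpM2l//.
rewrite -big_split/= (bigD1 i)//= [leRHS](bigD1 i)//= [leLHS]mulrAC.
have -> : \prod_(j < n | j != i) factor L N x c e j (rowt t 0 j) =
  \prod_(j < n | j != i) (\1_`[c 0 j - L / 2, c 0 j + L / 2] (rowt t 0 j) * fejer N (L^-1 * (x 0 j - rowt t 0 j))).
  by apply: eq_bigr => j ji; rewrite /factor /e (negbTE ji).
rewrite ler_wpM2r//.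
  by apply: prodr_ge0 => j _; rewrite mulr_ge0// fejer_ge0.
rewrite /factor /e eqxx -mulrA ler_wpM2l//.
exact: fejer_sin2.
Qed.

Lemma kernel_factor L N x c t :
  \1_(box c (L / 2)) t * kernel L N x t =
  L ^- n * \prod_j factor L N x c (fun=> None) j (t 0 j).
Proof. by rewrite indic_box_prod /kernel mulrCA -big_split. Qed.

Lemma measurable_kernel L N x c : measurable_fun setT
  (fun t : n.-tuple RR => \1_(box c (L / 2)) (rowt t) * kernel L N x (rowt t)).
Proof.
under eq_fun do rewrite kernel_factor.
by apply: measurable_funM; [exact: measurable_cst|exact: measurable_factor].
Qed.

Lemma integrable_kernel L N x c : (0 < N)%N -> 0 < L ->
  integrable_rows (fun t => (\1_(box c (L / 2)) t * kernel L N x t)%:C%C).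
Proof.
move=> N0 L0; split; last exact: integrable0.
apply/integrableP; split; first by apply/measurable_EFinP; exact: measurable_kernel.
rewrite (eq_integral (fun t : n.-tuple RR => (\1_(box c (L / 2)) (rowt t) * kernel L N x (rowt t))%:E)).
  by rewrite integral_kernel// ltry.
move=> t _ /=; rewrite ger0_norm// mulr_ge0// kernel_ge0//.
Qed.

Lemma cont_kernel L N x t : (0 < N)%N -> cont_at t (fun t => (kernel L N x t)%:C%C).
Proof.
move=> N0.
have -> : (fun t => (kernel L N x t)%:C%C) = (fun t => ((L ^- n * N%:R ^- n)%:C%C : C) *
    \sum_(p : {ffun 'I_n -> 'I_N * 'I_N}) wave (freq L p) x * wave (- freq L p) t).
  apply/funext => y.
  rewrite (eq_bigr (fun p => wave (freq L p) (x - y))) => [|p _]; last first.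
    by rewrite waveDx waveNx.
  rewrite sum_wave_freq// -realcM; congr (_%:C%C); rewrite /kernel -mulrA; congr (_ * _).
  by rewrite mulKf// expf_neq0// pnatr_eq0 -lt0n.
apply: Smooth_cont; apply: SmoothZ; apply: Smooth_sum => p; apply: SmoothZ.
by have [] := wave_partials (- freq L p).
Qed.

Lemma Cc_bounded u : Cc u -> exists B, forall x, normc (u x) <= B.
Proof.
move=> [cu [r hr]].
have [B hB] := cont_bounded_on_compact (@compact_box R n 0 r) (fun x => cont_at_normc (cu x)).
exists (Num.max B 0) => x; rewrite le_max.
by have [->|/hr/hB ->//] := eqVneq (u x) 0; rewrite normc0 lexx orbT.
Qed.

(** The support of [theta] fits in one period, over which the kernel has mass
one. *)
Lemma fejer_sum_bound L N theta c (B : R) x : (0 < N)%N -> 0 < L -> Cc theta ->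
  (forall x, normc (theta x) <= B) -> (forall x, theta x != 0 -> box c (L / 2) x) ->
  normc (fejer_sum L N theta x) <= 2 * B.
Proof.
move=> N0 L0 ct tB tc.
have B0 : 0 <= B := le_trans (normc_ge0 _) (tB 0).
rewrite fejer_sumE//.
apply: (@integral_bound _ _ _ (fun t => B * (\1_(box c (L / 2)) t * kernel L N x t))).
  move=> t; have k0 := kernel_ge0 N x t L0.
  have [->|/tc bt] := eqVneq (theta t) 0.
    rewrite mulr0 normc0 mulr_ge0// mulr_ge0//.
  rewrite normcM normc_real ger0_norm// mulrC indicE mem_set// mul1r.
  by rewrite ler_wpM2r.
under eq_integral do rewrite EFinM.
rewrite ge0_integralZl//; first by rewrite integral_kernel// mule1.
- by apply/measurable_EFinP; exact: measurable_kernel.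
- by move=> t _; rewrite lee_fin mulr_ge0// kernel_ge0.
Qed.

Lemma Cc_unif_cont u (e : R) : Cc u -> 0 < e ->
  exists2 d, 0 < d & forall x y, `|x - y| < d -> normc (u x - u y) <= e.
Proof.
move=> [cu [r hr]] e0.
have K := @compact_box R n 0 (r + 1).
move: K => /compact_near_coveringP K.
have : \forall d \near (0:R)^'+, box 0 (r + 1) `<=`
    (fun x => forall y, `|x - y| < d -> normc (u x - u y) <= e).
  apply: K => x _.
  have c1 : {for x, continuous (fun t => normc (u t - u x))}.
    by apply: cont_at_normc; apply: cont_atB => //; exact: cont_at_cst.
  have /nbhs_ballP[s /= s0 hs] : \forall t \near x, normc (u t - u x) < e / 2.
    apply: (c1 [set y | y < e / 2]); apply: open_nbhs_nbhs; split; first exact: open_lt.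
    by rewrite /= subrr normc0 divr_gt0.
  have s2 : 0 < s / 2 by rewrite divr_gt0.
  exists (ball x (s / 2), [set d | d < s / 2]) => /=.
    by split; [exact: nbhsx_ballx|exact: nbhs_right_lt].
  move=> [x' d] /= [xx' ds] y x'y.
  have h1 : normc (u x' - u x) < e / 2.
    by apply: hs; apply: le_ball xx'; rewrite ler_pdivrMr//; lra.
  have h2 : normc (u y - u x) < e / 2.
    apply: hs; rewrite [s]splitr; apply: (ball_triangle xx').
    by rewrite -ball_normE /= (lt_trans x'y).
  have -> : u x' - u y = (u x' - u x) + (u x - u y) by ring.
  apply: le_trans (le_normcD _ _) _.
  rewrite [normc (u x - u y)]normcB; lra.
move=> h.
have [d [[hd d1] d0]] := filter_ex (filterI (filterI h (nbhs_right_lt (ltr01 : 0 < 1 :> R))) (nbhs_right_gt 0)).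
exists d => // x y xy.
have [bx|bx] := pselect (box 0 (r + 1) x); first exact: hd.
have out z : ~ box 0 r z -> u z = 0.
  by move=> bz; apply/eqP/negP => /negP /hr.
rewrite !out ?subrr ?normc0 ?ltW// => bz; apply: bx.
- move=> i; have := bz i; rewrite !mxE !subr0 => h1.
  have := coord_le_norm (x - y) i; rewrite !mxE => h2.
  have := ler_normD (x 0 i - y 0 i) (y 0 i); rewrite subrK; lra.
- by apply: box_incl bz; rewrite lerDl.
Qed.

(** Integrate over the period centred at [x]; it contains the support of [theta].
By uniform continuity, [|theta t - theta x|] is at most a small constant plus a
multiple of [sum_i sin (pi (x_i - t_i) / L)^2], whose integral against the kernel
is [O(1/N)] by [integral_kernel_sin2]. *)
Lemma fejer_sum_cvg L theta c (e : R) : 0 < L -> Cc theta ->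
  (forall x, theta x != 0 -> box c (L / 4) x) -> 0 < e ->
  exists N0, forall N x, (N0 < N)%N -> box c (L / 4) x ->
    normc (fejer_sum L N theta x - theta x) <= e.
Proof.
move=> L0 ct tc e0.
have e4 : 0 < e / 4 by rewrite divr_gt0.
have [B hB] := Cc_bounded ct.
have B0 : 0 <= B := le_trans (normc_ge0 _) (hB 0).
have [d d0 hd] := Cc_unif_cont ct e4.
pose A := 2 * B * (36 * (L / d) ^+ 2).
have A0 : 0 <= A by apply: mulr_ge0; [exact: mulr_ge0|apply: mulr_ge0 => //; exact: sqr_ge0].
exists (Num.truncn (4 * A * n%:R / e)).+1 => N x hN bx.
have N0 : (0 < N)%N by exact: leq_trans hN.
pose I := box x (L / 2).
have tI t : theta t != 0 -> I t.
  move=> /tc bt i; have := bt i; have := bx i.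
  have := ler_distD (c 0 i) (t 0 i) (x 0 i); rewrite [ `|c 0 i - _|]distrC; lra.
have iK := integrable_kernel x x N0 L0.
have k0 t := kernel_ge0 N x t L0.
have -> : fejer_sum L N theta x - theta x =
    integral_Rn (fun t => - theta x * (\1_I t * kernel L N x t)%:C%C + (kernel L N x t)%:C%C * theta t).
  rewrite integral_lin_gen//.
    rewrite -fejer_sumE// addrC; congr (_ + _).
    suff -> : integral_Rn (fun t => (\1_I t * kernel L N x t)%:C%C) = 1 by rewrite mulr1.
    rewrite integral_RnE /Rintegral.
    have -> : (\int[mu]_t (Im ((\1_I (rowt t) * kernel L N x (rowt t))%:C%C))%:E = 0)%E.
      by rewrite integral0_eq.
    by have -> := integral_kernel x x N0 L0.
  apply: Cc_integrable; apply: Cc_mul => //; move=> t; exact: cont_kernel N0.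
pose S t := \sum_i sin (pi * (L^-1 * (x 0 i - t 0 i))) ^+ 2.
have pointwise t : I t -> normc (theta t - theta x) <= e / 4 + A * S t.
  move=> It; have S0 : 0 <= S t by apply: sumr_ge0 => i _; exact: sqr_ge0.
  have [/hd h|dt] := ltP `|t - x| d.
    by apply: le_trans h _; rewrite lerDl mulr_ge0.
  have [i hi] : exists i, ~ `|(t - x) 0 i| <= d / 2.
    apply/existsNP => h; suff : `|t - x| <= d / 2 by lra.
    by apply: row_norm_le => //; lra.
  have {}hi : d / 2 < `|x 0 i - t 0 i|.
    by rewrite distrC ltNge; apply/negP => h; apply: hi; rewrite !mxE.
  have pi2 := @pi_ge2 R; have pi4 := @pihalf_lt2 R.
  have hs : sin (pi * (L^-1 * (x 0 i - t 0 i))) ^+ 2 <= S t.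
    by rewrite /S (bigD1 i)//= lerDl; apply: sumr_ge0 => j _; exact: sqr_ge0.
  apply: le_trans (le_normcD _ _) _; rewrite normcN.
  suff : 2 * B <= A * S t by have := hB t; have := hB x; lra.
  have := It i; rewrite distrC => hi2.
  pose y := `|x 0 i - t 0 i| / L.
  have y2 : y <= 1 / 2 by rewrite ler_pdivrMr//; lra.
  have yd : d / L / 2 <= y by rewrite /y mulrAC ler_pM2r ?invr_gt0//; lra.
  have absE : `|pi * (L^-1 * (x 0 i - t 0 i))| = pi * y.
    by rewrite normrM gtr0_norm ?pi_gt0// normrM gtr0_norm ?invr_gt0// [L^-1 * _]mulrC.
  have h1 : `|pi * (L^-1 * (x 0 i - t 0 i))| <= 2.
    rewrite absE; nra.
  have := sin2_ge2 h1; rewrite -[X in X / 36]real_normK ?num_real// absE => h2.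
  have dL : 0 < d / L by rewrite divr_gt0.
  have h0 : d / L <= pi * y by move: dL yd pi2; clear; set q := d / L; nra.
  have h3 : (d / L) ^+ 2 <= (pi * y) ^+ 2.
    by apply: lerXn2r; rewrite ?nnegrE; [exact: ltW|exact: le_trans (ltW dL) h0|].
  have h4 : (d / L) ^+ 2 / 36 <= S t by lra.
  apply: le_trans (ler_wpM2l A0 h4); rewrite le_eqVlt; apply/orP; left; apply/eqP.
  by rewrite /A; field; rewrite !gt_eqF.
have mK : measurable_fun setT (fun t : n.-tuple RR => \1_I (rowt t) * kernel L N x (rowt t)).
  exact: measurable_kernel.
have mS i : measurable_fun setT (fun t : n.-tuple RR => sin (pi * (L^-1 * (x 0 i - (rowt t) 0 i))) ^+ 2).
  apply: (@measurable_rowt_continuous R n (fun t : V => sin (pi * (L^-1 * (x 0 i - t 0 i))) ^+ 2)) => t.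
  apply: (@continuous_comp _ _ _ (fun t : V => t 0 i) (fun y : R => sin (pi * (L^-1 * (x 0 i - y))) ^+ 2)).
    exact: coord_continuous.
  apply: (@continuous_comp _ _ _ (fun y : R => sin (pi * (L^-1 * (x 0 i - y)))) (@GRing.exp R ^~ 2%N)); last exact: exprn_continuous.
  apply: (@continuous_comp _ _ _ (fun y : R => pi * (L^-1 * (x 0 i - y))) sin); last exact: continuous_sin.
  do 2 (apply: continuousM; first exact: cst_continuous).
  by apply: continuousB; [exact: cst_continuous|exact: cvg_id].
rewrite (_ : e = 2 * (e / 4 + e / 4)); last by field.
apply: (@integral_bound _ _ _ (fun t => e / 4 * (\1_I t * kernel L N x t) +
   A * \sum_i (\1_I t * kernel L N x t * sin (pi * (L^-1 * (x 0 i - t 0 i))) ^+ 2))).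
  move=> t; have [It|It] := pselect (I t); last first.
    have -> : theta t = 0 by apply/eqP/negP => /negP /tI.
    rewrite indicE memNset//= !mul0r mulr0 mulr0 addr0 normc0.
    rewrite mulr0 add0r big1 ?mulr0// => i _; by rewrite mul0r.
  rewrite indicE mem_set// -mulr_sumr mul1r.
  have -> : - theta x * (kernel L N x t)%:C%C + (kernel L N x t)%:C%C * theta t =
     (kernel L N x t)%:C%C * (theta t - theta x) by ring.
  rewrite normcM normc_real ger0_norm//.
  apply: le_trans (ler_wpM2l (k0 t) (pointwise t It)) _.
  by rewrite le_eqVlt; apply/orP; left; apply/eqP; rewrite /S; ring.
have g0 t : 0 <= \1_I t * kernel L N x t by rewrite mulr_ge0.
under eq_integral do rewrite EFinD.
rewrite ge0_integralD//=; last 4 first.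
- by move=> t _; rewrite lee_fin mulr_ge0// ltW.
- by apply/measurable_EFinP; apply: measurable_funM => //; exact: measurable_cst.
- by move=> t _; rewrite lee_fin mulr_ge0// sumr_ge0// => i _; rewrite mulr_ge0// sqr_ge0.
- apply/measurable_EFinP; apply: measurable_funM; first exact: measurable_cst.
  by apply: measurable_sum => i; exact: measurable_funM.
rewrite EFinD; apply: leeD.
  under eq_integral do rewrite EFinM.
  rewrite ge0_integralZl//=; last 3 first.
  - exact/measurable_EFinP.
  - by move=> t _; rewrite lee_fin.
  - by rewrite lee_fin ltW.
  by rewrite integral_kernel// mule1.
under eq_integral do rewrite EFinM -sumEFin.
rewrite ge0_integralZl//=; last 2 first.
- by apply: emeasurable_sum => i; apply/measurable_EFinP; exact: measurable_funM.
- by move=> t _; apply: sume_ge0 => i _; rewrite lee_fin mulr_ge0// sqr_ge0.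
rewrite ge0_integral_sum//=; last 2 first.
- by move=> i; apply/measurable_EFinP; exact: measurable_funM.
- by move=> i t _; rewrite lee_fin mulr_ge0// sqr_ge0.
apply: le_trans (_ : (A%:E * \sum_(i < n) (N%:R^-1)%:E <= _)%E).
  rewrite lee_wpmul2l//; apply: lee_sum => i _; exact: integral_kernel_sin2.
rewrite sumEFin sumr_const card_ord -EFinM lee_fin -[_ *+ n]mulr_natr.
have : 4 * A * n%:R / e < N%:R.
  apply: lt_le_trans (truncnS_gt _) _; by rewrite ler_nat ltnW.
rewrite ltr_pdivrMr// => h.
rewrite [N%:R^-1 * _]mulrC mulrA ler_pdivrMr ?ltr0n//; lra.
Qed.

Lemma fourier_iter_partial U u a xi : Test U u ->
  fourier (iter_partialC a u) xi = wave_coef xi a * fourier u xi.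
Proof.
move=> tu; elim: a => [|i a IH]; first by rewrite /wave_coef big_nil mul1r iter_partialC_nil.
have -> : iter_partialC (i :: a) u = iter_partialC [:: i] (iter_partialC a u).
  apply/funext => x; apply: iter_partialC_cons.
  by apply: Smooth_has_partial; apply: Smooth_iter_partial; exact: Test_Smooth tu.
rewrite (fourier_partial i xi (Test_iter a tu)) IH /wave_coef big_cons mulrA//.
Qed.

Lemma fejer_sum_Smooth L N theta : Smooth (fejer_sum L N theta).
Proof.
apply: SmoothZ; apply: Smooth_sum => p; apply: SmoothZ.
by have [] := wave_partials (freq L p).
Qed.

(** Differentiating the waves or differentiating [theta] multiplies the Fourier
coefficients by the same factor. *)
Lemma fejer_sum_partials U L N theta a : Test U theta ->
  iter_partialC a (fejer_sum L N theta) = fejer_sum L N (iter_partialC a theta).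
Proof.
move=> tt; rewrite /fejer_sum.
have sw p : Smooth (wave (freq L p)) by have [] := wave_partials (freq L p).
rewrite iter_partialCZ; last by apply: Smooth_sum => p; exact: SmoothZ.
apply/funext => x; congr (_ * _).
rewrite iter_partialC_sum; last by move=> p; exact: SmoothZ.
apply: eq_bigr => p _; rewrite iter_partialCZ//.
have [_ ->] := wave_partials (freq L p).
by rewrite (fourier_iter_partial _ _ tt) mulrA [wave_coef _ _ * _]mulrC.
Qed.

Lemma fejer_sum_bounded L N theta : Bounded_derivatives (fejer_sum L N theta).
Proof.
split; first exact: fejer_sum_Smooth.
have sw p : Smooth (wave (freq L p)) by have [] := wave_partials (freq L p).
move=> a; exists (normc ((N%:R * L) ^- n)%:C%C * \sum_p normc (fourier theta (freq L p)) * normc (wave_coef (@freq L N p) a)) => x.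
rewrite iter_partialCZ; last by apply: Smooth_sum => p; exact: SmoothZ.
rewrite normcM ler_wpM2l ?normc_ge0// iter_partialC_sum; last by move=> p; exact: SmoothZ.
apply: le_trans (normc_sum _ _ _) _; apply: ler_sum => p _.
rewrite iter_partialCZ// normcM ler_wpM2l ?normc_ge0//.
by have [_ ->] := wave_partials (freq L p); rewrite normcM normc_wave mulr1.
Qed.

End FejerSums.

Section FejerWeights.
Context {R : realType} {n : nat}.
Implicit Types (m N j l : nat).

(** The term of index [j >= 1] is at most [2/j - 2/(j+1)]. *)
Let inv_sqr_sum m : \sum_(0 <= j < m) (1 + (j%:R : R) ^+ 2)^-1 <= 3.
Proof.
case: m => [|m]; first by rewrite big_geq.
suff : \sum_(0 <= j < m.+1) (1 + (j%:R : R) ^+ 2)^-1 <= 3 - 2 / m.+1%:R.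
  have : 0 <= 2 / (m.+1%:R : R) by [].
  by set y := 2 / _; set z := bigop _ _ _; lra.
elim: m => [|m IH]; first by rewrite big_nat1 expr0n/= addr0; lra.
rewrite big_nat_recr//=; apply: le_trans (lerD IH (lexx _)) _.
have p1 : 0 < m.+1%:R :> R by rewrite ltr0n.
rewrite -(natr1 m.+1); move: p1; set y := m.+1%:R => p1.
have -> : 2 / (y + 1) = 2 / y - 2 / (y * (y + 1)) by field; rewrite !gt_eqF; lra.
suff : (1 + y ^+ 2)^-1 <= 2 / (y * (y + 1)).
  by set a := 2 / y; set z := 2 / (y * _); set w := _^-1; lra.
rewrite ler_pdivlMr; last nra.
rewrite mulrC ler_pdivrMr; nra.
Qed.

Let inv_sqr_row N (j : 'I_N) :
  \sum_(l < N) (1 + (j%:R - l%:R : R) ^+ 2)^-1 <= 6.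
Proof.
rewrite -(big_mkord xpredT (fun l => (1 + (j%:R - l%:R : R) ^+ 2)^-1)).
rewrite (@big_cat_nat _ _ _ j.+1)//=.
have h1 : \sum_(0 <= l < j.+1) (1 + (j%:R - l%:R : R) ^+ 2)^-1 <= 3.
  rewrite big_nat_rev/=; apply: le_trans (inv_sqr_sum j.+1).
  rewrite le_eqVlt; apply/orP; left; apply/eqP.
  rewrite [LHS]big_nat_cond [RHS]big_nat_cond; apply: eq_bigr => l /andP[/andP[_ lj] _].
  by rewrite add0n subSS natrB// subKr.
have h2 : \sum_(j.+1 <= l < N) (1 + (j%:R - l%:R : R) ^+ 2)^-1 <= 3.
  rewrite -{1}[j.+1]add0n big_addn; apply: le_trans (inv_sqr_sum (N - j.+1)).
  apply: ler_sum => l _; rewrite natrD -natr1.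
  have -> : ((j%:R : R) - (l%:R + (j%:R + 1))) ^+ 2 = (l%:R + 1) ^+ 2 by ring.
  have l0 : 0 <= l%:R :> R by [].
  by rewrite lef_pV2 ?posrE; nra.
lra.
Qed.

(** The frequencies of a Fejer sum of period [L] fill a lattice of mesh [1/L];
with the Fejer weights, a summable majorant has a sum that is polynomial in [L],
uniformly in the order [N]. *)
Lemma fejer_weights (L : R) N : (0 < N)%N -> 1 <= L ->
  (N%:R * L) ^- n * \sum_(p : {ffun 'I_n -> 'I_N * 'I_N}) bracket2 (freq L p) ^- n
  <= (6 * L) ^+ n.
Proof.
move=> N0 L1.
have NR : 0 < N%:R :> R by rewrite ltr0n.
have L0 : 0 < L by lra.
pose b (q : 'I_N * 'I_N) : R := L ^+ 2 * (1 + (q.1%:R - q.2%:R) ^+ 2)^-1.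
have b0 q : 0 <= b q.
  by rewrite /b mulr_ge0 ?sqr_ge0// invr_ge0 addr_ge0// sqr_ge0.
have hb (p : {ffun 'I_n -> 'I_N * 'I_N}) : bracket2 (freq L p) ^- n <= \prod_i b (p i).
  have -> : bracket2 (freq L p) ^- n = \prod_(i < n) (bracket2 (freq L p))^-1.
    by rewrite prodr_const card_ord exprVn.
  apply: ler_prod => i _; rewrite invr_ge0 ltW ?bracket2_gt0//=.
  have := coord2_le_bracket2 (freq L p) i; rewrite mxE => h.
  set d : R := ((p i).1%:R - (p i).2%:R).
  have h1 : L ^- 2 * (1 + d ^+ 2) <= bracket2 (freq L p).
    apply: le_trans h; rewrite exprMn -/d exprVn mulrDr mulr1 [L ^- 2 * _]mulrC lerD2r.
    by rewrite invf_le1 ?exprn_gt0// exprn_ege1.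
  have d0 : 0 < 1 + d ^+ 2 by have := sqr_ge0 d; lra.
  have -> : b (p i) = (L ^- 2 * (1 + d ^+ 2))^-1 by rewrite /b invfM invrK.
  rewrite lef_pV2 ?posrE ?bracket2_gt0//.
  by rewrite mulr_gt0// invr_gt0 exprn_gt0.
have hs : \sum_(q : 'I_N * 'I_N) b q <= N%:R * (6 * L ^+ 2).
  rewrite -(pair_bigA _ (fun j l : 'I_N => L ^+ 2 * (1 + (j%:R - l%:R) ^+ 2)^-1))/=.
  apply: le_trans (_ : \sum_(j < N) (6 * L ^+ 2) <= _).
    apply: ler_sum => j _; rewrite -mulr_sumr mulrC ler_wpM2r ?sqr_ge0//.
    exact: inv_sqr_row.
  by rewrite sumr_const card_ord [leRHS]mulr_natl.
have hs0 : 0 <= \sum_(q : 'I_N * 'I_N) b q by apply: sumr_ge0 => q _; exact: b0.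
apply: le_trans (_ : (N%:R * L) ^- n * \sum_(p : {ffun 'I_n -> 'I_N * 'I_N}) \prod_i b (p i) <= _).
  by rewrite ler_wpM2l ?ler_sum// invr_ge0 exprn_ge0// mulr_ge0// ltW.
rewrite -(bigA_distr_bigA (fun _ : 'I_n => b))/= prodr_const card_ord.
rewrite -exprVn -exprMn; apply: lerXn2r; rewrite ?nnegrE.
- by rewrite mulr_ge0// invr_ge0 mulr_ge0// ltW.
- by rewrite mulr_ge0// ltW.
rewrite ler_pdivrMl ?mulr_gt0//; apply: le_trans hs _.
by rewrite le_eqVlt; apply/orP; left; apply/eqP; ring.
Qed.

End FejerWeights.

(** * Tempered distributions tested against modulated functions *)

Ltac positivity := lazymatch goal with
  | |- is_true (0 < _ ^+ _) => apply: exprn_gt0; positivity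
  | |- is_true (0 < _^-1) => rewrite invr_gt0; positivity
  | |- is_true (0 < _ * _) => apply: mulr_gt0; positivity
  | |- is_true (0 < _ + _) => first [assumption | apply: addr_gt0; positivity]
  | |- _ => done
  end.
Ltac nonnegativity := apply: ltW; positivity.

Section Tempered.
Context {R : realType} {n : nat}.
Local Notation V := ('rV[R]_n).
Local Notation C := (R[i]).
Implicit Types (u v w chi : V -> C) (x c xi eta t : V) (i : 'I_n) (f : @functional R n).

Lemma tempered_lin f (k : C) u v : tempered f -> Schwartz u -> Schwartz v ->
  f (fun t => k * u t + v t) = k * f u + f v.
Proof. by move=> [fl _] /SchwartzP su /SchwartzP sv; exact: fl. Qed.

Lemma Schwartz0 : Schwartz (fun _ : V => 0 : C).
Proof. exact: Test_Schwartz (Test0 setT). Qed.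

Lemma tempered0 f : tempered f -> f (fun=> 0) = 0.
Proof.
move=> tf; have := tempered_lin 1 tf Schwartz0 Schwartz0.
rewrite (_ : (fun t => _) = (fun=> 0)); last by apply/funext => t; rewrite mulr0 addr0.
by rewrite mul1r => /eqP; rewrite -subr_eq subrr eq_sym => /eqP.
Qed.

Lemma temperedZ f (k : C) u : tempered f -> Schwartz u ->
  f (fun t => k * u t) = k * f u.
Proof.
move=> tf su; have := tempered_lin k tf su Schwartz0.
rewrite tempered0// addr0 => <-; congr f; apply/funext => t; by rewrite addr0.
Qed.

Lemma temperedB f u v : tempered f -> Schwartz u -> Schwartz v ->
  f (fun t => u t - v t) = f u - f v.
Proof.
move=> tf su sv; have := tempered_lin (-1) tf sv su.
rewrite mulN1r addrC => <-; congr f; apply/funext => t; by rewrite mulN1r addrC.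
Qed.

Lemma tempered_sum f (I : finType) (k : I -> C) (F : I -> V -> C) : tempered f ->
  (forall j, Schwartz (F j)) ->
  Schwartz (fun t => \sum_j k j * F j t) /\
  f (fun t => \sum_j k j * F j t) = \sum_j k j * f (F j).
Proof.
move=> tf sF; elim: (index_enum I) => [|j js [IHs IHf]].
  rewrite (_ : (fun t => _) = (fun=> 0)); last by apply/funext => t; rewrite big_nil.
  by rewrite big_nil (tempered0 tf); split; first exact: Schwartz0.
rewrite (_ : (fun t => _) = (fun t => k j * F j t + \sum_(j <- js) k j * F j t)); last first.
  by apply/funext => t; rewrite big_cons.
split; first exact: Schwartz_lin.
by rewrite tempered_lin// big_cons IHf.
Qed.

(** Continuity at zero and homogeneity: [phi] is rescaled until its seminorms are
below [d]. *)
Lemma tempered_bound f : tempered f -> exists (K : nat) (C0 : R), 0 < C0 /\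
  forall phi B, Schwartz phi -> 0 < B ->
    (forall a x, (size a <= K)%N -> bracket2 x ^+ K * normc (iter_partialC a phi x) <= B) ->
    normc (f phi) <= C0 * B.
Proof.
move=> tf; have [_ fc] := tf.
have [N [d [d0 hN]]] := fc _ (proj2 (SchwartzP _) Schwartz0) 1 ltr01.
exists N, (2 / d); split; first by rewrite divr_gt0.
move=> phi B sp B0 hB.
pose k : R := d / (2 * B).
have k0 : 0 < k by rewrite divr_gt0// mulr_gt0.
have skp : Schwartz (fun t => k%:C%C * phi t).
  have := Schwartz_lin k%:C%C sp Schwartz0.
  by rewrite (_ : (fun t => _) = (fun t => k%:C%C * phi t))//; apply/funext => t; rewrite addr0.
have := hN _ (proj2 (SchwartzP _) skp).
rewrite tempered0// subr0 temperedZ// normcM normc_real gtr0_norm// => h.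
have : k * normc (f phi) < 1.
  apply: h => a aN.
  apply: (@le_lt_trans _ _ (d / 2)%:E); last by rewrite lte_fin ltr_pdivrMr//; lra.
  apply: seminorm_le => x.
  rewrite (_ : (fun t => _) = (fun t => k%:C%C * phi t)); last first.
    by apply/funext => t; rewrite subr0.
  rewrite iter_partialCZ; last by case: sp.
  rewrite normcM normc_real gtr0_norm// mulrCA.
  rewrite (_ : d / 2 = k * B); last by rewrite /k; field; rewrite gt_eqF.
  by apply: ler_wpM2l; [exact: ltW|exact: hB].
move=> h1; rewrite (_ : 2 / d * B = k^-1); last by rewrite /k; field; rewrite !gt_eqF.
by rewrite -ltr_pdivlMl// in h1; rewrite ltW// -[k^-1]mulr1.
Qed.

(** Testing against a Schwartz multiple of [v]: polynomial growth of [v] is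
absorbed by the Schwartz factor, and a modulation costs a polynomial in the
frequency. *)
Lemma tempered_wave_bound f : tempered f -> exists K, forall u M, Schwartz u ->
  exists2 C0 : R, 0 < C0 & forall v (D : R) xi, Bounded_derivatives v -> 0 < D ->
    (forall a x, (size a <= K)%N -> normc (iter_partialC a v x) <= D * bracket2 x ^+ M) ->
    normc (f (fun t => u t * (v t * wave xi t))) <= C0 * (1 + `|xi|) ^+ K * D.
Proof.
move=> tf; have [K [C0 [C00 hK]]] := tempered_bound tf.
exists K => u M su.
have [B B0 hB] := Schwartz_unif su (K + M)%N K.
have pi0 := @pi_gt0 R.
exists (C0 * (2 ^+ K * (B * (2 ^+ K * (1 + 2 * pi) ^+ K)))).
  by positivity.
move=> v D xi bv D0 hv.
have bw := bounded_mul bv (wave_bounded xi).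
pose W := (1 + 2 * pi) ^+ K * (1 + `|xi|) ^+ K.
have nx := normr_ge0 xi.
have W0 : 0 < W by rewrite mulr_gt0// exprn_gt0// ?addr_gt0// ?mulr_gt0//; lra.
have hW a x : (size a <= K)%N -> normc (iter_partialC a (wave xi) x) <= W.
  move=> aK; have [_ ->] := wave_partials xi.
  rewrite normcM normc_wave mulr1; apply: le_trans (wave_coef_le _ _) _.
  rewrite /W -exprMn.
  apply: le_trans (_ : (1 + 2 * pi * `|xi|) ^+ K <= _).
    by rewrite ler_weXn2l// lerDl !mulr_ge0// ltW.
  apply: lerXn2r; rewrite ?nnegrE; nra.
have [sv _] := bv; have [sw _] := wave_bounded xi.
have hvw a x : (size a <= K)%N ->
    normc (iter_partialC a (fun t => v t * wave xi t) x) <= 2 ^+ K * (D * bracket2 x ^+ M * W).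
  by move=> aK; apply: leibniz_bound => // b bK; [exact: hv|exact: hW].
have D1 : 0 < 2 ^+ K * (B * (2 ^+ K * (D * W))) by positivity.
rewrite (_ : _ * D = C0 * (2 ^+ K * (B * (2 ^+ K * (D * W))))); last by rewrite /W; ring.
apply: hK; [exact: Schwartz_mul|exact: D1|].
move=> a x aK.
have b0 := bracket2_gt0 x.
have su' : Smooth u by case: su.
have [svw _] := bw.
have hBx b : (size b <= K)%N -> normc (iter_partialC b u x) <= B / bracket2 x ^+ (K + M).
  by move=> bK; rewrite ler_pdivlMr ?exprn_gt0// mulrC; exact: hB.
have := leibniz_bound su' svw hBx (fun b bK => hvw b x bK) aK.
move=> h; rewrite -ler_pdivlMl ?exprn_gt0//; apply: le_trans h _.
rewrite le_eqVlt; apply/orP; left; apply/eqP.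
rewrite exprD; move: b0; set y := bracket2 x => y0.
have yK : y ^+ K != 0 by rewrite expf_neq0// gt_eqF.
have yM : y ^+ M != 0 by rewrite expf_neq0// gt_eqF.
by field; rewrite yK.
Qed.

Lemma normc_partials_cst1 a x : normc (iter_partialC a (fun _ : V => 1 : C) x) <= 1.
Proof.
case: a => [|i a]; first by rewrite iter_partialC_nil normc1.
have -> : iter_partialC (i :: a) (fun=> 1 : C) x = 0; last by rewrite normc0.
elim: a i x => [|j a IH] i x; apply: iter_partialC_cons.
  by rewrite iter_partialC_nil; exact: has_partial_cst.
rewrite (_ : iter_partialC _ _ = fun=> 0); first exact: has_partial_cst.
by apply/funext => z; exact: IH.
Qed.

Lemma bounded_sub u v : Bounded_derivatives u -> Bounded_derivatives v ->
  Bounded_derivatives (fun t => u t - v t).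
Proof.
move=> [su hu] [sv hv]; split; first exact: SmoothB.
move=> a; have [A hA] := hu a; have [B hB] := hv a; exists (A + B) => x.
rewrite iter_partialCB//; apply: le_trans (le_normcD _ _) _.
by rewrite normcN lerD.
Qed.

(** In a superposition of waves of frequencies [m], the small frequencies keep
[xi - m] inside the cone where [W] decays, and the large ones have small
coefficients. *)
Lemma frequency_shift (A W : V -> R) xi0 (e C2 C3 T : R) (K M : nat) :
  (forall m, 0 <= A m) -> (forall eta, 0 <= W eta) ->
  0 < e -> `|xi0| = 1 -> 0 < C2 -> 0 < C3 -> 0 < T ->
  (forall (c : R) eta, 1 <= c -> `|eta - c *: xi0| <= 2 * e * c -> W eta <= C2 / c ^+ M) ->
  (forall eta, W eta <= C3 * (1 + `|eta|) ^+ K) ->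
  (forall m, A m <= T / bracket2 m ^+ (n + K + M)) ->
  exists2 Q : R, 0 < Q & forall (c : R) xi m, 1 <= c -> `|xi - c *: xi0| <= e * c ->
    A m * W (xi - m) <= Q / c ^+ M * bracket2 m ^- n.
Proof.
move=> A0 W0 e0 xi01 C20 C30 T0 near far hA.
pose Q2 := C3 * T * (2 * (2 + 2 / e)) ^+ K * (2 / e) ^+ M.
have Q20 : 0 < Q2 by rewrite /Q2; positivity.
exists (C2 * T + Q2); first by positivity.
move=> c xi m c1 hxi; have c0 : 0 < c by lra.
set y := bracket2 m; have y1 : 1 <= y := bracket2_ge1 m.
have y0 : 0 < y by lra.
have cyV : 0 <= (c ^+ M)^-1 * (y ^+ n)^-1 by nonnegativity.
rewrite -mulrA.
have [mc|mc] := leP `|m| (e * c).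
  have hn : W (xi - m) <= C2 / c ^+ M.
    apply: near => //.
    have -> : xi - m - c *: xi0 = (xi - c *: xi0) - m by rewrite addrAC.
    by apply: le_trans (ler_normB _ _) _; lra.
  apply: le_trans (ler_pM (A0 _) (W0 _) (hA m) hn) _.
  apply: le_trans (_ : T / y ^+ n * (C2 / c ^+ M) <= _).
    apply: ler_wpM2r; first by nonnegativity.
    apply: ler_wpM2l; first by nonnegativity.
    by rewrite lef_pV2 ?posrE ?exprn_gt0// ler_weXn2l// -addnA leq_addr.
  rewrite (_ : _ * (C2 / _) = C2 * T * ((c ^+ M)^-1 / y ^+ n)); last by ring.
  by apply: ler_wpM2r => //; rewrite lerDl ltW.
have cy : c <= 2 / e * y.
  rewrite mulrAC ler_pdivlMr//; have := norm_le_bracket2 m; rewrite -/y; lra.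
have my : 1 + `|xi - m| <= 2 * (2 + 2 / e) * y.
  have := ler_normB xi m; have := ler_normD (xi - c *: xi0) (c *: xi0).
  rewrite subrK normrZ xi01 mulr1 gtr0_norm//.
  have := norm_le_bracket2 m; rewrite -/y.
  have ey : c * e <= 2 * y by have := norm_le_bracket2 m; rewrite -/y; lra.
  have : 0 <= 2 * y / e by nonnegativity.
  rewrite mulrAC in cy.
  have -> : 2 * (2 + 2 / e) * y = 4 * y + 2 * (2 * y / e) by ring.
  set z := 2 * y / e in cy *; move: hxi.
  have := normr_ge0 m; set a := `|m|; set b := `|xi|; set dd := `|xi - m|; set g := `|xi - _|.
  lra.
apply: le_trans (ler_pM (A0 _) (W0 _) (hA m) (far _)) _.
apply: le_trans (_ : T / y ^+ (n + K + M) * (C3 * (2 * (2 + 2 / e) * y) ^+ K * (2 / e * y / c) ^+ M) <= _).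
  apply: ler_wpM2l; first by nonnegativity.
  apply: le_trans (_ : C3 * (2 * (2 + 2 / e) * y) ^+ K <= _).
    apply: ler_wpM2l; first exact: ltW.
    by apply: lerXn2r; rewrite ?nnegrE//; nonnegativity.
  apply: ler_peMr; first by nonnegativity.
  by apply: exprn_ege1; rewrite ler_pdivlMr// mul1r.
apply: le_trans (_ : Q2 * ((c ^+ M)^-1 / y ^+ n) <= _); last first.
  by apply: ler_wpM2r => //; rewrite lerDr ltW// mulr_gt0.
rewrite le_eqVlt; apply/orP; left; apply/eqP; rewrite /Q2.
move: (2 * (2 + 2 / e)) (2 / e) => p r.
rewrite !exprMn !exprD exprVn.
have yn : y ^+ n != 0 by rewrite expf_neq0// gt_eqF.
have yK : y ^+ K != 0 by rewrite expf_neq0// gt_eqF.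
have yM : y ^+ M != 0 by rewrite expf_neq0// gt_eqF.
have cM : c ^+ M != 0 by rewrite expf_neq0// gt_eqF.
by field; rewrite yn yK yM cM.
Qed.

(** Division by the window [u] near [t0], then a Fejer sum whose period is
proportional to the size of the frequency: the multiplier [chi / u] becomes a
finite superposition of waves, each of which only shifts the frequency at which
[u f] is tested. *)
Lemma local_decay f u t0 xi0 (e : R) : tempered f -> Schwartz u -> u t0 != 0 ->
  0 < e -> `|xi0| = 1 -> e <= 1 ->
  (forall M, exists2 C0 : R, 0 < C0 & forall (c : R) eta, 1 <= c ->
     `|eta - c *: xi0| <= 2 * e * c ->
     normc (f (fun t => u t * wave (- eta) t)) <= C0 / c ^+ M) ->
  exists2 d : R, 0 < d & forall chi, Test (box t0 d) chi -> forall M,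
    exists2 C0 : R, 0 < C0 & forall (c : R) xi, 1 <= c ->
      `|xi - c *: xi0| <= e * c ->
      normc (f (fun t => chi t * wave (- xi) t)) <= C0 / c ^+ M.
Proof.
move=> tf su ut0 e0 xi01 e1 hu.
have smu : Smooth u by case: su.
have : \forall t \near t0, u t != 0.
  have c0 := cont_at_normc (Smooth_cont t0 smu).
  have : \forall t \near t0, 0 < normc (u t).
    apply: (c0 [set y | 0 < y]); apply: open_nbhs_nbhs; split; first exact: open_gt.
    by rewrite /= normc_gt0.
  by apply: filterS => t; rewrite normc_gt0.
move=> /nbhs_ballP[s /= s0 hs].
pose d := Num.min (s / 2) (1 / 4).
have d0 : 0 < d by rewrite lt_min divr_gt0//=; lra.
exists d => // chi tchi M.
have ub t : box t0 d t -> u t != 0.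
  move=> bt; apply: hs; rewrite -ball_normE /= distrC.
  apply: le_lt_trans (proj1 (box_norm t0 t (ltW d0)) bt) _.
  by rewrite /d gt_min; apply/orP; left; lra.
pose th t := chi t / u t.
have tth : Test (box t0 d) th by exact: Test_div.
have chiE t : chi t = u t * th t.
  have [bt|bt] := pselect (box t0 d t); first by rewrite /th mulrC divfK// ub.
  by rewrite (Test_out tth bt) mulr0 (Test_out tchi bt).
have [K hK] := tempered_wave_bound tf.
pose P := (K + M)%N.
(* Outside of a box of size [c], the error of the Fejer sum is only bounded; the
   weight [bracket2 ^+ P] turns this into a bound by [c ^- P]. *)
have [C1 C10 err] := hK u P su.
have [Bth Bth0 hBth] := bounded_unif (Schwartz_bounded (Test_Schwartz tth)) K.
pose q := 8 * (1 + `|t0|).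
have q0 : 0 < q by rewrite mulr_gt0//; have := normr_ge0 t0; lra.
pose D1 := 1 + 3 * Bth * q ^+ P.
have D10 : 0 < D1 by rewrite /D1; positivity.
pose M' := (M + n)%N.
have [C2 C20 near] := hu M'.
have [C3 C30 far] := hK u 0%N su.
have [T T0 hT] := Schwartz_unif (fourier_Schwartz tth) (n + K + M')%N 0%N.
have [Q Q0 term] : exists2 Q : R, 0 < Q & forall (c : R) xi m, 1 <= c ->
    `|xi - c *: xi0| <= e * c ->
    normc (fourier th m) * normc (f (fun t => u t * wave (- (xi - m)) t)) <=
    Q / c ^+ M' * bracket2 m ^- n.
  apply: (@frequency_shift (fun m => normc (fourier th m)) (fun eta => normc (f (fun t => u t * wave (- eta) t)))
     xi0 e C2 C3 T K M').
  - by move=> m; exact: normc_ge0.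
  - by move=> m; exact: normc_ge0.
  - by [].
  - by [].
  - by [].
  - by [].
  - by [].
  - exact: near.
  - move=> eta.
    have := far (fun=> 1) 1 (- eta) (bounded_cst 1) ltr01; rewrite mulr1 normrN.
    rewrite (_ : (fun t => u t * (1 * _)) = fun t => u t * wave (- eta) t); last first.
      by apply/funext => t; rewrite mul1r.
    by apply => a x _; rewrite expr0 mulr1; exact: normc_partials_cst1.
  - move=> m; rewrite ler_pdivlMr ?exprn_gt0 ?bracket2_gt0// mulrC.
    exact: (hT [::] m (leqnn 0)).
have bv N (c : R) : Bounded_derivatives (fun t => th t - fejer_sum c N th t).
  exact: bounded_sub (Schwartz_bounded (Test_Schwartz tth)) (fejer_sum_bounded _ _ _).
exists (C1 * 3 ^+ K * D1 + Q * 6 ^+ n).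
  by positivity.
move=> c xi c1 hxi; have c0 : 0 < c by lra.
have cP : 0 < (c ^+ P)^-1 by positivity.
have d4 : d <= 1 / 4 by rewrite /d ge_min lexx orbT.
(* an order of summation good for all the derivatives that [f] sees *)
have [N [N0 hN]] : exists N, (0 < N)%N /\ forall a, (size a <= K)%N ->
    forall x, box t0 (c / 4) x ->
      normc (fejer_sum c N (iter_partialC a th) x - iter_partialC a th x) <= (c ^+ P)^-1.
  have : \forall N \near \oo, forall a : seq 'I_n, (size a <= K)%N -> forall x, box t0 (c / 4) x ->
      normc (fejer_sum c N (iter_partialC a th) x - iter_partialC a th x) <= (c ^+ P)^-1.
    apply: near_seq_size => a.
    have ta := Test_iter a tth.
    have [||N1 hN1] := @fejer_sum_cvg R n c (iter_partialC a th) t0 (c ^+ P)^-1 c0 (Test_Cc ta).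
    - move=> x ax; apply: (@box_incl _ _ _ d); first lra.
      exact: Test_supp ta ax.
    - exact: cP.
    - by exists N1.+1 => // N /= NN1 x; exact: hN1.
  move=> hN; have [N [N0 hN']] := filter_ex (filterI (nbhs_infty_gt 0) hN).
  by exists N.
pose v t := th t - fejer_sum c N th t.
have xi3 : 1 + `|xi| <= 3 * c.
  have -> : xi = (xi - c *: xi0) + c *: xi0 by rewrite subrK.
  have := ler_normD (xi - c *: xi0) (c *: xi0).
  rewrite normrZ xi01 mulr1 gtr0_norm// => h; move: h hxi e1 c1; clear; nra.
have hv : normc (f (fun t => u t * (v t * wave (- xi) t))) <= C1 * 3 ^+ K * D1 / c ^+ M.
  have D0 : 0 < D1 / c ^+ P by positivity.
  apply: le_trans (err v (D1 / c ^+ P) (- xi) (bv N c) D0 _) _; last first.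
    rewrite normrN.
    apply: le_trans (_ : C1 * (3 * c) ^+ K * (D1 / c ^+ P) <= _).
      apply: ler_wpM2r; first exact: ltW.
      apply: ler_wpM2l; first exact: ltW.
      by apply: lerXn2r => //; rewrite nnegrE; [rewrite addr_ge0|nonnegativity].
    rewrite le_eqVlt; apply/orP; left; apply/eqP; rewrite exprMn /P exprD.
    have cK : c ^+ K != 0 by rewrite expf_neq0// gt_eqF.
    have cM : c ^+ M != 0 by rewrite expf_neq0// gt_eqF.
    by field; rewrite cK cM.
  move=> a x aK.
  have ta := Test_iter a tth.
  have stt := Test_Smooth tth.
  rewrite iter_partialCB//; last exact: fejer_sum_Smooth.
  rewrite (fejer_sum_partials c N a tth).
  have br := bracket2_ge1 x; have br0 := bracket2_gt0 x.
  have bP : 1 <= bracket2 x ^+ P by exact: exprn_ege1.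
  have qP0 : 0 <= 3 * Bth * q ^+ P by apply: ltW; positivity.
  have [bx|bx] := pselect (box t0 (c / 4) x).
    rewrite normcB; apply: le_trans (hN a aK x bx) _.
    rewrite mulrAC; apply: ler_peMl; first exact: ltW.
    apply: le_trans bP _; apply: ler_peMl; last by rewrite /D1 lerDl.
    by nonnegativity.
  have cq : c <= q * bracket2 x.
    have [i hi] : exists i, ~ `|x 0 i - t0 0 i| <= c / 4 by apply/existsNP.
    have h1 : c / 4 < `|x 0 i - t0 0 i| by rewrite ltNge; apply/negP.
    have h2 := le_trans (ler_normB (x 0 i) (t0 0 i)) (lerD (coord_le_norm x i) (coord_le_norm t0 i)).
    move: (lt_le_trans h1 h2) (norm_le_bracket2 x) (normr_ge0 x) (normr_ge0 t0); rewrite /q; clear.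
    set A := `|x|; set B := `|t0|; set z := bracket2 x => h1 h2 A0 B0.
    have h3 : A + B <= (1 + B) * (1 + A) by nra.
    have h4 : (1 + B) * (1 + A) <= (1 + B) * (2 * z) by apply: ler_wpM2l => //; lra.
    lra.
  have h3 : normc (iter_partialC a th x - fejer_sum c N (iter_partialC a th) x) <= 3 * Bth.
    apply: le_trans (le_normcD _ _) _; rewrite normcN.
    have b1 y : normc (iter_partialC a th y) <= Bth by exact: hBth.
    have := @fejer_sum_bound R n c N (iter_partialC a th) t0 Bth x N0 c0 (Test_Cc ta) b1.
    have hsup y : iter_partialC a th y != 0 -> box t0 (c / 2) y.
      move=> ay; apply: (@box_incl _ _ _ d); last exact: Test_supp ta ay.
      by move: d4 c1; clear; lra.
    move=> /(_ hsup) h; have -> : 3 * Bth = Bth + 2 * Bth by ring.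
    exact: lerD (b1 x) h.
  apply: le_trans h3 _.
  have : 1 <= (q * bracket2 x / c) ^+ P by apply: exprn_ege1; rewrite ler_pdivlMr// mul1r.
  rewrite exprMn exprMn exprVn => h4.
  rewrite (_ : D1 / c ^+ P * bracket2 x ^+ P = (c ^+ P)^-1 * bracket2 x ^+ P +
    3 * Bth * (q ^+ P * bracket2 x ^+ P / c ^+ P)); last by rewrite /D1; ring.
  apply: le_trans (_ : 3 * Bth * (q ^+ P * bracket2 x ^+ P / c ^+ P) <= _).
    by apply: ler_peMr => //; nonnegativity.
  by rewrite lerDr; nonnegativity.
have sU (p : {ffun 'I_n -> 'I_N * 'I_N}) : Schwartz (fun t => u t * wave (freq c p - xi) t) by exact/Schwartz_mul/wave_bounded.
have [sS ES] := tempered_sum (fun p : {ffun 'I_n -> 'I_N * 'I_N} =>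
   ((N%:R * c) ^- n)%:C%C * fourier th (freq c p)) tf sU.
have hT2 : normc (f (fun t => \sum_(p : {ffun 'I_n -> 'I_N * 'I_N})
    ((N%:R * c) ^- n)%:C%C * fourier th (freq c p) * (u t * wave (freq c p - xi) t)))
    <= Q * 6 ^+ n / c ^+ M.
  rewrite ES; apply: le_trans (normc_sum _ _ _) _.
  have Nc0 : 0 <= (N%:R * c) ^- n by rewrite invr_ge0 exprn_ge0// mulr_ge0// ltW.
  apply: le_trans (_ : \sum_(p : {ffun 'I_n -> 'I_N * 'I_N}) Q / c ^+ M' * ((N%:R * c) ^- n * bracket2 (freq c p) ^- n) <= _).
    apply: ler_sum => p _; rewrite -mulrA normcM normc_real ger0_norm// normcM.
    rewrite [leRHS]mulrCA; apply: ler_wpM2l => //.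
    by have := term c xi (freq c p) c1 hxi; rewrite opprB.
  rewrite -mulr_sumr -mulr_sumr.
  have QM : 0 <= Q / c ^+ M' by apply: ltW; positivity.
  apply: le_trans (ler_wpM2l QM (@fejer_weights R n c N N0 c1)) _.
  rewrite le_eqVlt; apply/orP; left; apply/eqP; rewrite exprMn /M' exprD.
  have cn : c ^+ n != 0 by rewrite expf_neq0// gt_eqF.
  have cM : c ^+ M != 0 by rewrite expf_neq0// gt_eqF.
  by field; rewrite cn cM.
have -> : (fun t => chi t * wave (- xi) t) = (fun t => 1 * (u t * (v t * wave (- xi) t)) +
   \sum_(p : {ffun 'I_n -> 'I_N * 'I_N})
    ((N%:R * c) ^- n)%:C%C * fourier th (freq c p) * (u t * wave (freq c p - xi) t)).
  apply/funext => t; rewrite chiE mul1r.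
  have -> : \sum_(p : {ffun 'I_n -> 'I_N * 'I_N})
      ((N%:R * c) ^- n)%:C%C * fourier th (freq c p) * (u t * wave (freq c p - xi) t) =
     u t * (fejer_sum c N th t * wave (- xi) t).
    rewrite /fejer_sum mulrCA -!mulrA mulr_suml !mulr_sumr; apply: eq_bigr => p _.
    by rewrite waveD; ring.
  by rewrite /v; ring.
rewrite tempered_lin//; last exact: Schwartz_mul su (bounded_mul (bv N c) (wave_bounded _)).
rewrite mul1r; apply: le_trans (le_normcD _ _) _.
by rewrite mulrDl; exact: lerD.
Qed.

End Tempered.

(** * Decay of the localized Fourier transform *)

Section Windows.
Context {R : realType} {n : nat}.
Local Notation V := ('rV[R]_n).
Local Notation C := (R[i]).
Local Notation mu := (lebesgue_tuple n).
Implicit Types (u v w chi : V -> C) (x c xi eta t : V) (i : 'I_n) (f : @functional R n).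

Lemma near_right_ex (P : R -> Prop) : (\forall d \near (0:R)^'+, P d) ->
  exists d, P d /\ 0 < d.
Proof.
move=> h; have hpos : \forall d \near (0:R)^'+, 0 < d by exact: nbhs_right_gt.
have [d [hd d0]] := @filter_ex _ _ (at_right_proper_filter (0:R)) _ (filterI h hpos).
by exists d.
Qed.

Lemma Test_box u c (r : R) : Smooth u -> (forall x, u x != 0 -> box c r x) ->
  Test (box c r) u.
Proof.
move=> su hu.
have cb : closed (box c r) by apply: compact_closed; [exact: norm_hausdorff|exact: compact_box].
have sub := support_set_sub cb hu.
split=> //; apply: subclosed_compact sub; [exact: closed_closure|exact: compact_box].
Qed.

(** On a small box around [x0], [u] is bounded below by a positive constant. *)
Lemma integral_neq0 u x0 : Cc u -> (forall x, exists2 y : R, 0 <= y & u x = y%:C%C) ->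
  u x0 != 0 -> integral_Rn u != 0.
Proof.
move=> cu hu ux0.
have v0 x : 0 <= Re (u x) by have [y y0 ->] := hu x.
have vx0 : 0 < Re (u x0).
  by move: ux0; have [y y0 ->] := hu x0; rewrite -normc_gt0 normc_real ger0_norm.
pose a := Re (u x0) / 2; have a0 : 0 < a by rewrite divr_gt0.
have [cr _] : cont_at x0 u by case: cu.
have /nbhs_ballP[s /= s0 hs] : \forall t \near x0, a < Re (u t).
  apply: (cr [set y | a < y]); apply: open_nbhs_nbhs; split; first exact: open_gt.
  by rewrite /= /a; lra.
have [iu _] := Cc_integrable cu.
have I1 : ((a * s ^+ n)%:E <= \int[mu]_t (Re (u (rowt t)))%:E)%E.
  have mb := @measurable_box R n x0 (s / 2).
  have -> : (a * s ^+ n)%:E = (\int[mu]_t (a%:E * (\1_(@rowt R n @^-1` box x0 (s / 2)) t)%:E))%E.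
    rewrite ge0_integralZl//=; last 2 first.
    - by apply/measurable_EFinP; exact: measurable_indic.
    - by rewrite lee_fin ltW.
    have := integral_indic mu measurableT mb; rewrite setIT => ->.
    have s2 : 0 <= s / 2 by nonnegativity.
    have mbox := @measure_box R n x0 (s / 2) s2.
    by rewrite [X in (_ * X)%E]mbox -EFinM; congr (_ * _ ^+ _)%:E; field.
  apply: ge0_le_integral_nonmeas => t.
    by rewrite -EFinM lee_fin mulr_ge0// ltW.
  rewrite -EFinM lee_fin.
  have [bt|bt] := pselect (box x0 (s / 2) (rowt t)).
    rewrite indicE mem_set// mulr1 ltW//; apply: hs.
    rewrite -ball_normE /= distrC; apply: le_lt_trans (_ : s / 2 < s); last by lra.
    by apply/box_norm => //; rewrite divr_ge0// ltW.
  by rewrite indicE memNset// mulr0.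
have fin : (\int[mu]_t (Re (u (rowt t)))%:E)%E \is a fin_num by exact: integrable_fin_num iu.
have : 0 < Re (integral_Rn u).
  rewrite integral_RnE /= /Rintegral.
  have : (0 < \int[mu]_t (Re (u (rowt t)))%:E)%E.
    by apply: lt_le_trans I1; rewrite lte_fin mulr_gt0// exprn_gt0.
  by move=> h; rewrite fine_gt0// h/= ltey_eq fin.
by move=> h; apply/eqP => e; move: h; rewrite e /= ltxx.
Qed.

Lemma iter_partialCJ a u : Smooth u ->
  iter_partialC a (fun t => (u t)^*%C) = fun t => (iter_partialC a u t)^*%C.
Proof.
move=> su; elim: a => [|i a IH]; first by rewrite !iter_partialC_nil.
apply/funext => x; apply: iter_partialC_cons; rewrite IH.
apply: has_partialJ; rewrite (_ : iter_partialC (i :: a) u x = iter_partialC [:: i] (iter_partialC a u) x).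
  by apply: Smooth_has_partial; exact: Smooth_iter_partial.
by apply: iter_partialC_cons; apply: Smooth_has_partial; exact: Smooth_iter_partial.
Qed.

Lemma bounded_conj u : Bounded_derivatives u -> Bounded_derivatives (fun t => (u t)^*%C).
Proof.
move=> [su hu]; split; first exact: SmoothJ.
by move=> a; have [B hB] := hu a; exists B => x; rewrite iter_partialCJ// normcJ.
Qed.

Lemma window_bounded k (le_kn : (k <= n)%N) (g : 'I_k -> R -> C) (x0 : 'rV[R]_k) :
  (forall j : 'I_k, test_function1 (g j)) ->
  Bounded_derivatives (fun t : V => (tensor g (first_coords le_kn t - x0))^*%C).
Proof.
move=> tg; apply: bounded_conj; rewrite /tensor; apply: bounded_prod => i.
have := pullback_bounded (widen_ord le_kn i) (x0 0 i) 1 (tg i).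
rewrite (_ : (fun t : V => _) = (fun t : V => g i ((first_coords le_kn t - x0) 0 i)))//.
by apply/funext => t; rewrite mul1r !mxE.
Qed.

(** The modulated bump [b wave(t0)] has a Fourier transform that does not vanish at
[t0], while its translates stay in the cone: testing [f] against the product of
the window with that transform is testing the windowed Fourier transform of [f]
inside the cone, where it is a rapidly decreasing function. *)
Lemma window_decay k (le_kn : (k <= n)%N) f (g0 : R -> C) t0 xi0 :
  test_function1 g0 -> g0 0 != 0 ->
  k_directionally_regular le_kn f (first_coords le_kn t0) xi0 -> `|xi0| = 1 ->
  exists2 u, Schwartz u & u t0 != 0 /\ exists e : R, [/\ 0 < e, e <= 1 &
    forall M, exists2 C0 : R, 0 < C0 & forall (c : R) eta, 1 <= c ->
     `|eta - c *: xi0| <= 2 * e * c ->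
     normc (f (fun t => u t * wave (- eta) t)) <= C0 / c ^+ M].
Proof.
move=> tg0 g00 [g [r [Gam [h [tg gn0 r0 [[oG cG] Gxi] [hfun hb]]]]]] xi01.
set x0 := first_coords le_kn t0 in hfun hb *.
have cx0 : cube r x0 x0 by move=> i; rewrite ltrBlDr ltrDl r0.
have /nbhs_ballP[s /= s0 hs] : nbhs xi0 Gam by exact: open_nbhs_nbhs.
pose e := Num.min (s / 4) (1 / 8).
have e0 : 0 < e by rewrite lt_min divr_gt0//=; lra.
have e8 : e <= 1 / 8 by rewrite /e ge_min lexx orbT.
have es : e <= s / 4 by rewrite /e ge_min lexx.
have [b tb [b0 bpos]] := bump_exists (0 : V) tg0 g00 e0.
have [swt _] := wave_partials t0.
pose om t := b t * wave t0 t.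
have tom : Test (box 0 e) om by exact: Test_mulr.
pose W (t : V) := (tensor g (first_coords le_kn t - x0))^*%C.
have bW : Bounded_derivatives W by exact: window_bounded.
pose u t := W t * fourier om t.
have su : Schwartz u.
  rewrite (_ : u = fun t => fourier om t * W t); last by apply/funext => t; rewrite mulrC.
  exact: Schwartz_mul (fourier_Schwartz tom) bW.
exists u => //; split.
  apply: mulf_neq0.
    by rewrite /W subrr -normc_gt0 normcJ normc_gt0.
  rewrite fourierE (_ : (fun t => _) = b).
    exact: integral_neq0 (Test_Cc tb) bpos b0.
  apply/funext => t; rewrite /om mulrCA -waveD addNr wave0 mulr1//.
exists e; split => //; first lra.
move=> M.
have [CN CN0 hCN] := hb (2 * M)%N.
have [Bom Bom0 hBom] := bounded_unif (Schwartz_bounded (Test_Schwartz tom)) 0%N.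
have {}hBom x : normc (om x) <= Bom by rewrite -[om]iter_partialC_nil; exact: hBom.
exists (2 * (CN * 4 ^+ M * Bom * (2 * e) ^+ n)); first by positivity.
move=> c eta c1 heta; have c0 : 0 < c by lra.
pose oms t := om (t - eta).
have inG y : box eta e y -> `|y - c *: xi0| <= 3 * e * c.
  move=> /(box_norm _ _ (ltW e0)) hy.
  rewrite -(subrK eta y) -addrA; apply: le_trans (ler_normD _ _) _; nra.
have subG : box eta e `<=` Gam.
  move=> y /inG hy; have -> : y = c *: (c^-1 *: y) by rewrite scalerA divff ?gt_eqF// scale1r.
  apply: cG => //; apply: hs; rewrite -ball_normE /=.
  rewrite -(ltr_pM2l c0) -[X in X * `|_|]gtr0_norm// -normrZ scalerBr scalerA divff ?gt_eqF// scale1r distrC.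
  apply: le_lt_trans hy _; nra.
have toms : Test (box eta e) oms.
  apply: Test_box; first exact: Smooth_shift (Test_Smooth tom).
  move=> x /(Test_supp tom) bx i; have := bx i; by rewrite !mxE subr0.
have -> : f (fun t => u t * wave (- eta) t) = DS le_kn g f x0 oms.
  rewrite /DS /fourier_distr /mul_distr; congr f; apply/funext => t.
  by rewrite (fourier_shift eta (Test_Cc tom)) /u -/(W t) mulrAC mulrA.
have [_ ->] := hfun _ cx0; last by apply/TestP; exact: TestW toms.
have -> : 2 * (CN * 4 ^+ M * Bom * (2 * e) ^+ n) / c ^+ M =
   2 * (CN * 4 ^+ M * Bom / c ^+ M * (2 * e) ^+ n) by ring.
apply: (@integral_box_bound _ _ _ eta).
- exact: ltW.
- by nonnegativity.
- move=> y; have [->|nz] := eqVneq (oms y) 0.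
    by rewrite mulr0 normc0; nonnegativity.
  have by' := Test_supp toms nz.
  have y3 := inG y by'.
  have hy := hCN x0 y cx0 (subG y by').
  rewrite normcM; apply: le_trans (_ : (CN / bracket2 y ^+ M) * Bom <= _).
    apply: ler_pM; rewrite ?normc_ge0//; last exact: hBom.
    apply: le_trans hy _; rewrite natrM mulrAC divff// mul1r powRN powR_mulrn//.
    exact/ltW/bracket2_gt0.
  have yc : c / 2 <= `|y|.
    have := ler_distD y (c *: xi0) 0; rewrite !subr0 normrZ xi01 mulr1 gtr0_norm// distrC.
    nra.
  have yb : c / 4 <= bracket2 y by have := norm2_le_bracket2 y; nra.
  have -> : CN * 4 ^+ M * Bom / c ^+ M = CN * (4 ^+ M / c ^+ M) * Bom by ring.
  apply: ler_wpM2r; first exact: ltW.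
  apply: ler_wpM2l; first exact: ltW.
  have -> : 4 ^+ M / c ^+ M = ((c / 4) ^+ M)^-1.
    by rewrite exprMn exprVn invfM invrK mulrC.
  rewrite lef_pV2 ?posrE; last 2 first.
  - exact/exprn_gt0/bracket2_gt0.
  - by positivity.
  apply: lerXn2r => //; rewrite nnegrE; first by nonnegativity.
  exact/ltW/bracket2_gt0.
- by move=> y; rewrite mulf_eq0 negb_or => /andP[_ /(Test_supp toms)].
Qed.

Lemma compact_sphere : compact [set x : V | `|x| = 1].
Proof.
apply: (@subclosed_compact _ _ (box 0 1)); last 2 first.
- exact: compact_box.
- by move=> x /= x1 i; rewrite mxE subr0 -x1 coord_le_norm.
rewrite (_ : [set x | _] = (fun x : V => `|x|) @^-1` [set 1 : R])//.
by apply: closed_comp; [move=> x _; exact: norm_continuous|exact: closed_eq].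
Qed.

Definition decays_near f t0 (d e : R) xi0 := forall chi, Test (box t0 d) chi ->
  forall M, exists2 C0 : R, 0 < C0 & forall (c : R) xi, 1 <= c ->
    `|xi - c *: xi0| <= e * c ->
    normc (f (fun t => chi t * wave (- xi) t)) <= C0 / c ^+ M.

(** Compactness of the sphere of directions is used twice: for the size of the
neighbourhood of [t0], and then, [chi] and [M] being fixed, for the constant. *)
Lemma decay_all_directions f t0 :
  (forall xi0, `|xi0| = 1 -> exists2 d : R, 0 < d & exists2 e : R, 0 < e & decays_near f t0 d e xi0) ->
  exists2 d : R, 0 < d & forall chi, Test (box t0 d) chi -> forall M,
    exists2 C0 : R, 0 < C0 & forall xi, 1 <= `|xi| ->
      normc (f (fun t => chi t * wave (- xi) t)) <= C0 / `|xi| ^+ M.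
Proof.
move=> hf.
have shrink d d' e xi0 xi1 : d' <= d -> `|xi1 - xi0| < e / 2 ->
    decays_near f t0 d e xi0 -> decays_near f t0 d' (e / 2) xi1.
  move=> dd xx h chi tchi M.
  have [|C0 C00 hC] := h chi _ M; first by apply: TestW tchi => x; exact: box_incl.
  exists C0 => // c xi c1 hxi; apply: hC => //.
  have c0 : 0 < c by lra.
  have -> : xi - c *: xi0 = (xi - c *: xi1) + c *: (xi1 - xi0).
    by rewrite scalerBr addrA subrK.
  apply: le_trans (ler_normD _ _) _; rewrite normrZ gtr0_norm//; nra.
have [d [hd d0]] : exists d : R, (forall xi1, `|xi1| = 1 -> exists2 e : R, 0 < e & decays_near f t0 d e xi1) /\ 0 < d.
  have /compact_near_coveringP K := compact_sphere.
  have : \forall d \near (0:R)^'+, [set x : V | `|x| = 1] `<=`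
      (fun xi1 => exists2 e : R, 0 < e & decays_near f t0 d e xi1).
    apply: K => xi0 /= /hf[d d0 [e e0 h]].
    exists (ball xi0 (e / 2), [set d' | d' < d]) => /=.
      by split; [apply: nbhsx_ballx; rewrite divr_gt0|exact: nbhs_right_lt].
    move=> [xi1 d'] /= [x01 dd]; exists (e / 2); first by rewrite divr_gt0.
    apply: shrink h; first exact: ltW.
    by move: x01; rewrite -ball_normE /= distrC.
  exact: near_right_ex.
exists d => // chi tchi M.
have /compact_near_coveringP K := compact_sphere.
have : \forall C0 \near +oo, [set x : V | `|x| = 1] `<=`
    (fun xi1 => forall c : R, 1 <= c ->
       normc (f (fun t => chi t * wave (- (c *: xi1)) t)) <= C0 / c ^+ M).
  apply: K => xi0 /= /hd[e e0 h]; have [C0 C00 hC] := h chi tchi M.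
  exists (ball xi0 e, [set C1 | C0 < C1]) => /=.
    by split; [exact: nbhsx_ballx|exact: (nbhs_pinfty_gt (num_real C0))].
  move=> [xi1 C1] /= [x01 CC] c c1; have c0 : 0 < c by lra.
  apply: le_trans (hC c _ c1 _) _.
    rewrite -scalerBr normrZ gtr0_norm// mulrC ler_wpM2r// ltW//.
    by move: x01; rewrite -ball_normE /= distrC.
  by apply: ler_wpM2r; [nonnegativity|exact: ltW].
move=> h; have [C0 [hC C00]] := filter_ex (filterI h (nbhs_pinfty_gt (num_real (0 : R)))).
exists C0 => // xi xi1; have x0 : 0 < `|xi| by lra.
have E : xi = `|xi| *: (`|xi|^-1 *: xi) by rewrite scalerA divff ?gt_eqF// scale1r.
rewrite {1}E; apply: hC => //=.
by rewrite normrZ gtr0_norm ?invr_gt0// mulVf// gt_eqF.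
Qed.

(** The frequencies smaller than one are handled by [tempered_wave_bound]. *)
Lemma decay_bracket2 f t0 d : tempered f ->
  (forall chi, Test (box t0 d) chi -> forall M,
    exists2 C0 : R, 0 < C0 & forall xi, 1 <= `|xi| ->
      normc (f (fun t => chi t * wave (- xi) t)) <= C0 / `|xi| ^+ M) ->
  forall chi, Test (box t0 d) chi -> forall M,
    exists2 C0 : R, 0 < C0 & forall xi,
      normc (f (fun t => chi t * wave (- xi) t)) <= C0 / bracket2 xi ^+ M.
Proof.
move=> tf h chi tchi M.
have [C1 C10 h1] := h chi tchi (2 * M)%N.
have [K hK] := tempered_wave_bound tf.
have [C2 C20 h2] := hK chi 0%N (Test_Schwartz tchi).
have n0 : 0 <= n%:R :> R by [].
have n1 : 0 < 1 + n%:R :> R by lra.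
have brn xi : bracket2 xi <= 1 + n%:R * `|xi| ^+ 2.
  by rewrite /bracket2 lerD2l; have := dotp_le_norm xi xi; rewrite -expr2; have := ler_norm (dotp xi xi); lra.
exists ((C1 + C2 * 2 ^+ K) * (1 + n%:R) ^+ M); first by positivity.
move=> xi; have b0 := bracket2_gt0 xi.
have [x1|x1] := leP 1 `|xi|.
  apply: le_trans (h1 xi x1) _.
  apply: le_trans (_ : C1 * (1 + n%:R) ^+ M / bracket2 xi ^+ M <= _); last first.
    apply: ler_wpM2r; first by nonnegativity.
    apply: ler_wpM2r; first by nonnegativity.
    by rewrite lerDl; nonnegativity.
  rewrite -mulrA; apply: ler_wpM2l; first exact: ltW.
  have x0 : 0 < `|xi| by lra.
  rewrite exprM -[leLHS]mul1r ler_pdivrMr; last by positivity.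
  rewrite mulrAC ler_pdivlMr; last by positivity.
  rewrite mul1r -exprMn; apply: lerXn2r; rewrite ?nnegrE; [nonnegativity|nonnegativity|].
  apply: le_trans (brn xi) _; nra.
apply: le_trans (_ : C2 * 2 ^+ K <= _).
  have := h2 (fun=> 1) 1 (- xi) (bounded_cst 1) ltr01; rewrite mulr1 normrN.
  rewrite (_ : (fun t => chi t * (1 * _)) = fun t => chi t * wave (- xi) t); last first.
    by apply/funext => t; rewrite mul1r.
  move=> h3; apply: le_trans (h3 _) _.
    by move=> a x _; rewrite expr0 mulr1; exact: normc_partials_cst1.
  apply: ler_wpM2l; first exact: ltW.
  by apply: lerXn2r; rewrite ?nnegrE//; have := normr_ge0 xi; lra.
apply: le_trans (_ : C2 * 2 ^+ K * (1 + n%:R) ^+ M / bracket2 xi ^+ M <= _); last first.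
  apply: ler_wpM2r; first by nonnegativity.
  apply: ler_wpM2r; first by nonnegativity.
  by rewrite lerDr; nonnegativity.
rewrite -mulrA; apply: ler_peMr; first by nonnegativity.
rewrite ler_pdivlMr; last by positivity.
rewrite mul1r; apply: lerXn2r; rewrite ?nnegrE; [nonnegativity|nonnegativity|].
apply: le_trans (brn xi) _; have := normr_ge0 xi => x0.
have : `|xi| ^+ 2 <= 1 by nra.
nra.
Qed.

End Windows.

(** * A smooth representative near a point *)

Section UltraLimits.
Context {R : realType}.
Local Notation C := (R[i]).
Context (U : set_system nat) {UU : UltraFilter U}.
Implicit Types (z w : nat -> C).

Definition ulim z (l : C) := forall e : R, 0 < e -> \forall N \near U, normc (z N - l) <= e.

(** An ultrafilter contains the preimage of every neighbourhood of a cluster point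
of its image in a compact interval. *)
Lemma ulim_exists z (B : R) : (forall N, normc (z N) <= B) -> exists l, ulim z l.
Proof.
have real (s : nat -> R) : (forall N, `|s N| <= B) ->
    exists l, forall e : R, 0 < e -> \forall N \near U, `|s N - l| <= e.
  move=> sB.
  have UsB : (s @ U) `[- B, B]%classic.
    rewrite /fmap /= (_ : _ @^-1` _ = setT); first exact: (@filterT _ U _).
    by apply/seteqP; split => // N _; rewrite /= in_itv/= -ler_norml; exact: sB.
  have [l [_ sl]] := @segment_compact R (- B) B (s @ U) _ UsB.
  exists l => e e0; have hball : nbhs l (ball l e) by exact: nbhsx_ballx.
  have [h|h] := in_ultra_setVsetC (s @^-1` ball l e) UU.
    by apply: (@filterS _ U _ _ _ _ h) => N; rewrite /= -ball_normE /= distrC => /ltW.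
  have h' : (s @ U) (~` ball l e) by [].
  by have [y [/= nb yb]] := sl _ _ h' hball.
move=> zB.
have [N|a ha] := real (fun N => Re (z N)); first exact: le_trans (Re_le_normc _) (zB N).
have [N|b hb] := real (fun N => Im (z N)); first exact: le_trans (Im_le_normc _) (zB N).
exists (a +i* b)%C => e e0; have e2 : 0 < e / 2 by rewrite divr_gt0.
apply: (@filterS _ U _ _ _ _ (@filterI _ U _ _ _ (ha _ e2) (hb _ e2))) => N [h1 h2].
apply: le_trans (normc_le_ReIm _) _; rewrite cReD cImD cReN cImN /=; lra.
Qed.

Lemma ulim_lin z w (l m k : C) : ulim z l -> ulim w m ->
  ulim (fun N => z N - k * w N) (l - k * m).
Proof.
move=> hz hw e e0; have e2 : 0 < e / 2 by rewrite divr_gt0.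
have k0 : 0 < normc k + 1 by have := normc_ge0 k; lra.
have e3 : 0 < e / 2 / (normc k + 1) by rewrite divr_gt0.
apply: (@filterS _ U _ _ _ _ (@filterI _ U _ _ _ (hz _ e2) (hw _ e3))) => N [h1 h2].
have -> : z N - k * w N - (l - k * m) = (z N - l) - k * (w N - m) by ring.
apply: le_trans (le_normcD _ _) _; rewrite normcN normcM.
move: h2; rewrite ler_pdivlMr// => h2.
have := normc_ge0 (w N - m); lra.
Qed.

Lemma ulim_bound z (l : C) (B : R) : ulim z l -> (forall N, normc (z N) <= B) -> normc l <= B.
Proof.
move=> hz zB; rewrite leNgt; apply/negP => h.
have e0 : 0 < (normc l - B) / 2 by rewrite divr_gt0// subr_gt0.
have [N hN] := filter_ex (hz _ e0).
have := le_normcD (l - z N) (z N); rewrite subrK normcB; have := zB N; lra.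
Qed.

End UltraLimits.

Section LocalRepresentative.
Context {R : realType} {n : nat}.
Local Notation V := ('rV[R]_n).
Local Notation C := (R[i]).
Implicit Types (u v w chi psi : V -> C) (x c xi eta t : V) (i : 'I_n) (f : @functional R n).

(** Fejer weighted sum of the coefficients [c] over the lattice of integral
frequencies. *)
Definition lattice_sum N (c : V -> C) : C :=
  (N.+1%:R ^- n)%:C%C *
  \sum_(p : {ffun 'I_n -> 'I_N.+1 * 'I_N.+1}) c (- freq 1 p).

Lemma lattice_sum_bound N (c : V -> C) (A : R) : 0 <= A ->
  (forall m, normc (c m) <= A / bracket2 m ^+ n) -> normc (lattice_sum N c) <= A * 6 ^+ n.
Proof.
move=> A0 hc; rewrite /lattice_sum normcM normc_real ger0_norm ?invr_ge0 ?exprn_ge0//.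
have := @fejer_weights R n 1 N.+1 (ltn0Sn N) (lexx 1); rewrite !mulr1 => h.
apply: le_trans (ler_wpM2l A0 h).
rewrite mulrCA; apply: ler_wpM2l; first by rewrite invr_ge0 exprn_ge0.
apply: le_trans (normc_sum _ _ _) _; rewrite mulr_sumr; apply: ler_sum => p _.
by apply: le_trans (hc _) _; rewrite /bracket2 dotpNl dotpNr opprK.
Qed.

Context (v : V -> C) (v_decay : forall M, exists2 C0 : R, 0 < C0 &
  forall xi, normc (v xi) <= C0 / bracket2 xi ^+ M).

Lemma lattice_decay_bound k : exists2 C0 : R, 0 < C0 & forall N (E : V -> C) (A : R),
  0 <= A -> (forall m, normc (E m) <= A * bracket2 m ^+ k) ->
  normc (lattice_sum N (fun m => v m * E m)) <= C0 * A.
Proof.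
have [C0 C00 h] := v_decay (n + k)%N.
exists (C0 * 6 ^+ n); first by positivity.
move=> N E A A0 hE; rewrite mulrAC; apply: lattice_sum_bound.
  by rewrite mulr_ge0// ltW.
move=> m; have b0 := bracket2_gt0 m.
rewrite normcM; apply: le_trans (ler_pM (normc_ge0 _) (normc_ge0 _) (h m) (hE m)) _.
rewrite le_eqVlt; apply/orP; left; apply/eqP; rewrite exprD.
have bn : bracket2 m ^+ n != 0 by rewrite expf_neq0// gt_eqF.
have bk : bracket2 m ^+ k != 0 by rewrite expf_neq0// gt_eqF.
by field; rewrite bn bk.
Qed.

(** The derivative of multi-index [a] of the Fejer mean of the Fourier series with
coefficients [v]. *)
Definition synthesis N a x : C :=
  lattice_sum N (fun m => v m * (wave_coef m a * wave m x)).

Lemma lattice_sum_comb N (E E' : V -> C) (k : C) :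
  lattice_sum N (fun m => v m * E m) - k * lattice_sum N (fun m => v m * E' m) =
  lattice_sum N (fun m => v m * (E m - k * E' m)).
Proof.
rewrite /lattice_sum mulrCA -mulrBr; congr (_ * _).
by rewrite mulr_sumr -sumrB; apply: eq_bigr => p _; ring.
Qed.

Let kap : R := 2 * (1 + 2 * pi).
Let kap0 : 0 < kap. Proof. by have := @pi_gt0 R; rewrite /kap; lra. Qed.

Let kap_norm (m : V) : 1 + 2 * pi * `|m| <= kap * bracket2 m.
Proof.
have := norm_le_bracket2 m; have := @pi_gt0 R; have := normr_ge0 m; rewrite /kap.
have := bracket2_ge1 m; nra.
Qed.

Let kap_coef (m : V) a : normc (wave_coef m a) <= kap ^+ size a * bracket2 m ^+ size a.
Proof.
apply: le_trans (wave_coef_le m a) _; rewrite -exprMn.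
have := @pi_gt0 R; have := normr_ge0 m; have := kap_norm m => h h1 h2.
by apply: lerXn2r => //; rewrite nnegrE; nra.
Qed.

Lemma synthesis_bound a : exists2 B : R, 0 < B & forall N x, normc (synthesis N a x) <= B.
Proof.
have [C0 C00 h] := lattice_decay_bound (size a).
exists (C0 * kap ^+ size a); first by positivity.
move=> N x; apply: h; first by nonnegativity.
by move=> m; rewrite normcM normc_wave mulr1.
Qed.

Lemma synthesis_lip a : exists2 B : R, 0 < B & forall N x y,
  normc (synthesis N a x - synthesis N a y) <= B * `|x - y|.
Proof.
have [C0 C00 h] := lattice_decay_bound (size a).+1.
have p0 := @pi_gt0 R; have n0 : 0 <= n%:R :> R by [].
have q0 : 0 < 1 + n%:R :> R by lra.
exists (C0 * (kap ^+ size a * (4 * pi * (1 + n%:R) * kap))); first by positivity.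
move=> N x y; rewrite -[synthesis N a y]mul1r /synthesis lattice_sum_comb -mulrA.
apply: h.
  by apply: mulr_ge0 => //; nonnegativity.
move=> m; rewrite mul1r -mulrBr normcM.
apply: le_trans (ler_pM (normc_ge0 _) (normc_ge0 _) (kap_coef m a) (wave_lip m x y)) _.
rewrite exprS; have b0 := bracket2_gt0 m.
rewrite (_ : _ * `|x - y| * _ = kap ^+ size a * bracket2 m ^+ size a *
  (4 * pi * (1 + n%:R) * (kap * bracket2 m) * `|x - y|)); last by ring.
apply: ler_wpM2l; first by nonnegativity.
apply: ler_wpM2r => //.
have := kap_norm m; have := normr_ge0 m; set M := `|m|; set K := kap * _ => M0 hK.
have hM : M <= K by apply: le_trans hK; have := @pi_ge2 R; nra.
rewrite -!mulrA; do 2 (apply: ler_wpM2l; first nra).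
apply: ler_pM => //; lra.
Qed.

Lemma synthesis_taylor a i : exists2 B : R, 0 < B & forall N x (h : R),
  normc (synthesis N a (x + h *: delta_mx 0 i) - synthesis N a x -
    h%:C%C * synthesis N (i :: a) x) <= B * h ^+ 2.
Proof.
have [C0 C00 hC] := lattice_decay_bound (size a).+2.
exists (C0 * (kap ^+ size a * (2 * kap ^+ 2))); first by positivity.
move=> N x h; rewrite -[synthesis N a x]mul1r /synthesis !lattice_sum_comb -mulrA.
apply: hC; first by apply: mulr_ge0; [nonnegativity|exact: sqr_ge0].
move=> m.
have -> : wave_coef m a * wave m (x + h *: delta_mx 0 i) - 1 * (wave_coef m a * wave m x) -
   h%:C%C * (wave_coef m (i :: a) * wave m x) =
   wave_coef m a * (wave m (x + h *: delta_mx 0 i) - wave m x -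
     h%:C%C * ('i%C * (2 * pi * m 0 i)%:C%C * wave m x)).
  by rewrite /wave_coef big_cons; ring.
rewrite normcM.
apply: le_trans (ler_pM (normc_ge0 _) (normc_ge0 _) (kap_coef m a) (wave_taylor m x i h)) _.
have b0 := bracket2_gt0 m.
rewrite (_ : _ * h ^+ 2 * _ = kap ^+ size a * bracket2 m ^+ size a *
  (2 * (kap * bracket2 m) ^+ 2 * h ^+ 2)); last by rewrite !exprS; ring.
apply: ler_wpM2l; first by nonnegativity.
apply: ler_wpM2r; first exact: sqr_ge0.
apply: ler_wpM2l => //.
have hm : `|2 * pi * m 0 i| <= kap * bracket2 m.
  have p0 := @pi_gt0 R.
  rewrite normrM gtr0_norm ?mulr_gt0//; apply: le_trans (kap_norm m).
  have := coord_le_norm m i; nra.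
rewrite -[leLHS]real_normK ?num_real//.
by apply: lerXn2r; rewrite ?nnegrE//; nonnegativity.
Qed.

(** The Fejer sums of the Fourier series have equibounded derivatives; a limit
along an ultrafilter inherits all the estimates, so it is smooth. *)
Lemma synthesis_limit : exists2 F, Smooth F & exists2 U : set_system nat,
  ProperFilter U /\ \oo `<=` U & forall e : R, 0 < e -> forall c (r : R),
    \forall N \near U, forall x, box c r x -> normc (synthesis N [::] x - F x) <= e.
Proof.
have [U [UU sub]] := @ultraFilterLemma nat \oo eventually_filter.
have lims a x : exists l, ulim U (fun N => synthesis N a x) l.
  by have [B _ hB] := synthesis_bound a; apply: (ulim_exists (B := B)) => N.
pose G a x := projT1 (cid (lims a x)).
have hG a x : ulim U (fun N => synthesis N a x) (G a x) by exact: projT2 (cid (lims a x)).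
have lipG a : exists2 B : R, 0 < B & forall x y, normc (G a x - G a y) <= B * `|x - y|.
  have [B B0 hB] := synthesis_lip a; exists B => // x y.
  have := @ulim_lin R U UU _ _ _ _ 1 (hG a x) (hG a y); rewrite mul1r => h.
  by apply: (ulim_bound h) => N; rewrite mul1r; exact: hB.
have [||sG _] := @smooth_family R n G.
- by move=> a; have [B _ hB] := lipG a; exists B.
- move=> a i; have [B _ hB] := synthesis_taylor a i; exists B => x h.
  have h1 := @ulim_lin R U UU _ _ _ _ 1 (hG a (x + h *: delta_mx 0 i)) (hG a x).
  have := @ulim_lin R U UU _ _ _ _ h%:C%C h1 (hG (i :: a) x); rewrite mul1r => h2.
  by apply: (ulim_bound h2) => N; rewrite mul1r; exact: hB.
exists (G [::]) => //; exists U; first by split => //; exact: ultra_proper.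
move=> e e0 c r.
have [B1 B10 lip1] := lipG [::]; have [B2 B20 lip2] := synthesis_lip [::].
have K := @compact_box R n c r.
move: K => /compact_near_coveringP K.
apply: (K _ U (fun N x => normc (synthesis N [::] x - G [::] x) <= e)) => x _.
pose s := e / 2 / (B1 + B2).
have B12 : 0 < B1 + B2 by lra.
have s0 : 0 < s by rewrite divr_gt0// divr_gt0.
have e2 : 0 < e / 2 by rewrite divr_gt0.
exists (ball x s, [set N | normc (synthesis N [::] x - G [::] x) <= e / 2]) => /=.
  by split; [exact: nbhsx_ballx|exact: hG].
move=> [x' N] /= [xx hN].
have xs : `|x' - x| * (B1 + B2) <= e / 2.
  by move: xx; rewrite -ball_normE /= distrC ltr_pdivlMr// => /ltW.
have -> : synthesis N [::] x' - G [::] x' = (synthesis N [::] x' - synthesis N [::] x) +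
   ((synthesis N [::] x - G [::] x) + (G [::] x - G [::] x')) by ring.
apply: le_trans (le_normcD _ _) _.
have h1 := lip2 N x' x; have h2 := lip1 x x'; rewrite distrC in h2.
have := le_normcD (synthesis N [::] x - G [::] x) (G [::] x - G [::] x').
lra.
Qed.

End LocalRepresentative.

Section LocalSmoothness.
Context {R : realType} {n : nat}.
Local Notation V := ('rV[R]_n).
Local Notation C := (R[i]).
Implicit Types (u v w chi psi F G : V -> C) (x c xi eta t : V) (i : 'I_n) (f : @functional R n).

(** Only the values of [v] on the support of [chi] matter: Fejer sums, which are
periodic, approximate a function there but not globally. *)
Lemma tempered_local_bound f chi t0 d : tempered f -> Test (box t0 d) chi ->
  exists K, exists2 C0 : R, 0 < C0 & forall v (D : R), Smooth v -> 0 < D ->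
    (forall a x, (size a <= K)%N -> box t0 d x -> normc (iter_partialC a v x) <= D) ->
    normc (f (fun t => chi t * v t)) <= C0 * D.
Proof.
move=> tf tchi; have [K [C1 [C10 hK]]] := tempered_bound tf.
have [B B0 hB] := Schwartz_unif (Test_Schwartz tchi) K K.
exists K, (C1 * (2 ^+ K * B)); first by positivity.
move=> v D sv D0 hv.
have tcv : Test (box t0 d) (fun t => chi t * v t) by exact: Test_mulr.
rewrite -mulrA; apply: hK; [exact: Test_Schwartz tcv|by positivity|].
move=> a x aK; have b0 := bracket2_gt0 x.
have [bx|bx] := pselect (box t0 d x); last first.
  rewrite iter_partialC_supp ?normc0 ?mulr0; first by nonnegativity.
  by move=> hx; apply: bx; case: tcv => _ _; apply.
have hBx b : (size b <= K)%N -> normc (iter_partialC b chi x) <= B / bracket2 x ^+ K.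
  by move=> bK; rewrite ler_pdivlMr ?exprn_gt0// mulrC; exact: hB.
have := leibniz_bound (Test_Smooth tchi) sv hBx (fun b bK => hv b x bK bx) aK.
move=> h; rewrite -ler_pdivlMl ?exprn_gt0//; apply: le_trans h _.
by rewrite le_eqVlt; apply/orP; left; apply/eqP; ring.
Qed.

(** Both sides are the same finite sum, since the coefficient at [- m] is the value
of [f] at [chi] times the wave of frequency [m]. *)
Lemma integral_synthesis f chi psi N U U' : tempered f -> Test U chi -> Test U' psi ->
  integral_Rn (fun t => synthesis (fun xi => f (fun t => chi t * wave (- xi) t)) N [::] t * psi t) =
  f (fun t => chi t * fejer_sum 1 N.+1 psi t).
Proof.
move=> tf tchi tpsi; set v := fun xi => f _.
pose k (p : {ffun 'I_n -> 'I_N.+1 * 'I_N.+1}) : C := (N.+1%:R ^- n)%:C%C * v (- freq 1 p).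
pose F (p : {ffun 'I_n -> 'I_N.+1 * 'I_N.+1}) t := wave (- freq 1 p) t * psi t.
have cF p : Cc (F p) by apply: Cc_wave; exact: Test_Cc tpsi.
have [_ E] := integral_sum k cF.
have -> : (fun t => synthesis v N [::] t * psi t) = (fun t => \sum_p k p * F p t).
  apply/funext => t; rewrite /synthesis /lattice_sum -mulrA mulr_suml mulr_sumr.
  by apply: eq_bigr => p _; rewrite /wave_coef big_nil /k /F; ring.
rewrite E.
pose k' (p : {ffun 'I_n -> 'I_N.+1 * 'I_N.+1}) : C := (N.+1%:R ^- n)%:C%C * fourier psi (freq 1 p).
pose F' (p : {ffun 'I_n -> 'I_N.+1 * 'I_N.+1}) t := chi t * wave (freq 1 p) t.
have sF p : Schwartz (F' p).
  by apply: Schwartz_mul; [exact: Test_Schwartz tchi|exact: wave_bounded].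
have [_ E'] := tempered_sum k' tf sF.
have -> : (fun t => chi t * fejer_sum 1 N.+1 psi t) = (fun t => \sum_p k' p * F' p t).
  apply/funext => t; rewrite /fejer_sum mulr1 !mulr_sumr.
  by apply: eq_bigr => p _; rewrite /k' /F'; ring.
rewrite E'; apply: eq_bigr => p _; rewrite /k /k' /F -fourierE /v opprK /F'.
by rewrite mulrAC.
Qed.

(** Near the support of [psi] the Fejer sums [T psi] of period one converge to
[psi] with all derivatives, and testing [chi f] against [T psi] only involves
the Fourier coefficients of [chi f]: hence [chi f] is the sum of its Fourier
series. *)
Lemma local_representative f chi t0 d : tempered f -> 0 < d -> d <= 1 / 4 ->
  Test (box t0 d) chi ->
  (forall M, exists2 C0 : R, 0 < C0 & forall xi,
     normc (f (fun t => chi t * wave (- xi) t)) <= C0 / bracket2 xi ^+ M) ->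
  exists2 F, Smooth F & forall psi, Test (box t0 d) psi ->
    f (fun t => chi t * psi t) = integral_Rn (fun t => F t * psi t).
Proof.
move=> tf d0 d4 tchi decay; pose v xi := f (fun t => chi t * wave (- xi) t).
have [F sF [U [pU subU] hU]] := synthesis_limit decay.
exists F => // psi tpsi.
have [K [C0 C00 hC]] := tempered_local_bound tf tchi.
have [B B0 hB] := bounded_unif (Schwartz_bounded (Test_Schwartz tpsi)) 0%N.
have {}hB x : normc (psi x) <= B by rewrite -[psi]iter_partialC_nil; exact: hB.
pose A := C0 + 2 * (B * (2 * d) ^+ n).
have A0 : 0 < A by rewrite /A; positivity.
suff H (e : R) : 0 < e -> normc (f (fun t => chi t * psi t) - integral_Rn (fun t => F t * psi t)) <= A * e.
  apply/eqP; rewrite -subr_eq0 -normc_eq0 eq_le normc_ge0 andbT leNgt; apply/negP => h.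
  set z := normc _ in H h; have := H (z / A / 2); rewrite !divr_gt0// => /(_ isT).
  rewrite (_ : A * _ = z / 2); last by field; rewrite gt_eqF.
  lra.
move=> e0.
have fej : \forall N \near \oo, forall a : seq 'I_n, (size a <= K)%N -> forall x, box t0 d x ->
    normc (fejer_sum 1 N.+1 (iter_partialC a psi) x - iter_partialC a psi x) <= e.
  apply: near_seq_size => a.
  have ta := Test_iter a tpsi.
  have [||N1 hN1] := @fejer_sum_cvg R n 1 (iter_partialC a psi) t0 e ltr01 (Test_Cc ta).
  - move=> x ax; apply: (@box_incl _ _ _ d); first lra.
    exact: Test_supp ta ax.
  - exact: e0.
  - exists N1 => // N /= NN1 x bx; apply: hN1; first by rewrite ltnS.
    by apply: box_incl bx; lra.
have [N [h1 h2]] := @filter_ex _ _ pU _ (@filterI _ U _ _ _ (subU _ fej) (hU e e0 t0 d)).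
have sT := fejer_sum_Smooth 1 N.+1 psi.
rewrite -(subrK (f (fun t => chi t * fejer_sum 1 N.+1 psi t)) (f _)) -addrA.
apply: le_trans (le_normcD _ _) _; rewrite /A mulrDl; apply: lerD.
  have tT : Test (box t0 d) (fun t => chi t * fejer_sum 1 N.+1 psi t) by exact: Test_mulr.
  have tP : Test (box t0 d) (fun t => chi t * psi t) by exact: Test_mulr tchi (Test_Smooth tpsi).
  rewrite -temperedB; [|exact: tf|exact: Test_Schwartz tP|exact: Test_Schwartz tT].
  rewrite (_ : (fun t => _) = fun t => chi t * (psi t - fejer_sum 1 N.+1 psi t)); last first.
    by apply/funext => t; rewrite mulrBr.
  apply: hC; [exact: SmoothB (Test_Smooth tpsi) sT|exact: e0|].
  move=> a x aK bx; rewrite iter_partialCB//; last exact: Test_Smooth tpsi.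
  by rewrite (fejer_sum_partials 1 N.+1 a tpsi) normcB; exact: h1.
rewrite -(integral_synthesis N tf tchi tpsi) -/v.
have cs : Cc (fun t => synthesis v N [::] t * psi t).
  apply: Cc_mul (Test_Cc tpsi) => x; apply: Smooth_cont.
  apply: SmoothZ; apply: Smooth_sum => p; apply: SmoothZ; apply: SmoothZ.
  by have [] := wave_partials (- @freq R n 1 N.+1 p).
have cF : Cc (fun t => F t * psi t).
  by apply: Cc_mul (Test_Cc tpsi) => x; exact: Smooth_cont.
have := integral_lin (-1) cF cs; rewrite mulN1r addrC => <-.
have -> : 2 * (B * (2 * d) ^+ n) * e = 2 * ((e * B) * (2 * d) ^+ n) by ring.
apply: (@integral_box_bound _ _ _ t0).
- exact: ltW.
- by nonnegativity.
- move=> x; rewrite (_ : _ + _ = (synthesis v N [::] x - F x) * psi x); last by ring.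
  have [->|px] := eqVneq (psi x) 0; first by rewrite mulr0 normc0; nonnegativity.
  rewrite normcM; apply: ler_pM; rewrite ?normc_ge0//.
  by apply: h2; exact: Test_supp tpsi px.
- move=> x; have [->|px _] := eqVneq (psi x) 0; last exact: Test_supp tpsi px.
  by rewrite !mulr0 addr0 eqxx.
Qed.

(** On a neighbourhood of [t0] the cut-off [chi] is removed by division. *)
Lemma local_smooth k (le_kn : (k <= n)%N) f (g0 : R -> C) t0 :
  test_function1 g0 -> g0 0 != 0 -> tempered f ->
  (forall xi, xi != 0 -> k_directionally_regular le_kn f (first_coords le_kn t0) xi) ->
  exists2 d : R, 0 < d & exists2 G, smooth_on (ball t0 d) G &
    forall psi, Test (box t0 (d / 2)) psi -> f psi = integral_Rn (fun t => G t * psi t).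
Proof.
move=> tg g00 tf reg.
have [d0 d00 hd0] : exists2 d : R, 0 < d & forall chi, Test (box t0 d) chi -> forall M,
    exists2 C0 : R, 0 < C0 & forall xi, 1 <= `|xi| ->
      normc (f (fun t => chi t * wave (- xi) t)) <= C0 / `|xi| ^+ M.
  apply: decay_all_directions => xi0 xi01.
  have xi0n : xi0 != 0 by rewrite -normr_eq0 xi01 oner_eq0.
  have [u su [ut0 [e [e0 e1 hu]]]] := window_decay tg g00 (reg _ xi0n) xi01.
  have [d dpos hd] := local_decay tf su ut0 e0 xi01 e1 hu.
  by exists d => //; exists e.
have decay := decay_bracket2 tf hd0.
pose d1 := Num.min d0 (1 / 4).
have d10 : 0 < d1 by rewrite lt_min d00/=; lra.
have d14 : d1 <= 1 / 4 by rewrite /d1 ge_min lexx orbT.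
have d1d0 : d1 <= d0 by rewrite /d1 ge_min lexx.
have [chi tchi [chi0 _]] := bump_exists t0 tg g00 d10.
have tchi0 : Test (box t0 d0) chi by apply: TestW tchi => x; exact: box_incl.
have [F sF hF] := local_representative tf d10 d14 tchi (decay chi tchi0).
have schi := Test_Smooth tchi.
pose W := [set x | chi x != 0].
have oW : open W by exact: open_neq0.
have /nbhs_ballP[s /= s0 hs] : nbhs t0 W by exact: open_nbhs_nbhs.
pose d := Num.min s d1.
have dd : 0 < d by rewrite lt_min s0.
have ds : d <= s by rewrite /d ge_min lexx.
have dd1 : d <= d1 by rewrite /d ge_min lexx orbT.
exists d => //; exists (fun t => F t * (chi t)^-1).
  apply: (@smooth_onW _ _ W); first by apply: subset_trans hs; exact: le_ball.
  apply: (smooth_onM oW); first exact: Smooth_on.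
  by apply: (smooth_onV oW); first exact: Smooth_on.
move=> psi tpsi.
have W0 x : box t0 (d / 2) x -> chi x != 0.
  move=> bx; apply: hs; rewrite -ball_normE /= distrC.
  have d2 : 0 <= d / 2 by nonnegativity.
  apply: le_lt_trans (proj1 (box_norm t0 x d2) bx) _; lra.
have tq : Test (box t0 (d / 2)) (fun t => psi t / chi t) by exact: Test_div.
have tq1 : Test (box t0 d1) (fun t => psi t / chi t).
  by apply: TestW tq => x; apply: box_incl; lra.
have := hF _ tq1.
rewrite (_ : (fun t => chi t * _) = psi); last first.
  apply/funext => t; have [bt|bt] := pselect (box t0 (d / 2) t).
    by rewrite mulrC divfK// W0.
  by rewrite (Test_out tpsi bt) mul0r mulr0.
move=> ->; congr integral_Rn; apply/funext => t; ring.
Qed.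

End LocalSmoothness.

(** * Gluing the local representatives *)

Section Gluing.
Context {R : realType} {n : nat}.
Local Notation V := ('rV[R]_n).
Local Notation C := (R[i]).
Local Notation mu := (lebesgue_tuple n).
Implicit Types (u v w chi psi F G : V -> C) (x c xi eta t : V) (i : 'I_n) (f : @functional R n).

Lemma integral_real (v : V -> R) : Cc (fun t => (v t)%:C%C) ->
  integral_Rn (fun t => (v t)%:C%C) = (\int[mu]_t v (rowt t))%:C%C.
Proof.
move=> cv; rewrite integral_RnE; apply: complex_ext => //=.
by rewrite /Rintegral integral0_eq.
Qed.

(** Two continuous functions with the same integrals against bumps agree: test
their difference [D], rotated so that [Re D > 0], against a small bump. *)
Lemma representative_unique (g0 : R -> C) x (d : R) G H :
  test_function1 g0 -> g0 0 != 0 -> 0 < d ->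
  smooth_on (ball x d) G -> smooth_on (ball x d) H ->
  (forall r : R, 0 < r -> exists2 s : R, 0 < s <= r & forall psi, Test (box x s) psi ->
     integral_Rn (fun t => G t * psi t) = integral_Rn (fun t => H t * psi t)) ->
  G x = H x.
Proof.
move=> tg g00 d0 sG sH hGH; apply/eqP; rewrite -subr_eq0; apply/negP => /negP k0.
pose k := G x - H x; pose D t := (k^*)%C * (G t - H t).
have ob : open (ball x d) by exact: ball_open.
have sD : smooth_on (ball x d) D.
  have -> : D = fun t => (k^*)%C * G t + (- (k^*)%C) * H t.
    by apply/funext => t; rewrite /D; ring.
  by apply: (smooth_onD ob); (apply: (smooth_onM ob); [exact: (smooth_on_cst _ ob)|]).
have Dx : 0 < Re (D x).
  rewrite /D -/k cReM cReJ cImJ mulNr opprK -!expr2 -sqr_normcE exprn_gt0//.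
  by rewrite normc_gt0.
have [cD _] := smooth_on_cont sD (ballxx x d0).
have /nbhs_ballP[s /= s0 hs] : \forall t \near x, 0 < Re (D t).
  by apply: (cD [set y | 0 < y]); apply: open_nbhs_nbhs; split => //; exact: open_gt.
pose r := Num.min s d / 2.
have sd0 : 0 < Num.min s d by rewrite lt_min s0.
have r0 : 0 < r by rewrite divr_gt0.
have [s1 /andP[s10 s1r] hint] := hGH r r0.
have small t : box x s1 t -> ball x s t /\ ball x d t.
  move=> bt; have h : `|x - t| < Num.min s d.
    rewrite distrC; apply: le_lt_trans (proj1 (box_norm x t (ltW s10)) bt) _.
    by apply: le_lt_trans s1r _; rewrite /r; lra.
  by rewrite lt_min in h; case/andP: h => h1 h2; rewrite -ball_normE.
have [b tb [bx breal]] := bump_exists x tg g00 s10.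
have sub : box x s1 `<=` ball x d by move=> t /small[].
have tD := Test_mul_smooth_on ob sub tb sD.
have tG := Test_mul_smooth_on ob sub tb sG.
have tH := Test_mul_smooth_on ob sub tb sH.
have ID : integral_Rn (fun t => D t * b t) = 0.
  have -> : (fun t => D t * b t) = (fun t => (k^*)%C * ((-1) * (H t * b t) + G t * b t)).
    by apply/funext => t; rewrite /D; ring.
  rewrite integralZ; last by apply: Cc_lin; [exact: Test_Cc tH|exact: Test_Cc tG].
  rewrite integral_lin; [|exact: Test_Cc tH|exact: Test_Cc tG].
  by rewrite (hint b tb) mulN1r addNr mulr0.
have cu : Cc (fun t => (Re (D t * b t))%:C%C).
  have [cDb [q hq]] := Test_Cc tD; split; first by move=> t; exact: cont_at_Re.
  by exists q => t ht; apply: hq; apply: contra ht => /eqP ->.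
suff /eqP : integral_Rn (fun t => (Re (D t * b t))%:C%C : C) != 0.
  apply; rewrite (integral_real cu).
  by have := congr1 (@complex.Re R) ID; rewrite integral_RnE /= => ->.
apply: (@integral_neq0 _ _ _ x cu).
  move=> t; exists (Re (D t * b t)) => //.
  have [y y0 bE] := breal t.
  have [b0|nb] := eqVneq (b t) 0; first by rewrite b0 mulr0.
  have [/hs Dt _] := small t (Test_supp tb nb).
  by rewrite bE cReM /= mulr0 subr0 mulr_ge0// ltW.
have [y y0 bE] := breal x.
have yp : 0 < y by move: bx; rewrite bE -normc_gt0 normc_real ger0_norm.
rewrite -normc_gt0 normc_real normr_gt0 bE cReM /= mulr0 subr0.
by rewrite gt_eqF// mulr_gt0.
Qed.

Lemma smooth_locally_integrable F : Smooth F -> locally_integrable_Rn setT F.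
Proof.
move=> sF K cK _.
have [M hM] : exists M : R, K `<=` box 0 M.
  have [M [_ hM]] := compact_bounded cK.
  exists (M + 1) => x /(hM (M + 1) (ltr_pwDr ltr01 (lexx _))) /= xM i.
  by rewrite mxE subr0; apply: le_trans (coord_le_norm x i) xM.
have mK : measurable (@rowt R n @^-1` K).
  have oK : open (~` K) by apply: closed_openC; apply: compact_closed => //; exact: norm_hausdorff.
  by rewrite -[K]setCK preimage_setC; apply: measurableC; exact: measurable_rowt_open oK.
pose M' := Num.max M 0.
have M'0 : 0 <= M' by rewrite le_max lexx orbT.
have Kfin : (mu (@rowt R n @^-1` K) < +oo)%E.
  apply: (@le_lt_trans _ _ (mu (@rowt R n @^-1` box 0 M'))); last by rewrite measure_box ?ltry.
  apply: le_measure; rewrite ?inE//; first exact: measurable_box.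
  by move=> t /hM; apply: box_incl; rewrite le_max lexx.
have real (v : V -> R) : (forall x, {for x, continuous v}) ->
    mu.-integrable (@rowt R n @^-1` K) (fun s : n.-tuple (measurableTypeR R) => (v (rowt s))%:E).
  move=> cv.
  have [|B hB] := @cont_bounded_on_compact R n (fun x => `|v x|) _ cK.
    by move=> x; apply: (@continuous_comp _ _ _ v Num.norm) => //; exact: norm_continuous.
  apply: (@measurable_bounded_integrable _ _ _ mu (v \o @rowt R n)) => //.
    by apply: measurable_funTS; exact: measurable_rowt_continuous.
  by apply: pinfty_bound; exists B => B' BB' t /= Kt; exact: le_trans (hB _ Kt) BB'.
split; [apply: (real (fun t => Re (F t)))|apply: (real (fun t => Im (F t)))] => x.
  by have [] := Smooth_cont x sF.
by have [] := Smooth_cont x sF.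
Qed.

(** Local smooth representatives agree where they overlap, and a partition of
unity reduces a test function to the local ones. *)
Lemma glue f (g0 : R -> C) : test_function1 g0 -> g0 0 != 0 -> tempered f ->
  (forall t0, exists2 d : R, 0 < d & exists2 G, smooth_on (ball t0 d) G &
    forall psi, Test (box t0 (d / 2)) psi -> f psi = integral_Rn (fun t => G t * psi t)) ->
  exists2 F, Smooth F & forall psi, Test setT psi -> f psi = integral_Rn (fun t => F t * psi t).
Proof.
move=> tg g00 tf loc.
pose d t : R := projT1 (cid2 (loc t)).
have d0 t : 0 < d t by rewrite /d; case: cid2.
have locG t : exists2 G, smooth_on (ball t (d t)) G &
    forall psi, Test (box t (d t / 2)) psi -> f psi = integral_Rn (fun y => G y * psi y).
  by rewrite /d; case: cid2.
pose G t := projT1 (cid2 (locG t)).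
have sG t : smooth_on (ball t (d t)) (G t) by rewrite /G; case: cid2.
have fG t psi : Test (box t (d t / 2)) psi -> f psi = integral_Rn (fun y => G t y * psi y).
  by rewrite /G; case: cid2 => /= ? _; apply.
have d2 t : 0 < d t / 2 by rewrite divr_gt0.
pose F x := G x x.
have FG t x : ball t (d t / 2) x -> F x = G t x.
  move=> tx.
  have /nbhs_ballP[e /= e0 he] : nbhs x (ball t (d t / 2)).
    by apply: open_nbhs_nbhs; split => //; exact: ball_open.
  have le2 : ball t (d t / 2) `<=` ball t (d t) by apply: le_ball; have := d0 t; lra.
  pose m := Num.min e (d x).
  have m0 : 0 < m by rewrite lt_min e0 d0.
  have mx : ball x m `<=` ball x (d x) by apply: le_ball; rewrite /m ge_min lexx orbT.
  have mt : ball x m `<=` ball t (d t / 2).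
    by apply: subset_trans he; apply: le_ball; rewrite /m ge_min lexx.
  rewrite /F; apply: (representative_unique tg g00 m0).
  - exact: smooth_onW (sG x).
  - by apply: smooth_onW (sG t); exact: subset_trans le2.
  move=> r r0; pose s := Num.min r (m / 4).
  have s0 : 0 < s by rewrite lt_min r0/= divr_gt0.
  have sm : s <= m / 4 by rewrite /s ge_min lexx orbT.
  exists s; first by rewrite s0 /s ge_min lexx.
  move=> psi tpsi; rewrite -fG; last first.
    apply: TestW tpsi => y; apply: box_incl.
    have : m <= d x by rewrite /m ge_min lexx orbT.
    lra.
  rewrite -fG//; apply: TestW tpsi => y by'.
  apply/box_norm; first exact: ltW.
  have : ball x m y.
    rewrite -ball_normE /= distrC.
    by apply: le_lt_trans (proj1 (box_norm x y (ltW s0)) by') _; lra.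
  by move=> /mt; rewrite -ball_normE /= distrC => /ltW.
have sF : Smooth F.
  split; apply: smooth_on_bigcover => x _.
  exists (ball x (d x / 2)); first exact: ballxx.
  apply: (@smooth_on_eq _ _ _ (G x)); [exact: ball_open|by move=> y /FG ->|].
  by apply: smooth_onW (sG x); apply: le_ball; have := d0 x; lra.
exists F => // psi tpsi.
have d4 t : 0 < d t / 4 by rewrite divr_gt0.
have bump t : exists b : V -> C, [/\ Test (box t (d t / 4)) b, b t != 0 &
    forall x, exists2 y : R, 0 <= y & b x = y%:C%C].
  by have [b tb [bt hb]] := bump_exists t tg g00 (d4 t); exists b.
pose b t := projT1 (cid (bump t)).
have tb t : Test (box t (d t / 4)) (b t) by rewrite /b; case: cid => ? [].
have bt t : b t t != 0 by rewrite /b; case: cid => ? [].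
have breal t x : exists2 y : R, 0 <= y & b t x = y%:C%C.
  by rewrite /b; case: cid => ? [].
have := tpsi; case=> spsi cpsi _.
have [S _ hS] : finite_subset_cover [set: V] (fun t => [set x | b t x != 0]) (support_set psi).
  move: cpsi; rewrite compact_cover; apply.
  - by move=> t _; apply: open_neq0; exact: Test_Smooth (tb t).
  - by move=> x _; exists x => //=.
pose B x := \sum_(t : S) b (fsval t) x.
have sB : Smooth B by apply: Smooth_sum => t; exact: Test_Smooth (tb _).
have B0 x : support_set psi x -> B x != 0.
  move=> /hS[t /= tS btx].
  rewrite -normc_gt0; apply: lt_le_trans (le_trans (ler_norm _) (Re_le_normc _)).
  rewrite /B Re_sum (bigD1 [` tS]%fset)//= ltr_wpDr//.
    by apply: sumr_ge0 => s _; have [y y0 ->] := breal (fsval s) x.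
  by move: btx; have [y y0 ->] := breal t x; rewrite -normc_gt0 normc_real ger0_norm.
have tpsi' : Test (support_set psi) psi by split.
have tq : Test (support_set psi) (fun x => psi x / B x) by exact: Test_div.
pose part (t : S) x := b (fsval t) x * (psi x / B x).
have tpart (t : S) : Test (box (fsval t) (d (fsval t) / 4)) (part t).
  exact: Test_mulr (tb _) (Test_Smooth tq).
have psiE : psi = fun x => \sum_(t : S) 1 * part t x.
  apply/funext => x; under eq_bigr do rewrite mul1r.
  rewrite /part -mulr_suml -/(B x).
  have [hx|hx] := pselect (support_set psi x); first by rewrite mulrC divfK// B0.
  by rewrite (support_setP hx) mul0r mulr0.
have [_ Ef] := tempered_sum (fun=> 1) tf (fun t : S => Test_Schwartz (tpart t)).
have cF (t : S) : Cc (fun x => F x * part t x).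
  by apply: Cc_mul (Test_Cc (tpart t)) => x; exact: Smooth_cont.
have [_ Ei] := integral_sum (fun=> 1) cF.
rewrite [X in f X]psiE Ef.
have -> : (fun t => F t * psi t) = (fun x => \sum_(t : S) 1 * (F x * part t x)).
  apply/funext => x; rewrite {1}psiE mulr_sumr; apply: eq_bigr => t _.
  by rewrite !mul1r.
rewrite Ei; apply: eq_bigr => t _; congr (_ * _).
have tp : Test (box (fsval t) (d (fsval t) / 2)) (part t).
  by apply: TestW (tpart t) => x; apply: box_incl; have := d0 (fsval t); lra.
rewrite (fG _ _ tp); congr integral_Rn; apply/funext => x.
have [->|px] := eqVneq (part t x) 0; first by rewrite !mulr0.
rewrite (FG (fsval t))//.
have bx := Test_supp (tpart t) px.
rewrite -ball_normE /= distrC.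
apply: le_lt_trans (proj1 (box_norm _ _ (ltW (d4 (fsval t)))) bx) _.
by have := d0 (fsval t); lra.
Qed.

End Gluing.

Theorem theorem5p7 (R : realType) (n k : nat) (k_gt0 : (1 <= k)%N)
    (le_kn : (k <= n)%N) (f : ('rV[R]_n -> R[i]) -> R[i]) :
  tempered f ->
  (forall (x : 'rV[R]_k) (xi : 'rV[R]_n), xi != 0 ->
     k_directionally_regular le_kn f x xi) ->
  exists2 F : 'rV[R]_n -> R[i], smooth F & is_function_on setT f F.
Proof.
move=> tf reg.
have n_gt0 : (0 < n)%N by exact: leq_trans k_gt0 le_kn.
have nz : delta_mx 0 (Ordinal n_gt0) != 0 :> 'rV[R]_n.
  apply/eqP => /matrixP/(_ 0 (Ordinal n_gt0)); rewrite !mxE !eqxx => /eqP.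
  by rewrite oner_eq0.
have [g [r [Gam [h [tg g0 _ _ _]]]]] := reg 0 _ nz.
pose i0 := Ordinal k_gt0.
have gi0 : g i0 0 != 0.
  apply: contra g0 => /eqP e; apply/eqP; rewrite /tensor (bigD1 i0)//= mxE e mul0r//.
have [F sF hF] := glue (tg i0) gi0 tf (fun t0 => local_smooth (tg i0) gi0 tf (reg (first_coords le_kn t0))).
exists F; first exact/SmoothP.
split; first exact: smooth_locally_integrable.
by move=> phi /TestP; exact: hF.
Qed.
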